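(* Consider a sequence of problems as in the context with $np\to\infty$. Assume that all eigenvalues of $\Sigma$ and of $\Psi$ lie in $[c^{-1},c]$ for some fixed constant $c>0$, and that $$\max_{1\le j\le q}|\beta_j|_0=o\Big(\frac{\sqrt{np}}{(\log\max(q,np))^{3/2}}\Big).$$ Let the fixed constant $\delta>0$ in the Lasso penalty level be large enough. Then there are sequences $a_{n1}=o(1/\log\max(q,np))$ and $a_{n2}=o((np\log q)^{-1/4})$ such that the Lasso estimators $\hat\beta_j(\delta)$ satisfy $$\max_{1\le j\le q}|\hat\beta_j(\delta)-\beta_j|_1=O_{\mathbb P}(a_{n1}),\qquad \max_{1\le j\le q}|\hat\beta_j(\delta)-\beta_j|_2=O_{\mathbb P}(a_{n2}).$$
   Context: Setting. $n\ge2$, $q\ge2$; $X^{(1)},\dots,X^{(n)}$ are i.i.d. $p\times q$ random matrices with matrix-variate normal distribution $N(\mu,\Sigma\otimes\Psi)$, meaning $\mathrm{vec}((X^{(k)})')\sim N(\mathrm{vec}(\mu'),\Sigma\otimes\Psi)$ (so $\mathrm{Cov}(X_{li},X_{mj})=\sigma_{lm}\psi_{ij}$), with $\Sigma\in\mathbb R^{p\times p}$, $\Psi\in\mathbb R^{q\times q}$ positive definite. $\Gamma=\Psi^{-1}=(\gamma_{ij})$. All of $n,p,q,\mu,\Sigma,\Psi$ may vary along the sequence; $n$ may stay bounded. $|x|_0$ is the number of nonzero entries of $x$; $|\cdot|_1,|\cdot|_2$ are the $\ell_1$ and Euclidean norms. For a row vector or matrix, the index $-j$ means that the $j$-th coordinate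 (row/column) is removed. Regression coefficients: $\beta_j=-\gamma_{jj}^{-1}\Gamma_{-j,j}\in\mathbb R^{q-1}$, $1\le j\le q$. Lasso estimator: let $\bar X=\frac1n\sum_kX^{(k)}$, $\hat\Psi=(\hat\psi_{ij})_{q\times q}=\frac1{(n-1)p}\sum_{k=1}^n(X^{(k)}-\bar X)'(X^{(k)}-\bar X)$, $D_j=\mathrm{diag}(\hat\Psi_{-j,-j})$ (the diagonal matrix with the diagonal of $\hat\Psi_{-j,-j}$), $\theta_{nj}(\delta)=\delta\sqrt{\hat\psi_{jj}\log\max(q,np)/(np)}$, $$\hat\alpha_j(\delta)\in\arg\min_{\alpha\in\mathbb R^{q-1}}\Big\{\frac1{2np}\sum_{k=1}^n\sum_{l=1}^p\big(X^{(k)}_{lj}-\bar X_{lj}-(X^{(k)}_{l,-j}-\bar X_{l,-j})D_j^{-1/2}\alpha\big)^2+\theta_{nj}(\delta)|\alpha|_1\Big\},\qquad \hat\beta_j(\delta)=D_j^{-1/2}\hat\alpha_j(\delta).$$ *)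

(* Defs.v *)
From HB Require Import structures.
From mathcomp Require Export all_boot all_order all_algebra.
From mathcomp Require Export all_classical all_reals all_analysis.
From mathcomp.real_closed Require Export mxtens.
Export Order.TTheory GRing.Theory Num.Theory.
Export numFieldNormedType.Exports.

Set Implicit Arguments.
Unset Strict Implicit.
Unset Printing Implicit Defensive.

Local Open Scope classical_set_scope.
Local Open Scope ring_scope.

Definition nnz (R : realType) (m : nat) (v : 'cV[R]_m) : nat :=
  #|[set i | v i 0 != 0]%SET|.

Definition norm1 (R : realType) (m : nat) (v : 'cV[R]_m) : R :=
  \sum_i `|v i 0|.

Definition norm2 (R : realType) (m : nat) (v : 'cV[R]_m) : R :=
  Num.sqrt (\sum_i v i 0 ^+ 2).

Definition posdefmx (R : realType) (m : nat) (A : 'M[R]_m) : Prop :=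
  A^T = A /\ forall x : 'rV[R]_m, x != 0 -> 0 < (x *m A *m x^T) 0 0.

Definition eigenvalues_in (R : realType) (m : nat) (A : 'M[R]_m) (a b : R) :
  Prop := forall x : R, eigenvalue A x -> a <= x <= b.

(** Columns stacked on top of each other. The index [mxtens_index (j, i)] is
    [j * m + i], the same index as in the Kronecker product [tensmx]. *)
Definition vec (R : realType) (m n : nat) (A : 'M[R]_(m, n)) :
    'cV[R]_(n * m) :=
  \col_k A (mxtens_unindex k).2 (mxtens_unindex k).1.

(** Mean [m] and variance [v]. The case [v = 0] is separate because
    [normal_prob m 0] is not the point mass at [m]. *)
Definition normal_law (R : realType) (d : measure_display)
    (T : measurableType d) (P : probability T R) (Y : T -> R) (m v : R) :
    Prop :=
  measurable_fun setT Y /\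
  forall B : set R, measurable B ->
    P (Y @^-1` B) = if v == 0 then \d_m B else normal_prob m (Num.sqrt v) B.

(** Every linear combination of the coordinates is normal, with the mean and
    variance prescribed by [m] and [V]. *)
Definition multinormal_law (R : realType) (d : measure_display)
    (T : measurableType d) (P : probability T R) (r : nat)
    (Y : T -> 'cV[R]_r) (m : 'cV[R]_r) (V : 'M[R]_r) : Prop :=
  forall a : 'rV[R]_r,
    normal_law P (fun w => (a *m Y w) 0 0)
      ((a *m m) 0 0) ((a *m V *m a^T) 0 0).

Definition matrix_normal_law (R : realType) (d : measure_display)
    (T : measurableType d) (P : probability T R) (p q : nat)
    (X : T -> 'M[R]_(p, q)) (mu : 'M[R]_(p, q))
    (Sigma : 'M[R]_p) (Psi : 'M[R]_q) : Prop :=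
  multinormal_law P (fun w => vec (X w)^T) (vec mu^T) (tensmx Sigma Psi).

(** The sigma-algebra on [T] generated by the entries of [X]. *)
Definition sigma_matrix (R : realType) (d : measure_display)
    (T : measurableType d) (p q : nat) (X : T -> 'M[R]_(p, q)) :
    set (set T) :=
  <<s [set A | exists (l : 'I_p) (j : 'I_q) (B : set R),
        measurable B /\ A = (fun w => X w l j) @^-1` B] >>.

Definition mutually_independent (R : realType) (d : measure_display)
    (T : measurableType d) (P : probability T R) (n p q : nat)
    (X : 'I_n -> T -> 'M[R]_(p, q)) : Prop :=
  forall (J : {set 'I_n}) (E : 'I_n -> set T),
    (forall k, k \in J -> sigma_matrix (X k) (E k)) ->
    P (\bigcap_(k in [set` J]) E k) = (\prod_(k in J) P (E k))%E.

(** Below, [X : 'I_n -> 'M_(p, q)] is one realization of the sample, and the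
    removal of index [j] is [row' j] or [col' j]. *)

Definition regression_coef (R : realType) (q : nat) (Psi : 'M[R]_q)
    (j : 'I_q) : 'cV[R]_q.-1 :=
  let Gamma := invmx Psi in - (Gamma j j)^-1 *: row' j (col j Gamma).

Definition sample_mean (R : realType) (n p q : nat)
    (X : 'I_n -> 'M[R]_(p, q)) : 'M[R]_(p, q) :=
  n%:R^-1 *: \sum_k X k.

Definition Psi_hat (R : realType) (n p q : nat)
    (X : 'I_n -> 'M[R]_(p, q)) : 'M[R]_q :=
  ((n.-1 * p)%:R)^-1 *:
    \sum_k (X k - sample_mean X)^T *m (X k - sample_mean X).

(** The matrix [D_j^(-1/2)]; almost surely no diagonal entry of [Psi_hat X]
    vanishes. *)
Definition D_invsqrt (R : realType) (n p q : nat)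
    (X : 'I_n -> 'M[R]_(p, q)) (j : 'I_q) : 'M[R]_q.-1 :=
  diag_mx (\row_i (Num.sqrt (row' j (col' j (Psi_hat X)) i i))^-1).

Definition log_dim (R : realType) (n p q : nat) : R :=
  ln (maxn q (n * p))%:R.

Definition lasso_penalty (R : realType) (n p q : nat)
    (X : 'I_n -> 'M[R]_(p, q)) (delta : R) (j : 'I_q) : R :=
  delta * Num.sqrt (Psi_hat X j j * log_dim R n p q / (n * p)%:R).

Definition lasso_objective (R : realType) (n p q : nat)
    (X : 'I_n -> 'M[R]_(p, q)) (delta : R) (j : 'I_q)
    (alpha : 'cV[R]_q.-1) : R :=
  (2 * (n * p)%:R)^-1 *
    \sum_(k < n) \sum_(l < p)
      (X k l j - sample_mean X l j
       - ((row l (col' j (X k)) - row l (col' j (sample_mean X)))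
            *m D_invsqrt X j *m alpha) 0 0) ^+ 2
  + lasso_penalty X delta j * norm1 alpha.

Definition lasso_argmin (R : realType) (n p q : nat)
    (X : 'I_n -> 'M[R]_(p, q)) (delta : R) (j : 'I_q)
    (alpha : 'cV[R]_q.-1) : Prop :=
  forall alpha' : 'cV[R]_q.-1,
    lasso_objective X delta j alpha <= lasso_objective X delta j alpha'.

Definition lasso_beta (R : realType) (n p q : nat)
    (X : 'I_n -> 'M[R]_(p, q)) (j : 'I_q) (alpha : 'cV[R]_q.-1) :
    'cV[R]_q.-1 :=
  D_invsqrt X j *m alpha.

(** [Y_N = O_P (a_N)]. The event [A] makes this meaningful without
    measurability of [Y_N], which is a function of an arbitrary selection of
    minimizers; for measurable [Y_N] one may take
    [A = {|Y_N| <= M |a_N|}]. *)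
Definition bigO_probability (R : realType) (d : nat -> measure_display)
    (T : forall N, measurableType (d N)) (P : forall N, probability (T N) R)
    (Y : forall N, T N -> R) (a : nat -> R) : Prop :=
  forall eps : R, 0 < eps -> exists2 M : R, 0 < M &
    \forall N \near \oo, exists A : set (T N),
      [/\ measurable A, ((1 - eps)%:E <= P N A)%E
        & forall w, A w -> `|Y N w| <= M * `|a N| ].

(* Main.v *)
(** For a fixed vector v, the form v Psi_hat v' is a weighted sum of squares of
    uncorrelated Gaussian coordinates. Its Laplace transform follows from the
    linear one by writing exp (z^2 / 2) = E exp (x z) and
    exp (- z^2 / 2) = E cos (x z) for an independent standard normal x; Chernoff's
    bound then gives |v Psi_hat v' - t v Psi v'| <= e c v Psi v' with overwhelming
    probability, where t = tr Sigma / p and e is of order sqrt (L / np),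
    L = log (max (q, np)). Let v_j be the coefficient vector of the residual of the
    population regression of column j, so that v_j Psi is proportional to the j-th
    basis vector. The bound for e_i +- e_k and e_i +- v_j, and polarization,
    control all entries of Psi_hat - t Psi and the noise e_i Psi_hat v_j'. The basic
    inequality of the Lasso yields errors of order s sqrt (L / np) in l1 and
    sqrt (s L / np) in l2, as s e -> 0 gives the restricted eigenvalue condition.
    As q may be exponentially large in np, e need not tend to 0; but s = 0 whenever
    e is not small, and then the Cauchy-Schwarz inequality bounds the noise by the
    penalty, so that the estimator vanishes. *)
Require Import Defs.
From mathcomp Require Import sesquilinear spectral complex.
From mathcomp Require Import measurable_realfun ring lra.

Set Implicit Arguments.
Unset Strict Implicit.
Unset Printing Implicit Defensive.

Local Open Scope classical_set_scope.
Local Open Scope ring_scope.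

(** * Symmetric matrices *)

(** The hypothesis describes the Gaussian matrices through the laws of linear functionals. This
    shapes the probabilistic part: neither joint densities nor rotations of Gaussian vectors occur,
    only expectations of exp and cos of linear forms, and the coordinates of the diagonalized form
    are never shown to be independent. A cosine with a phase stands in for the complex exponential.
    The limit t Psi differs from Psi by a scalar; this is harmless, since the regression
    coefficients do not change when Psi is scaled. Origin of the constants: with e = 12 sqrt (L /
    np) and (n - 1) p >= np / 2, Chernoff's exponent e^2 (n - 1) p / 16 is at least 4 L, and a union
    over 4 q^2 vectors leaves a failure probability of at most 8 / (np). The estimate is thus
    non-asymptotic and n may stay bounded. The threshold 48 c^4 for delta makes half the penalty
    dominate the noise on this event. The exponent 3/2 in the sparsity condition is what turns s
    sqrt (L / np) into o(1 / L). *)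

Lemma symmetric_eigenvalue (R : rcfType) (n : nat) (A : 'M[R]_n.+1) :
  A^T = A -> exists x, eigenvalue A x.
Proof.
(* Over the complex numbers the matrix is Hermitian, so the spectral theorem provides an eigenvalue;
   it is real, hence a root of the real characteristic polynomial. *)
move=> sA; pose B : 'M[R[i]]_n.+1 := map_mx (real_complex R) A.
have hB : B \is hermsymmx.
  apply: realsym_hermsym.
    apply/is_hermitianmxP; rewrite expr0 scale1r; apply/matrixP => i j.
    by rewrite !mxE -{1}sA mxE.
  by apply/mxOverP => i j; rewrite mxE complex_real.
have /orthomx_spectralP := hermitian_normalmx hB.
set U := spectralmx B; set d := spectral_diag B => BE.
have /mxOverP/(_ 0 0) dr := hermitian_spectral_diag_real hB.
have Uu : U \in unitmx by exact: spectral_unit.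
have : eigenvalue B (d 0 0).
  apply/eigenvalueP; exists (row 0 U).
    rewrite {1}BE -row_mul !mulmxA mulmxV// mul1mx.
    by rewrite mul_diag_mx; apply/rowP => j; rewrite !mxE.
  apply/negP => /eqP r0.
  have : (U *m invmx U) 0 0 = 0.
    rewrite mxE big1// => k _; move/rowP: r0 => /(_ k).
    by rewrite !mxE => ->; rewrite mul0r.
  by rewrite mulmxV// mxE eqxx => /eqP; rewrite oner_eq0.
rewrite eigenvalue_root_char; have /complex_realP[x ->] := dr.
rewrite /B -map_char_poly fmorph_root -eigenvalue_root_char => ?.
by exists x.
Qed.

Lemma mulmx_tr_gt0 (R : realDomainType) (n : nat) (w : 'rV[R]_n) :
  w != 0 -> 0 < (w *m w^T) 0 0.
Proof.
move=> w0; have wE : (w *m w^T) 0 0 = \sum_j w 0 j ^+ 2.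
  by rewrite mxE; apply: eq_bigr => j _; rewrite mxE expr2.
rewrite wE lt_neqAle sumr_ge0 ?andbT; last by move=> i _; rewrite sqr_ge0.
rewrite eq_sym; apply: contra w0; rewrite psumr_eq0; last first.
  by move=> i _; rewrite sqr_ge0.
move/allP => w0; apply/eqP/rowP => j; rewrite mxE.
by have /implyP/(_ isT) := w0 j (mem_index_enum _); rewrite sqrf_eq0 => /eqP.
Qed.

(* The reflection that exchanges [v] and the first basis vector. *)
Lemma householder (R : rcfType) (n : nat) (v : 'rV[R]_n.+1) :
  v *m v^T = 1%:M ->
  exists2 H : 'M[R]_n.+1, H *m H^T = 1%:M & row 0 H = v.
Proof.
move=> v1; pose e : 'rV[R]_n.+1 := delta_mx 0 0; pose w := v - e.
have [/eqP|w0] := eqVneq w 0.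
  rewrite subr_eq0 => /eqP ->; exists 1%:M; last by rewrite rowE mulmx1.
  by rewrite trmx1 mulmx1.
pose s := (w *m w^T) 0 0; pose H := 1%:M - (2 / s) *: (w^T *m w).
have s0 : s != 0 by rewrite gt_eqF// mulmx_tr_gt0.
have wwE : w *m w^T = s%:M by rewrite [LHS]mx11_scalar.
have HT : H^T = H.
  by rewrite /H linearB/= trmx1 linearZ/= trmx_mul trmxK.
exists H.
  have XX : (w^T *m w) *m (w^T *m w) = s *: (w^T *m w).
    by rewrite mulmxA -(mulmxA w^T w w^T) wwE mul_mx_scalar -scalemxAl.
  rewrite HT /H; move: (w^T *m w) XX => X XX.
  rewrite mulmxBl mul1mx mulmxBr mulmx1 -scalemxAl -scalemxAr XX !scalerA.
  have -> : 2 / s * (2 / s) * s = 2 / s + 2 / s by field.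
  by rewrite scalerDl; apply/matrixP => i j; rewrite !mxE; ring.
have sE : s = 2 - 2 * v 0 0.
  rewrite /s /w linearB/= mulmxBl !mulmxBr v1 /e trmx_delta mul_delta_mx.
  rewrite -[delta_mx 0 0 *m v^T]trmxK trmx_mul trmxK trmx_delta.
  by rewrite -colE !mxE/=; ring.
have ew : e *m w^T = (v 0 0 - 1)%:M.
  rewrite [LHS]mx11_scalar; congr _%:M.
  by rewrite -rowE !mxE eqxx.
rewrite rowE -/e /H mulmxBr mulmx1 -scalemxAr mulmxA ew mul_scalar_mx scalerA.
have -> : 2 / s * (v 0 0 - 1) = - 1.
  by move: s0; rewrite sE => s0; field.
by rewrite scaleN1r opprK /w addrC subrK.
Qed.

(** A real orthogonal matrix is wanted, whereas the complex spectral theorem yields a unitary one.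
    Hence the induction: a reflection moves a unit eigenvector to the first basis vector, symmetry
    clears the rest of the first row and column, and the remaining block is smaller. *)
Theorem symmetric_spectral (R : rcfType) (n : nat) (A : 'M[R]_n) :
  A^T = A ->
  exists (U : 'M[R]_n) (d : 'rV[R]_n), U *m U^T = 1%:M /\ A = U^T *m diag_mx d *m U.
Proof.
elim: n A => [A _|n IH A sA].
  by exists 1%:M, 0; split; apply/matrixP => [[]].
have [x /eigenvalueP[u uA u0]] := symmetric_eigenvalue sA.
pose r := (u *m u^T) 0 0.
have r0 : 0 < r := mulmx_tr_gt0 u0.
pose v := (Num.sqrt r)^-1 *: u.
have v1 : v *m v^T = 1%:M.
  rewrite /v linearZ/= -scalemxAl -scalemxAr scalerA [u *m _]mx11_scalar -/r.
  rewrite -invfM -expr2 sqr_sqrtr ?ltW// scale_scalar_mx mulVf// gt_eqF//.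
have vA : v *m A = x *: v by rewrite /v -scalemxAl uA scalerA mulrC -scalerA.
have [H HH Hv] := householder v1.
have HH' : H^T *m H = 1%:M by apply: mulmx1C.
pose A' : 'M[R]_(1 + n) := H *m A *m H^T.
have sA' : A'^T = A' by rewrite /A' !trmx_mul trmxK sA mulmxA.
have rA' : row 0 A' = x *: delta_mx 0 0.
  rewrite /A' !row_mul Hv vA -scalemxAl -Hv -row_mul HH.
  by rewrite rowE mulmx1.
have AE' : A = H^T *m A' *m H.
  by rewrite /A' !mulmxA HH' mul1mx -mulmxA HH' mulmx1.
clearbody A'.
have A'B : A' = block_mx x%:M 0 0 (drsubmx A').
  rewrite -[LHS]submxK; congr block_mx.
  - rewrite [LHS]mx11_scalar; congr _%:M; move/rowP: rA' => /(_ 0).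
    rewrite !mxE/= mulr1 => <-; congr (A' _ _); exact/val_inj.
  - apply/rowP => j; move/rowP: rA' => /(_ (rshift 1 j)).
    rewrite !mxE/= mulr0 => <-; congr (A' _ _); exact/val_inj.
  - apply/colP => j; move/rowP: rA' => /(_ (rshift 1 j)); rewrite -{1}sA'.
    rewrite !mxE/= mulr0 => <-; congr (A' _ _); exact/val_inj.
have sD : (drsubmx A')^T = drsubmx A'.
  by rewrite trmx_drsub sA'.
have [U2 [d2 [U21 DE]]] := IH _ sD.
pose V : 'M[R]_(1 + n) := block_mx 1%:M 0 0 U2.
have VT : V^T = block_mx 1%:M 0 0 U2^T by rewrite /V tr_block_mx !trmx0 trmx1.
have V1 : V *m V^T = 1%:M.
  rewrite VT /V mulmx_block !mul1mx !mulmx0 !mul0mx.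
  by rewrite !addr0 !add0r U21 -scalar_mx_block.
exists (V *m H), (row_mx x%:M d2); split.
  by rewrite trmx_mul -mulmxA (mulmxA H) HH mul1mx.
have -> : diag_mx (row_mx x%:M d2) = block_mx x%:M 0 0 (diag_mx d2).
  rewrite diag_mx_row; congr block_mx.
  by apply/matrixP => i j; rewrite !ord1 !mxE eqxx.
rewrite AE'.
rewrite trmx_mul !mulmxA; congr (_ *m H); rewrite -!mulmxA; congr (_ *m _).
rewrite A'B; have -> : V^T *m (block_mx x%:M 0 0 (diag_mx d2) *m V) =
    block_mx x%:M 0 0 (U2^T *m diag_mx d2 *m U2); last by rewrite -DE.
rewrite VT /V !mulmx_block.
by rewrite !(mul1mx, mulmx0, mul0mx, mulmx1, addr0, add0r) mulmxA.
Qed.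

Section eigenbounds.
Variables (R : rcfType) (n : nat) (A U : 'M[R]_n) (d : 'rV[R]_n).
Hypotheses (UU : U *m U^T = 1%:M) (AE : A = U^T *m diag_mx d *m U).

Lemma spectral_eigenvalue i : eigenvalue A (d 0 i).
Proof.
apply/eigenvalueP; exists (row i U).
  rewrite AE -row_mul !mulmxA UU mul1mx.
  by rewrite mul_diag_mx; apply/rowP => j; rewrite !mxE.
apply/negP => /eqP r0; have : (U *m U^T) i i = 0.
  rewrite mxE big1// => k _; move/rowP: r0 => /(_ k).
  by rewrite !mxE => ->; rewrite mul0r.
by rewrite UU mxE eqxx => /eqP; rewrite oner_eq0.
Qed.

Lemma spectral_quad (x : 'rV[R]_n) :
  (x *m A *m x^T) 0 0 = \sum_i d 0 i * (x *m U^T) 0 i ^+ 2.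
Proof.
have -> : x *m A *m x^T = (x *m U^T) *m diag_mx d *m (x *m U^T)^T.
  by rewrite AE trmx_mul trmxK !mulmxA.
set y := x *m U^T; rewrite mxE; apply: eq_bigr => i _.
by rewrite mul_mx_diag !mxE; ring.
Qed.

Lemma spectral_norm (x : 'rV[R]_n) :
  (x *m x^T) 0 0 = \sum_i (x *m U^T) 0 i ^+ 2.
Proof.
have -> : x *m x^T = (x *m U^T) *m (x *m U^T)^T.
  by rewrite trmx_mul trmxK -mulmxA (mulmxA U^T) (mulmx1C UU) mul1mx.
by rewrite mxE; apply: eq_bigr => i _; rewrite !mxE expr2.
Qed.

Lemma spectral_trace : \tr A = \sum_i d 0 i.
Proof. by rewrite AE mxtrace_mulC mulmxA UU mul1mx mxtrace_diag. Qed.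

End eigenbounds.

Section eigenvalues_bounds.
Variables (R : realType) (n : nat) (A : 'M[R]_n) (a b : R).
Hypotheses (sA : A^T = A) (hA : eigenvalues_in A a b).

Lemma quad_bounds (x : 'rV[R]_n) :
  a * (x *m x^T) 0 0 <= (x *m A *m x^T) 0 0 <= b * (x *m x^T) 0 0.
Proof.
have [U [d [UU AE]]] := symmetric_spectral sA.
rewrite (spectral_quad AE) (spectral_norm UU) !mulr_sumr.
by apply/andP; split; apply: ler_sum => i _; apply: ler_wpM2r; rewrite ?sqr_ge0//;
  have /andP[] := hA (spectral_eigenvalue UU AE i).
Qed.

Lemma trace_bounds : a * n%:R <= \tr A <= b * n%:R.
Proof.
have [U [d [UU AE]]] := symmetric_spectral sA.
rewrite (spectral_trace UU AE) !mulr_natr.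
by apply/andP; split; rewrite -[in X in _ *+ X](card_ord n) -sumr_const;
  apply: ler_sum => i _; have /andP[] := hA (spectral_eigenvalue UU AE i).
Qed.

Lemma unitmx_eigenvalues : 0 < a -> A \in unitmx.
Proof.
move=> a0; rewrite -row_free_unit; apply/negPn/negP => nf.
have : eigenvalue A 0.
  rewrite /eigenvalue /eigenspace -kermx_eq0 in nf *.
  by rewrite raddf0 subr0.
by move/hA; rewrite leNgt a0.
Qed.

(* For y = x A^-1 one has x A^-1 x^T = y A y^T and x x^T = |y A|^2, and
   a A <= A^2 <= b A. *)
Lemma quad_inv_bounds (x : 'rV[R]_n) : 0 < a ->
  b^-1 * (x *m x^T) 0 0 <= (x *m invmx A *m x^T) 0 0 <= a^-1 * (x *m x^T) 0 0.
Proof.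
move=> a0; have uA := unitmx_eigenvalues a0.
have [U [d [UU AE]]] := symmetric_spectral sA.
pose y := x *m invmx A.
have xE : x = y *m A by rewrite /y mulmxKV.
have -> : (x *m invmx A *m x^T) 0 0 = \sum_i d 0 i * (y *m U^T) 0 i ^+ 2.
  by rewrite -/y xE trmx_mul sA mulmxA (spectral_quad AE).
have -> : (x *m x^T) 0 0 = \sum_i d 0 i * (d 0 i * (y *m U^T) 0 i ^+ 2).
  rewrite xE (spectral_norm UU); apply: eq_bigr => i _.
  rewrite {1}AE !mulmxA -(mulmxA _ U) UU mulmx1 mul_mx_diag mxE; ring.
rewrite !mulr_sumr.
have dab i : a <= d 0 i <= b := hA (spectral_eigenvalue UU AE i).
apply/andP; split; apply: ler_sum => i _; have /andP[ad db] := dab i;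
  have d0 := lt_le_trans a0 ad; have b0 := lt_le_trans d0 db.
  rewrite ler_pdivrMl//; apply: ler_wpM2r => //.
  by rewrite mulr_ge0 ?sqr_ge0// ltW.
rewrite ler_pdivlMl//; apply: ler_wpM2r => //.
by rewrite mulr_ge0 ?sqr_ge0// ltW.
Qed.

End eigenvalues_bounds.

(** * Gaussian integrals *)

Import HBNNSimple.

(** The passage from sets to nonnegative functions through simple functions, done once for three
    uses: a density [G] with [U] the identity, the law of [U] with [G] equal to 1, and independence,
    where [G] is the product of the other factors. *)
Lemma ge0_integral_transfer (d1 d2 : measure_display) (T1 : measurableType d1)
    (T2 : measurableType d2) (R : realType)
    (m : {measure set T1 -> \bar R}) (nu : {measure set T2 -> \bar R})
    (G : T1 -> R) (U : T1 -> T2) :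
  measurable_fun setT G -> (forall x, 0 <= G x) -> measurable_fun setT U ->
  (forall B, measurable B -> (\int[m]_x (G x * \1_B (U x))%:E = nu B)%E) ->
  forall f : T2 -> R, measurable_fun setT f -> (forall y, 0 <= f y) ->
  (\int[m]_x (G x * f (U x))%:E = \int[nu]_y (f y)%:E)%E.
Proof.
move=> mG G0 mU mnu f mf f0.
have mf' : measurable_fun setT (EFin \o f) by exact/measurable_EFinP.
pose f_ := nnsfun_approx measurableT mf'.
have cf y : EFin \o f_^~ y @ \oo --> (f y)%:E.
  by apply: (cvg_nnsfun_approx measurableT mf') => // x _; rewrite lee_fin.
have mfU n : measurable_fun setT (f_ n \o U).
  by apply: measurableT_comp => //; exact: measurable_funP.
transitivity (limn (fun n => \int[nu]_y (f_ n y)%:E)%E); last first.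
  rewrite -monotone_convergence//.
  - by apply: eq_integral => y _; apply/cvg_lim => //; exact: cf.
  - by move=> n; exact/measurable_EFinP/measurable_funP.
  - by move=> n y _; rewrite lee_fin.
  - by move=> y _ i j ij; rewrite lee_fin; exact/lefP/nd_nnsfun_approx.
transitivity (limn (fun n => \int[m]_x (G x * f_ n (U x))%:E)%E).
  rewrite -monotone_convergence//.
  - apply: eq_integral => x _; apply/esym/cvg_lim => //.
    under eq_fun do rewrite EFinM.
    by rewrite EFinM; apply: cvgeZl => //; exact: cf.
  - by move=> n; apply/measurable_EFinP/measurable_funM => //; exact: mfU.
  - by move=> n x _; rewrite lee_fin mulr_ge0.
  - move=> x _ i j ij; rewrite lee_fin ler_wpM2l//.
    exact/lefP/nd_nnsfun_approx.
congr (limn _); apply/funext => n.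
have mB r : measurable (f_ n @^-1` [set r]) by [].
have mI (B : set T2) : measurable B -> measurable_fun setT (fun x => \1_B (U x) : R).
  move=> mB'; have : measurable_fun setT ((\1_B : T2 -> R) \o U); last by [].
  by apply: measurableT_comp => //; exact: measurable_indic.
transitivity (\sum_(r \in range (f_ n))
    \int[m]_x (r * (G x * \1_(f_ n @^-1` [set r]) (U x)))%:E)%E.
  rewrite -ge0_integral_fsum//; first last.
  - move=> r x _; rewrite lee_fin mulrCA mulr_ge0//.
    by have := nnfun_muleindic_ge0 (f_ n) r (U x); rewrite -EFinM lee_fin.
  - by move=> r; apply/measurable_EFinP; do 2 apply: measurable_funM => //; exact: mI.
  apply: eq_integral => x _; rewrite fsumEFin//; congr EFin.
  by rewrite fimfunE mulr_fsumr//; apply: eq_fsbigr => r _; rewrite mulrCA.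
transitivity (\sum_(r \in range (f_ n))
    \int[nu]_y (r * \1_(f_ n @^-1` [set r]) y)%:E)%E; last first.
  rewrite -ge0_integral_fsum//.
  - by apply: eq_integral => y _; rewrite fsumEFin// -fimfunE.
  - by move=> r; exact/measurable_EFinP/measurable_funM.
  - by move=> r y _; rewrite EFinM nnfun_muleindic_ge0.
apply: eq_fsbigr => r; rewrite inE => -[y _ yr].
have r0 : 0 <= r by rewrite -yr.
under eq_integral do rewrite EFinM.
rewrite ge0_integralZl//; last first.
- by move=> x _; rewrite lee_fin mulr_ge0.
- by apply/measurable_EFinP/measurable_funM => //; exact: mI.
rewrite mnu//; under [RHS]eq_integral do rewrite EFinM.
transitivity (r%:E * \int[nu]_y (\1_(f_ n @^-1` [set r]) y)%:E)%E.
  by rewrite integral_indic// setIT.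
rewrite -ge0_integralZl//.
by apply/measurable_EFinP; exact: measurable_indic.
Qed.

Lemma ge0_integral_normal_prob (R : realType) (m s : R) (f : R -> R) :
  measurable_fun setT f -> (forall y, 0 <= f y) ->
  (\int[normal_prob m s]_y (f y)%:E =
   \int[lebesgue_measure]_x (normal_pdf m s x * f x)%:E)%E.
Proof.
move=> mf f0; apply/esym.
apply: (@ge0_integral_transfer _ _ _ _ _ _ (normal_prob m s) _ id) => //.
- exact: measurable_normal_pdf.
- by move=> x; exact: normal_pdf_ge0.
move=> B mB; rewrite /normal_prob [RHS]integral_mkcond.
by apply: eq_integral => x _; rewrite epatch_indic EFinM.
Qed.

Lemma normal_mgf (R : realType) (s t : R) : s != 0 ->
  (\int[normal_prob 0 s]_x (expR (t * x))%:E = (expR (s ^+ 2 * t ^+ 2 / 2))%:E)%E.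
Proof.
move=> s0; rewrite ge0_integral_normal_prob; last 2 first.
- by apply: measurableT_comp => //; exact: measurable_funM.
- by move=> ?; exact: expR_ge0.
under eq_integral => x _.
  (* Completing the square gives a multiple of the density with mean [s ^+ 2 * t]. *)
  have -> : normal_pdf 0 s x * expR (t * x) =
      expR (s ^+ 2 * t ^+ 2 / 2) * normal_pdf (s ^+ 2 * t) s x.
    rewrite !normal_pdfE// /normal_fun -(mulrA (normal_peak s)) [RHS]mulrCA -!expRD; congr (_ * expR _).
    by field.
  rewrite EFinM; over.
rewrite ge0_integralZl//.
- by rewrite integral_normal_pdf mule1.
- by apply/measurable_EFinP; exact: measurable_normal_pdf.
- by move=> x _; rewrite lee_fin normal_pdf_ge0.
Qed.

(** The integrand times the density is a multiple of the centred density of variance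
    [(1 + 2 * k)^-1]. Negative [k] is allowed because the upper tail of a quadratic form needs
    growing exponentials. *)
Lemma normal_expR_sqr (R : realType) (k : R) : 0 < 1 + 2 * k ->
  (\int[normal_prob 0 1]_x (expR (- k * x ^+ 2))%:E = ((Num.sqrt (1 + 2 * k))^-1)%:E)%E.
Proof.
move=> k0; rewrite ge0_integral_normal_prob; last 2 first.
- by apply: measurableT_comp => //; exact: measurable_funM.
- by move=> ?; exact: expR_ge0.
pose r := Num.sqrt (1 + 2 * k).
have r0 : 0 < r by rewrite sqrtr_gt0.
have rr : r ^+ 2 = 1 + 2 * k by rewrite sqr_sqrtr// ltW.
under eq_integral => x _.
  have -> : normal_pdf 0 1 x * expR (- k * x ^+ 2) =
      r^-1 * normal_pdf 0 (r^-1) x.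
    rewrite !normal_pdfE ?invr_neq0 ?gt_eqF// /normal_fun -mulrA [RHS]mulrA -expRD.
    congr (_ * expR _).
      rewrite /normal_peak expr1n mul1r exprVn -mulrnAr.
      rewrite sqrtrM ?invr_ge0 ?exprn_ge0 ?ltW// sqrtrV ?exprn_ge0 ?ltW//.
      rewrite sqrtr_sqr gtr0_norm// invfM invrK mulrA mulVf ?mul1r// gt_eqF//.
    rewrite !subr0 exprVn rr; field; lra.
  rewrite EFinM; over.
rewrite ge0_integralZl//.
- by rewrite integral_normal_pdf mule1.
- by apply/measurable_EFinP; exact: measurable_normal_pdf.
- by move=> x _; rewrite lee_fin normal_pdf_ge0.
- by rewrite lee_fin invr_ge0 ltW.
Qed.

(** * The characteristic function of a centred normal law, in real form *)

Section normal_charfun.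
Variables (R : realType) (s : R).
Hypothesis s0 : s != 0.
Notation mu := (@lebesgue_measure R).
Let g := normal_pdf 0 s.

Let gE x : g x = normal_peak s * expR (- (s ^+ 2 *+ 2)^-1 * x ^+ 2).
Proof.
by rewrite /g normal_pdfE// /normal_fun subr0; congr (_ * expR _); ring.
Qed.

Let mg : measurable_fun setT g. Proof. exact: measurable_normal_pdf. Qed.

Let g0 x : 0 <= g x. Proof. exact: normal_pdf_ge0. Qed.

(** Since 1 + |x| <= 2 (exp x + exp (-x)), a multiple of [G] dominates [g] times any function of
    linear growth; the moment generating function at 1 and -1 makes [G] integrable. *)
Let G (x : R) := g x * expR (1 * x) + g x * expR (-1 * x).

Let norm_le_expR (x : R) : `|x| <= expR x + expR (- x).
Proof.
have [x0|x0] := leP 0 x.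
  by rewrite ger0_norm//; have := expR_ge1Dx x; have := expR_ge0 (- x); lra.
by rewrite ltr0_norm//; have := expR_ge1Dx (- x); have := expR_ge0 x; lra.
Qed.

Let integrable_mgf t : mu.-integrable setT (EFin \o (fun x => g x * expR (t * x))).
Proof.
have mf : measurable_fun setT (fun x : R => expR (t * x)).
  by apply: measurableT_comp => //; exact: measurable_funM.
apply/integrableP; split.
  by apply/measurable_EFinP; exact: measurable_funM.
under eq_integral do rewrite /= ger0_norm ?mulr_ge0 ?expR_ge0//.
rewrite -ge0_integral_normal_prob//.
by rewrite normal_mgf// ltry.
Qed.

Let integrable_G : mu.-integrable setT (EFin \o G).
Proof. exact: (integrableD measurableT (integrable_mgf 1) (integrable_mgf (-1))). Qed.

Let bounded_integrable (f : R -> R) (C : R) : measurable_fun setT f ->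
  (forall x, `|f x| <= C * (1 + `|x|)) ->
  mu.-integrable setT (EFin \o (fun x => f x * g x)).
Proof.
move=> mf fC.
have C0 : 0 <= C by have := fC 0; rewrite normr0 addr0 mulr1; apply: le_trans.
apply: (@le_integrable _ _ _ mu _ measurableT _ (EFin \o (fun x => (2 * C) * G x))).
- by apply/measurable_EFinP; exact: measurable_funM.
- move=> x _ /=; rewrite lee_fin normrM (ger0_norm (g0 x)).
  apply: le_trans (ler_norm _); rewrite /G !mul1r mulN1r.
  apply: le_trans (ler_wpM2r (g0 x) (fC x)) _.
  have -> : 2 * C * (g x * expR x + g x * expR (- x)) =
    C * (2 * (expR x + expR (- x))) * g x by ring.
  apply: ler_wpM2r => //; apply: ler_wpM2l => //.
  suff : 1 <= expR x + expR (- x) by have := norm_le_expR x; lra.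
  have := expR_ge1Dx x; have := expR_ge1Dx (- x); lra.
- exact: (integrableZl measurableT (2 * C) integrable_G).
Qed.

Let Cos (t b x : R) := cos (t * x + b).
Let Sin (t b x : R) := sin (t * x + b).

Let mlin (t b : R) : measurable_fun setT (fun x : R => t * x + b).
Proof. by apply: measurable_funD => //; exact: measurable_funM. Qed.

Let mCos t b : measurable_fun setT (Cos t b).
Proof.
apply: measurableT_comp (mlin t b).
by apply: continuous_measurable_fun => x; exact: continuous_cos.
Qed.

Let mSin t b : measurable_fun setT (Sin t b).
Proof.
apply: measurableT_comp (mlin t b).
by apply: continuous_measurable_fun => x; exact: continuous_sin.
Qed.

Let norm_cos (x : R) : `|cos x| <= 1.
Proof. by rewrite ler_norml cos_geN1 cos_le1. Qed.

Let norm_sin (x : R) : `|sin x| <= 1.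
Proof. by rewrite ler_norml sin_geN1 sin_le1. Qed.

Let integrable_Cos t b : mu.-integrable setT (EFin \o (fun x => Cos t b x * g x)).
Proof.
apply: (@bounded_integrable _ 1) => // x; rewrite mul1r.
by apply: le_trans (norm_cos _) _; rewrite lerDl.
Qed.

Let integrable_xSin t b :
  mu.-integrable setT (EFin \o (fun x => (x * Sin t b x) * g x)).
Proof.
apply: (@bounded_integrable _ 1) => [|x]; first exact: measurable_funM.
rewrite mul1r normrM; have := norm_sin (t * x + b); rewrite -/(Sin t b x) => h.
by have := ler_wpM2l (normr_ge0 x) h; lra.
Qed.

Let is_derive_g (x : R) : is_derive x (1 : R) g (- (s ^+ 2)^-1 * x * g x).
Proof.
have -> : g = normal_peak s \*: (expR \o (- (s ^+ 2 *+ 2)^-1 \*: (fun x : R => x ^+ 2))).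
  by apply/funext => y; rewrite gE.
apply: is_derive_eq => /=; rewrite /GRing.scale/=; field; exact: s0.
Qed.

Let is_derive_Sin (t b x : R) : is_derive x (1 : R) (Sin t b) (t * Cos t b x).
Proof.
have : is_derive x (1 : R) (sin \o (fun x => t * x + b)) (cos (t * x + b) * t).
  apply: is_derive1_comp.
  apply: is_derive_eq; by rewrite addr0 scaler1.
by rewrite mulrC.
Qed.

Let is_derive_Cos (t b x : R) : is_derive t (1 : R) (fun t => Cos t b x) (- (x * Sin t b x)).
Proof.
have : is_derive t (1 : R) (cos \o (fun t => t * x + b)) (- sin (t * x + b) * x).
  apply: is_derive1_comp.
  have -> : (fun t => t * x + b) = (fun t => x * t + b).
    by apply/funext => ?; rewrite mulrC.
  by apply: is_derive_eq; rewrite addr0 scaler1.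
by rewrite mulNr mulrC.
Qed.

(* That the integral of [h t b] vanishes is the differential equation satisfied
   by the characteristic function [F b] below. *)
Let h (t b x : R) := s ^+ 2 * t * (Cos t b x * g x) - x * Sin t b x * g x.

Let is_derive_h t b x : is_derive x (1 : R) (s ^+ 2 \*: (Sin t b * g)) (h t b x).
Proof.
have := is_derive_Sin t b x; have := is_derive_g x => dg dS.
apply: is_derive_eq; rewrite /h /GRing.scale/= /Sin /Cos; field; exact: s0.
Qed.

Let integrable_h t b : mu.-integrable setT (EFin \o h t b).
Proof.
exact: (integrableB measurableT
  (integrableZl measurableT (s ^+ 2 * t) (integrable_Cos t b)) (integrable_xSin t b)).
Qed.

Let continuous_derive (f df : R -> R) : (forall x, is_derive x (1 : R) f (df x)) ->
  continuous f.
Proof.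
move=> fdf x; apply: differentiable_continuous; apply/derivable1_diffP.
by have [] := fdf x.
Qed.

Let integral_h_itv t b (a : R) : 0 < a ->
  (\int[mu]_(x in `[(- a)%R, a]) (h t b x)%:E =
    (s ^+ 2 * (Sin t b a - Sin t b (- a)) * g a)%:E)%E.
Proof.
move=> a0.
have cg := continuous_derive is_derive_g.
have cS := continuous_derive (is_derive_Sin t b).
have cH := continuous_derive (is_derive_h t b).
rewrite (@continuous_FTC2 _ _ (s ^+ 2 \*: (Sin t b * g))).
- rewrite -EFinB; congr EFin; rewrite /= /GRing.scale/=.
  have gN : g (- a) = g a by rewrite !gE sqrrN.
  change (s ^+ 2 * (Sin t b a * g a) - s ^+ 2 * (Sin t b (- a) * g (- a)) =
          s ^+ 2 * (Sin t b a - Sin t b (- a)) * g a).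
  by rewrite gN; ring.
- by lra.
- apply: continuous_subspaceT => x.
  apply: cvgB; apply: cvgM => //; last exact: cg.
  + exact: cvg_cst.
  + apply: cvgM; last exact: cg.
    have -> : Cos t b = Sin t (b + pi / 2).
      by apply/funext => y; rewrite /Cos /Sin addrA sinDpihalf.
    exact: (continuous_derive (is_derive_Sin t _)).
  + apply: cvgM; [exact: cvg_id|exact: cS].
- split.
  + by move=> x _; have [] := is_derive_h t b x.
  + by apply: cvg_at_right_filter; exact: cH.
  + by apply: cvg_at_left_filter; exact: cH.
- by move=> x _; rewrite derive1E; apply: derive_val.
Qed.

Let g_cvg0 : g n.+1%:R @[n --> \oo] --> (0 : R).
Proof.
pose k := (s ^+ 2 *+ 2)^-1.
have k0 : 0 < k by rewrite invr_gt0 mulrn_wgt0// exprn_even_gt0.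
have p0 : 0 <= normal_peak s := normal_peak_ge0 s.
(* This constant comes from exp y >= 1 + y with y = k x^2, which gives exp (-k x^2) <= (1 + 1/k) / x
   for x >= 1. *)
pose C := normal_peak s * (1 + k^-1).
apply: (@squeeze_cvgr _ _ _ _ (fun=> 0) (fun n => C * n.+1%:R^-1)).
- apply: nearW => n; rewrite g0/= gE -/k.
  rewrite /C -mulrA; apply: ler_wpM2l => //; rewrite mulNr expRN.
  rewrite ler_pdivlMr ?ltr0n// mulrC ler_pdivrMr ?expR_gt0//.
  have := expR_ge1Dx (k * n.+1%:R ^+ 2) => H.
  apply: le_trans (ler_wpM2l _ H); last by rewrite addr_ge0// invr_ge0 ltW.
  have -> : (1 + k^-1) * (1 + k * n.+1%:R ^+ 2) = 1 + k^-1 + k * n.+1%:R ^+ 2 + n.+1%:R ^+ 2.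
    by field; rewrite gt_eqF.
  have : 0 <= k^-1 by rewrite invr_ge0 ltW.
  have : 0 <= k * n.+1%:R ^+ 2 by rewrite mulr_ge0 ?sqr_ge0 ?ltW.
  have : (n.+1%:R : R) <= n.+1%:R ^+ 2 by rewrite expr2 ler_peMl// ler1n.
  by lra.
- exact: cvg_cst.
- by rewrite -[X in _ --> X](mulr0 C); apply: cvgM; [exact: cvg_cst|exact: cvg_harmonic].
Qed.

(** [h t b] is the derivative of a function that vanishes at infinity. Over growing symmetric
    intervals only boundary terms remain, and they are of the size of [g] at the end points. *)
Let integral_h t b : (\int[mu]_x (h t b x)%:E = 0)%E.
Proof.
pose D n : set R := `[- n.+1%:R, n.+1%:R]%classic.
have /integrableP[mh _] := integrable_h t b.
pose f_ n x := (h t b x * \1_(D n) x)%:E.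
have : (\int[mu]_x f_ n x @[n --> \oo] --> \int[mu]_x (h t b x)%:E)%E.
  apply: (@dominated_cvg _ _ _ mu setT measurableT f_ (fun x => (h t b x)%:E)
    (fun x => `|(h t b x)%:E|)%E).
  - move=> n; apply/measurable_EFinP; apply: measurable_funM.
      by move/measurable_EFinP: mh.
    by apply: measurable_indic; exact: measurable_itv.
  - move=> x _; apply: cvg_near_cst.
    near=> n; rewrite /f_ indicE mem_set ?mulr1//=.
    rewrite /D /= in_itv/= -ler_norml.
    near: n; exists (Num.Def.archi_bound `|x|) => // n /= Hn.
    apply: (le_trans (ltW (archi_boundP (normr_ge0 x)))).
    by rewrite ler_nat ltnW.
  - by move=> x _.
  - by apply: integrable_abse; exact: integrable_h.
  - move=> n x _; rewrite /f_ /= lee_fin normrM ler_piMr// indicE.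
    by case: (_ \in _); rewrite ?normr1 ?normr0.
move=> cv; apply/esym; apply: (cvg_unique _ _ cv) => //.
have -> : (fun n => \int[mu]_x f_ n x)%E =
    (fun n => (s ^+ 2 * (Sin t b n.+1%:R - Sin t b (- n.+1%:R)) * g n.+1%:R)%:E).
  apply/funext => n; rewrite -integral_h_itv ?ltr0n// [RHS]integral_mkcond.
  by apply: eq_integral => x _; rewrite epatch_indic /f_ EFinM.
apply: cvg_EFin; first by apply: nearW.
apply: (@squeeze_cvgr _ _ _ _ (fun n => - (2 * s ^+ 2) * g n.+1%:R)
   (fun n => (2 * s ^+ 2) * g n.+1%:R)).
- apply: nearW => n; rewrite mulNr -ler_norml normrM (ger0_norm (g0 _)).
  apply: ler_wpM2r => //; rewrite normrM ger0_norm ?sqr_ge0// mulrC.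
  apply: ler_wpM2r; first by rewrite sqr_ge0.
  apply: le_trans (ler_normB _ _) _.
  by have := norm_sin (t * n.+1%:R + b); have := norm_sin (t * - n.+1%:R + b); rewrite /Sin; lra.
- by rewrite -[X in _ --> X](mulr0 (- (2 * s ^+ 2))); apply: cvgM => //; exact: cvg_cst.
- by rewrite -[X in _ --> X](mulr0 (2 * s ^+ 2)); apply: cvgM => //; exact: cvg_cst.
Unshelve. all: end_near. Qed.

Let F b t := \int[mu]_x (Cos t b x * g x).

Let is_derive_F b t : is_derive t (1 : R) (F b) (- (s ^+ 2 * t * F b t)).
Proof.
pose f u x := Cos u b x * g x.
have df u x : is_derive u (1 : R) (f ^~ x) (- (x * Sin u b x * g x)).
  have := is_derive_Cos u b x => dC.
  have -> : f ^~ x = g x \*: (fun u => Cos u b x).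
    by apply/funext => y; rewrite /f /= mulrC.
  by apply: is_derive_eq; rewrite /GRing.scale/=; ring.
have pE u x : partial1of2 f u x = - (x * Sin u b x * g x).
  by rewrite partial1of2E; apply: derive_val.
(* Any bounded neighbourhood of [t] would serve: the dominating function |x| g(x) does not depend on
   the parameter. *)
have ti : `](t - 1), (t + 1)[%classic t by rewrite /= in_itv/=; apply/andP; split; lra.
have i1 x : `](t - 1), (t + 1)[%classic x -> mu.-integrable setT (EFin \o f x).
  by move=> _; exact: integrable_Cos.
have i2 u x : `](t - 1), (t + 1)[%classic u -> [set: R] x -> derivable (f ^~ x) u 1.
  by move=> _ _; have [] := df u x.
have i3 x : 0 <= `|x| * g x by rewrite mulr_ge0.
have i4 : mu.-integrable setT (EFin \o (fun x => `|x| * g x)).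
  apply: (@bounded_integrable _ 1) => // x.
  by rewrite normr_id mul1r lerDr.
have i5 u x : `](t - 1), (t + 1)[%classic u -> [set: R] x -> `|partial1of2 f u x| <= `|x| * g x.
  move=> _ _; rewrite pE normrN normrM (ger0_norm (g0 x)) ler_wpM2r// normrM.
  by rewrite ler_piMr// norm_sin.
have D1 := derivable_under_integral measurableT ti i1 i2 i3 i4 i5.
have D2 := differentiation_under_integral measurableT ti i1 i2 i3 i4 i5.
apply: DeriveDef; first exact: D1.
rewrite -derive1E; apply: etrans D2 _.
under eq_Rintegral do rewrite pE.
have : \int[mu]_x (h t b x) = 0 by rewrite /Rintegral integral_h.
rewrite /h RintegralB//; last first.
- exact: (integrableZl measurableT (s ^+ 2 * t) (integrable_Cos t b)).
rewrite RintegralZl//.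
rewrite -/(F b t) => /eqP; rewrite subr_eq0 => /eqP ->.
under eq_Rintegral do rewrite -mulN1r.
by rewrite RintegralZl// mulN1r.
Qed.

Let F0 b : F b 0 = cos b.
Proof.
rewrite /F /Cos; under eq_Rintegral do rewrite mul0r add0r.
rewrite RintegralZl//; last exact: integrable_normal_pdf.
by rewrite /Rintegral /g integral_normal_pdf mulr1.
Qed.

Let FE b t : F b t = cos b * expR (- (s ^+ 2 * t ^+ 2 / 2)).
Proof.
(* [E] solves the differential equation with the opposite sign, so [E * F b] is constant; this gives
   the solution without a uniqueness theorem. *)
pose E u := expR (s ^+ 2 * u ^+ 2 / 2).
have dE u : is_derive u (1 : R) E (s ^+ 2 * u * E u).
  have : is_derive u (1 : R) (expR \o ((s ^+ 2 / 2) \*: (fun u : R => u ^+ 2))) (s ^+ 2 * u * E u).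
    apply: is_derive_eq; rewrite /GRing.scale/= /E.
    have -> : (s ^+ 2 / 2) *: u ^+ 2 = s ^+ 2 * u ^+ 2 / 2.
      by rewrite /GRing.scale/=; ring.
    by field.
  have -> // : expR \o ((s ^+ 2 / 2) \*: (fun u : R => u ^+ 2)) = E.
  by apply/funext => y; rewrite /E /= /GRing.scale/=; congr expR; ring.
have : (E * F b) t = (E * F b) 0.
  apply: is_derive_0_is_cst => u.
  have := dE u; have := is_derive_F b u => dF dE'.
  by apply: is_derive_eq; rewrite /GRing.scale/=; ring.
rewrite /= => H; have {H} : E t * F b t = E 0 * F b 0 by [].
rewrite F0 {2}/E expr0n/= mulr0 mul0r expR0 mul1r => <-.
by rewrite mulrAC expRN mulfV ?mul1r// gt_eqF// expR_gt0.
Qed.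

Lemma normal_charfun t b :
  (\int[normal_prob 0 s]_x (cos (t * x + b))%:E =
   (cos b * expR (- (s ^+ 2 * t ^+ 2 / 2)))%:E)%E.
Proof.
have iC : (normal_prob 0 s).-integrable setT (EFin \o Cos t b).
  apply: (@le_integrable _ _ _ _ _ measurableT _ (EFin \o cst 1)).
  - by apply/measurable_EFinP; exact: mCos.
  - by move=> x _ /=; rewrite lee_fin normr1 norm_cos.
  - exact: finite_measure_integrable_cst.
(* Adding 1 makes the integrand nonnegative, so that the density formula for nonnegative functions
   applies. *)
have : (\int[normal_prob 0 s]_x (Cos t b x + 1)%:E =
        \int[normal_prob 0 s]_x (Cos t b x)%:E + 1)%E.
  under eq_integral do rewrite EFinD.
  rewrite integralD//; last exact: finite_measure_integrable_cst.
  by congr (_ + _)%E; rewrite integral_cst// mul1e; exact: probability_setT.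
rewrite (@ge0_integral_normal_prob _ 0 s (fun x => Cos t b x + 1)); last 2 first.
- exact: measurable_funD.
- by move=> x; have := cos_geN1 (t * x + b); rewrite /Cos; lra.
under eq_integral do rewrite -/g mulrDr mulr1 EFinD mulrC.
rewrite integralD//; last 2 first.
- exact: integrable_Cos.
- exact: integrable_normal_pdf.
rewrite integral_normal_pdf.
have -> : (\int[mu]_x (Cos t b x * g x)%:E = (F b t)%:E)%E.
  rewrite /F /Rintegral fineK//; apply: integrable_fin_num => //; exact: integrable_Cos.
rewrite FE -[X in (X + 1)%E = _]fineK//.
have := integrable_fin_num measurableT iC; rewrite /= => fI.
rewrite -[X in _ = (X + 1)%E](fineK fI) => -[] /addIr H.
by rewrite H (fineK fI).
Qed.

End normal_charfun.

Section bounded.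
Context (d : measure_display) (T : measurableType d) (R : realType).
Variable P : probability T R.

Lemma bounded_integrable (f : T -> R) (M : R) : measurable_fun setT f ->
  (forall w, `|f w| <= M) -> P.-integrable setT (EFin \o f).
Proof.
move=> mf fM.
apply: (@le_integrable _ _ _ _ _ measurableT _ (EFin \o cst M)).
- exact/measurable_EFinP.
- move=> w _ /=; rewrite lee_fin; exact: le_trans (fM w) (ler_norm M).
- exact: finite_measure_integrable_cst.
Qed.

Lemma Rintegral_addC (f : T -> R) (M : R) : P.-integrable setT (EFin \o f) ->
  \int[P]_w (f w + M) = \int[P]_w f w + M.
Proof.
move=> fi; rewrite RintegralD//; last exact: finite_measure_integrable_cst.
congr (_ + _); rewrite Rintegral_cst// -[RHS]mulr1; congr (_ * _).
exact: (congr1 fine (@probability_setT _ _ _ P)).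
Qed.

End bounded.

Lemma measurable_prod_cond (d : measure_display) (T : measurableType d)
    (R : realType) (I : finType) (Q : pred I) (h : I -> T -> R) :
  (forall k, measurable_fun setT (h k)) ->
  measurable_fun setT (fun w => \prod_(k | Q k) h k w).
Proof.
by move=> mh; under eq_fun do rewrite -big_filter; exact: measurable_prod.
Qed.

Section normal_law.
Context (d : measure_display) (T : measurableType d) (R : realType).
Variables (P : probability T R) (Y : T -> R) (v : R).
Hypotheses (v0 : 0 <= v) (hY : normal_law P Y 0 v).

Let transfer (f : R -> R) : measurable_fun setT f -> (forall y, 0 <= f y) ->
  (\int[P]_w (f (Y w))%:E =
   if v == 0%R then (f 0%R)%:E else \int[normal_prob 0%R (Num.sqrt v)]_x (f x)%:E)%E.
Proof.
move=> mf f0; have [mY PY] := hY.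
have PB B : measurable B -> (\int[P]_w (cst 1 w * \1_B (Y w))%:E = P (Y @^-1` B))%E.
  move=> mB; under eq_integral do rewrite mul1r.
  rewrite (_ : (fun w => _) = (fun w => (\1_(Y @^-1` B) w)%:E))//.
  by rewrite integral_indic ?setIT// -[_ @^-1` _]setTI; exact: mY.
transitivity (\int[P]_w (cst 1 w * f (Y w))%:E)%E.
  by apply: eq_integral => w _; rewrite mul1r.
have [ve|vn] := eqVneq v 0.
  rewrite (@ge0_integral_transfer _ _ _ _ R P (\d_(0:R)) (cst 1) Y)//.
    rewrite integral_dirac//; last exact/measurable_EFinP.
    by rewrite diracE in_setT mul1e.
  by move=> B mB; rewrite PB// PY// ve eqxx.
rewrite (@ge0_integral_transfer _ _ _ _ R P (normal_prob 0 (Num.sqrt v)) (cst 1) Y)//.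
by move=> B mB; rewrite PB// PY// (negbTE vn).
Qed.

Lemma normal_law_exp : (\int[P]_w (expR (Y w))%:E = (expR (v / 2))%:E)%E.
Proof.
rewrite transfer//.
have [->|vn] := eqVneq v 0; first by rewrite mul0r.
have s0 : Num.sqrt v != 0 by rewrite gt_eqF// sqrtr_gt0 lt_neqAle eq_sym vn.
have := normal_mgf 1 s0; under eq_integral do rewrite mul1r.
by rewrite sqr_sqrtr// expr1n mulr1.
Qed.

Let mcosb b : measurable_fun setT (fun y : R => cos (y + b)).
Proof.
apply: (measurableT_comp (f := cos)); last exact: measurable_funD.
by apply: continuous_measurable_fun => x; exact: continuous_cos.
Qed.

Lemma measurable_normal_cos b : measurable_fun setT (fun w => cos (Y w + b)).
Proof. by have [mY _] := hY; exact: (measurableT_comp (mcosb b) mY). Qed.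

Lemma normal_law_cos b : \int[P]_w cos (Y w + b) = cos b * expR (- (v / 2)).
Proof.
have cos1 (x : R) : `|cos x| <= 1 by rewrite ler_norml cos_geN1 cos_le1.
have iY : P.-integrable setT (EFin \o (fun w => cos (Y w + b))).
  by apply: (@bounded_integrable _ _ _ _ _ 1) => //; exact: measurable_normal_cos.
(* The same shift by 1, now in order to use [transfer]. *)
apply: (@addIr _ 1); rewrite -Rintegral_addC// /Rintegral.
rewrite (@transfer (fun y => cos (y + b) + 1)); last 2 first.
- exact: measurable_funD.
- by move=> y; have := cos_geN1 (y + b); lra.
have [->|vn] := eqVneq v 0; first by rewrite mul0r oppr0 expR0 mulr1/= add0r.
have s0 : Num.sqrt v != 0 by rewrite gt_eqF// sqrtr_gt0 lt_neqAle eq_sym vn.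
have iN : (normal_prob 0 (Num.sqrt v)).-integrable setT (EFin \o (fun y => cos (y + b))).
  apply: (@bounded_integrable _ _ _ (normal_prob 0 (Num.sqrt v)) _ 1).
    exact: mcosb.
  by move=> y; exact: cos1.
rewrite -/(Rintegral _ _ _) Rintegral_addC// /Rintegral.
congr (_ + _); have := normal_charfun s0 1 b.
rewrite sqr_sqrtr// expr1n mulr1 => /(congr1 fine)/= <-; congr fine.
by apply: eq_integral => y _; rewrite mul1r.
Qed.

End normal_law.

(** * Expectations of products of independent variables *)

Section independent.
Context (d : measure_display) (T : measurableType d) (R : realType).
Variables (P : probability T R) (I : finType) (U : I -> T -> R).
Hypothesis mU : forall k, measurable_fun setT (U k).
Hypothesis hU : forall B : I -> set R, (forall k, measurable (B k)) ->
  (P [set w | forall k, B k (U k w)] = \prod_k P (U k @^-1` B k))%E.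

Let mfU (f : I -> R -> R) k : measurable_fun setT (f k) ->
  measurable_fun setT (fun w => f k (U k w)).
Proof. by move=> mf; exact: (measurableT_comp mf (mU k)). Qed.

Lemma independent_ge0 (f : I -> R -> R) :
  (forall k, measurable_fun setT (f k)) -> (forall k y, 0 <= f k y) ->
  (forall k, \int[P]_w (f k (U k w))%:E < +oo)%E ->
  (\int[P]_w (\prod_k f k (U k w))%:E = \prod_k \int[P]_w (f k (U k w))%:E)%E.
Proof.
move=> mf f0 foo.
(* [l] contains the coordinates at which [f] is not an indicator function. *)
suff H (l : seq I) : forall f : I -> R -> R,
  (forall k, measurable_fun setT (f k)) -> (forall k y, 0 <= f k y) ->
  (forall k, \int[P]_w (f k (U k w))%:E < +oo)%E ->
  (forall k, k \notin l -> exists2 B, measurable B & f k = \1_B) ->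
  (\int[P]_w (\prod_k f k (U k w))%:E = \prod_k \int[P]_w (f k (U k w))%:E)%E.
  by apply: (H (enum I)) => // k; rewrite mem_enum.
elim: l => {mf f0 foo f} [f mf f0 foo fB|m l IH f mf f0 foo fB].
  have /choice[B HB] : forall k, exists B, measurable B /\ f k = \1_B.
    by move=> k; have [//|B mB fE] := fB k; exists B.
  have mB k : measurable (B k) by have [] := HB k.
  have fE k : f k = \1_(B k) by have [] := HB k.
  have mUB k : measurable (U k @^-1` B k) by rewrite -[_ @^-1` _]setTI; exact: mU.
  have -> : (fun w => (\prod_k f k (U k w))%:E) =
      (fun w => (\1_[set w | forall k, B k (U k w)] w)%:E).
    apply/funext => w; congr EFin; rewrite indicE.
    have [Bw|nBw] := pselect (forall k, B k (U k w)).
      by rewrite mem_set// big1// => k _; rewrite fE indicE mem_set.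
    rewrite memNset//.
    have [k nBk] : exists k, ~ B k (U k w) by apply/existsNP.
    by rewrite (bigD1 k)//= fE indicE memNset ?mul0r.
  have -> : [set w | forall k, B k (U k w)] = \bigcap_(k in [set: I]) (U k @^-1` B k).
    by apply/seteqP; split => [w Bw k _|w Bw k]; exact: Bw.
  rewrite integral_indic//; last first.
    by apply: fin_bigcap_measurable => //; exact: finite_finset.
  rewrite setIT.
  have -> : \bigcap_(k in [set: I]) (U k @^-1` B k) = [set w | forall k, B k (U k w)].
    by apply/seteqP; split => [w Bw k|w Bw k _]; exact: Bw.
  apply: (etrans (hU mB)); apply: eq_bigr => k _; rewrite fE.
  by rewrite (_ : (fun w => _) = (fun w => (\1_(U k @^-1` B k) w)%:E))// integral_indic// setIT.
have fin k : (\int[P]_w (f k (U k w))%:E \is a fin_num)%E.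
  by rewrite ge0_fin_numE// integral_ge0// => w _; rewrite lee_fin.
(* The measure sending B to the integral of [G] over the event that [U m] lies in B is [c] times the
   law of [U m]: this is the induction hypothesis with [f m] replaced by the indicator of B.
   Finiteness of the integrals makes [c] a real number, as a scaling factor must be. *)
pose c := fine (\prod_(k | k != m) \int[P]_w (f k (U k w))%:E)%E.
have cE : (c%:E = \prod_(k | k != m) \int[P]_w (f k (U k w))%:E)%E.
  rewrite fineK//; elim/big_ind : _ => // x y; exact: fin_numM.
have c0 : 0 <= c.
  by rewrite -lee_fin cE prode_ge0// => k _; rewrite integral_ge0// => w _; rewrite lee_fin.
pose G w := \prod_(k | k != m) f k (U k w).
transitivity (\int[P]_w (G w * f m (U m w))%:E)%E.
  by apply: eq_integral => w _; rewrite (bigD1 m)//= mulrC.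
rewrite (@ge0_integral_transfer _ _ _ _ R P (mscale (NngNum c0) (pushforward P (U m))) G (U m))//.
- rewrite ge0_integral_mscale//=; last 2 first.
  + exact/measurable_EFinP.
  + by move=> y _; rewrite lee_fin.
  rewrite ge0_integral_pushforward//=; last 2 first.
  + exact/measurable_EFinP.
  + by move=> y _; rewrite lee_fin.
  by rewrite cE muleC [RHS](bigD1 m).
- apply: measurable_prod_cond => k; exact: mfU.
- by move=> w; rewrite prodr_ge0.
- move=> B mB; pose f' k := if k == m then \1_B else f k.
  have mf' k : measurable_fun setT (f' k).
    by rewrite /f'; case: ifP => // _; exact: measurable_indic.
  have f'0 k y : 0 <= f' k y by rewrite /f'; case: ifP => // _; rewrite indicE.
  have mUB : measurable (U m @^-1` B) by rewrite -[_ @^-1` _]setTI; exact: mU.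
  have IB : (\int[P]_w (\1_B (U m w))%:E = P (U m @^-1` B))%E.
    by rewrite (_ : (fun w => _) = (fun w => (\1_(U m @^-1` B) w)%:E))// integral_indic// setIT.
  transitivity (\int[P]_w (\prod_k f' k (U k w))%:E)%E.
    apply: eq_integral => w _; rewrite [in RHS](bigD1 m)//= {1}/f' eqxx mulrC.
    by congr (_ * _)%:E; apply: eq_bigr => k /negbTE; rewrite /f' => ->.
  rewrite IH//.
  + rewrite (bigD1 m)//= {1}/f' eqxx IB /mscale/= cE muleC; congr (_ * _)%E.
    by apply: eq_bigr => k /negbTE; rewrite /f' => ->.
  + move=> k; rewrite /f'; case: ifP => [/eqP ->|_]; last exact: foo.
    by rewrite IB; apply: le_lt_trans (probability_le1 P mUB) _; rewrite ltry.
  + move=> k kl; rewrite /f'; case: ifPn => [_|km]; first by exists B.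
    by apply: fB; rewrite inE negb_or km.
Qed.

Let integrable_prod (f : I -> R -> R) :
  (forall k, measurable_fun setT (f k)) ->
  (forall k, P.-integrable setT (EFin \o (fun w => f k (U k w)))) ->
  P.-integrable setT (EFin \o (fun w => \prod_k f k (U k w))).
Proof.
move=> mf fi; apply/integrableP; split.
  by apply/measurable_EFinP; apply: measurable_prod_cond => k; exact: mfU.
under eq_integral do rewrite /= normr_prod.
have fo k : (\int[P]_w (`|f k (U k w)|)%:E < +oo)%E by have /integrableP[] := fi k.
rewrite (@independent_ge0 (fun k y => `|f k y|))//; last first.
  by move=> k; exact: measurableT_comp.
rewrite -ge0_fin_numE; last first.
  by rewrite prode_ge0// => k _; rewrite integral_ge0// => w _; rewrite lee_fin.
elim/big_ind : _ => //; first exact: fin_numM.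
by move=> k _; rewrite ge0_fin_numE// integral_ge0// => w _; rewrite lee_fin.
Qed.

Lemma independent_Rintegral (f : I -> R -> R) :
  (forall k, measurable_fun setT (f k)) ->
  (forall k, P.-integrable setT (EFin \o (fun w => f k (U k w)))) ->
  \int[P]_w (\prod_k f k (U k w)) = \prod_k \int[P]_w f k (U k w).
Proof.
move=> mf fi.
(* Now [l] contains the coordinates at which [f] may take negative values. *)
suff H (l : seq I) : forall f : I -> R -> R,
  (forall k, measurable_fun setT (f k)) ->
  (forall k, P.-integrable setT (EFin \o (fun w => f k (U k w)))) ->
  (forall k, k \notin l -> forall y, 0 <= f k y) ->
  \int[P]_w (\prod_k f k (U k w)) = \prod_k \int[P]_w f k (U k w).
  by apply: (H (enum I)) => // k; rewrite mem_enum.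
elim: l => {mf fi f} [f mf fi f0|m l IH f mf fi f0].
  have f0' k y : 0 <= f k y by exact: f0.
  rewrite /Rintegral independent_ge0//; last first.
    move=> k; have /integrableP[_] := fi k.
    by under eq_integral do rewrite /= ger0_norm//.
  have fin k : (\int[P]_w (f k (U k w))%:E)%E = (\int[P]_w f k (U k w))%:E.
    by rewrite /Rintegral fineK//; apply: integrable_fin_num => //; exact: fi.
  by rewrite (eq_bigr _ (fun k _ => fin k)) prodEFin.
(* For [s] equal to 1 and -1 these are the positive and the negative part of [f m]; both sides of
   the claim are linear in this factor. *)
pose g s y : R := (`|f m y| + s * f m y) / 2.
have mg s : measurable_fun setT (g s).
  apply: measurable_funM => //; apply: measurable_funD => //.
    exact: measurableT_comp.
  exact: measurable_funM.
have g0 s y : `|s| <= 1 -> 0 <= g s y.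
  move=> s1; rewrite divr_ge0//; have := ler_norm (- (s * f m y)).
  rewrite normrN normrM => H; have := ler_wpM2r (normr_ge0 (f m y)) s1; lra.
have gi s : `|s| <= 1 -> P.-integrable setT (EFin \o (fun w => g s (U m w))).
  move=> s1; apply: (le_integrable _ _ _ (fi m)) => //.
    by apply/measurable_EFinP; exact: (measurableT_comp (mg s) (mU m)).
  move=> w _ /=; rewrite lee_fin ger0_norm ?g0// /g.
  have := ler_norm (s * f m (U m w)); rewrite normrM => H.
  have := ler_wpM2r (normr_ge0 (f m (U m w))) s1; lra.
pose h s k := if k == m then g s else f k.
have mh s k : measurable_fun setT (h s k) by rewrite /h; case: ifP.
have hi s k : `|s| <= 1 -> P.-integrable setT (EFin \o (fun w => h s k (U k w))).
  by move=> s1; rewrite /h; case: ifP => [/eqP ->|_]; [exact: gi|exact: fi].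
have IHh s : `|s| <= 1 ->
    \int[P]_w (\prod_k h s k (U k w)) = \prod_k \int[P]_w h s k (U k w).
  move=> s1; apply: IH => // k; first exact: hi.
  move=> kl y; rewrite /h; case: ifPn => [_|km]; first exact: g0.
  by apply: f0; rewrite inE negb_or km.
have s1 : `|1 : R| <= 1 by rewrite normr1.
have sN1 : `|-1 : R| <= 1 by rewrite normrN normr1.
(* [Q] stands for evaluation at a point in one use and for integration in the other. *)
have hprod s (F : I -> R -> R) (Q : (R -> R) -> I -> R) :
    \prod_k Q (h s k) k = Q (g s) m * \prod_(k | k != m) Q (f k) k.
  rewrite (bigD1 m)//= /h eqxx; congr (_ * _).
  by apply: eq_bigr => k /negbTE ->.
have -> : \int[P]_w (\prod_k f k (U k w)) =
    \int[P]_w (\prod_k h 1 k (U k w) - \prod_k h (-1) k (U k w)).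
  apply: eq_Rintegral => w _.
  rewrite !(hprod _ f (fun f k => f (U k w))) -mulrBl (bigD1 m)//=; congr (_ * _).
  by rewrite /g; field.
rewrite RintegralB//; last 2 first.
- by apply: integrable_prod => // k; exact: hi.
- by apply: integrable_prod => // k; exact: hi.
rewrite !IHh// !(hprod _ f (fun f k => \int[P]_w f (U k w))) -mulrBl [RHS](bigD1 m)//=.
congr (_ * _); rewrite -RintegralB//; last 2 first.
- exact: gi.
- exact: gi.
by apply: eq_Rintegral => w _; rewrite /g; field.
Qed.

End independent.

Section independent_normal.
Context (d : measure_display) (T : measurableType d) (R : realType).
Variables (P : probability T R) (I : finType) (U : I -> T -> R) (v : I -> R).
Hypothesis v0 : forall k, 0 <= v k.
Hypothesis lU : forall k, normal_law P (U k) 0 (v k).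
Hypothesis hU : forall B : I -> set R, (forall k, measurable (B k)) ->
  (P [set w | forall k, B k (U k w)] = \prod_k P (U k @^-1` B k))%E.

Let mU k : measurable_fun setT (U k). Proof. by have [] := lU k. Qed.

Lemma independent_normal_exp :
  (\int[P]_w (expR (\sum_k U k w))%:E = (expR ((\sum_k v k) / 2))%:E)%E.
Proof.
under eq_integral do rewrite expR_sum.
rewrite (@independent_ge0 _ _ _ _ _ _ mU hU (fun _ => expR))//; last first.
- by move=> k; rewrite (normal_law_exp (v0 k))// ltry.
under eq_bigr => k _ do rewrite (normal_law_exp (v0 k) (lU k)).
by rewrite prodEFin -expR_sum mulr_suml.
Qed.

Let cos1 (x : R) : `|cos x| <= 1. Proof. by rewrite ler_norml cos_geN1 cos_le1. Qed.

Let sin_cos (x : R) : sin x = cos (x - pi / 2).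
Proof. by rewrite -[in LHS](subrK (pi / 2) x) sinDpihalf. Qed.

Let mcosb b : measurable_fun setT (fun y : R => cos (y + b)).
Proof.
apply: (measurableT_comp (f := cos)); last exact: measurable_funD.
by apply: continuous_measurable_fun => x; exact: continuous_cos.
Qed.

Let normr_prod_le1 (J : finType) (Q : pred J) (x : J -> R) :
  (forall j, `|x j| <= 1) -> `|\prod_(j | Q j) x j| <= 1.
Proof.
move=> x1; rewrite normr_prod.
have : 0 <= \prod_(j | Q j) `|x j| <= 1; last by case/andP.
elim/big_ind : _ => [|a b /andP[a0 a1] /andP[b0 b1]|j _]; first by rewrite ler01 lexx.
  by rewrite mulr_ge0//= mulr_ile1.
by rewrite normr_ge0 x1.
Qed.

(* The factors outside [l] absorb the terms of the sum one at a time, by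
   [cos (x + y) = cos x * cos y - sin x * sin y]; the phase [b] allows for [sin]. *)
Let cos_sum (l : seq I) : uniq l -> forall (b : R) (H : I -> R -> R),
  (forall k, measurable_fun setT (H k)) -> (forall k y, `|H k y| <= 1) ->
  \int[P]_w (cos (\sum_(k <- l) U k w + b) * \prod_(k | k \notin l) H k (U k w)) =
  cos b * expR (- ((\sum_(k <- l) v k) / 2)) *
    \prod_(k | k \notin l) \int[P]_w H k (U k w).
Proof.
have iH (H : I -> R -> R) k : measurable_fun setT (H k) -> (forall y, `|H k y| <= 1) ->
    P.-integrable setT (EFin \o (fun w => H k (U k w))).
  move=> mH H1; apply: (@bounded_integrable _ _ _ _ _ 1) => //.
  exact: (measurableT_comp mH (mU k)).
elim: l => [_ b H mH H1|m l IH /= /andP[ml ul] b H mH H1].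
  under eq_Rintegral do rewrite big_nil add0r.
  rewrite big_nil mul0r oppr0 expR0 mulr1 RintegralZl//; last first.
    apply: (@bounded_integrable _ _ _ _ _ 1).
      by apply: measurable_prod_cond => k; exact: (measurableT_comp (mH k) (mU k)).
    by move=> w; exact: normr_prod_le1.
  by rewrite (independent_Rintegral mU hU)// => k; exact: iH.
(* At the coordinate [m] the phase 0 gives the cosine and the phase - pi / 2 the sine of the
   addition formula. *)
pose H' (c : R) k := if k == m then (fun y => cos (y + c)) else H k.
have mH' c k : measurable_fun setT (H' c k) by rewrite /H'; case: ifP.
have H'1 c k y : `|H' c k y| <= 1 by rewrite /H'; case: ifP.
have E c (Q : (R -> R) -> I -> R) : \prod_(k | k \notin l) Q (H' c k) k =
    Q (fun y => cos (y + c)) m * \prod_(k | k \notin m :: l) Q (H k) k.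
  rewrite (bigD1 m)//= /H' eqxx; congr (_ * _).
  apply: eq_big => [k|k /andP[_ /negbTE ->]//].
  by rewrite inE negb_or andbC.
have int c b' : P.-integrable setT (EFin \o (fun w =>
    cos (\sum_(k <- l) U k w + b') * \prod_(k | k \notin l) H' c k (U k w))).
  apply: (@bounded_integrable _ _ _ _ _ 1).
    apply: measurable_funM.
      exact: (measurableT_comp (mcosb b') (measurable_sum _ mU)).
    by apply: measurable_prod_cond => k; exact: (measurableT_comp (mH' c k) (mU k)).
  by move=> w; rewrite normrM mulr_ile1// normr_prod_le1.
transitivity (\int[P]_w
   (cos (\sum_(k <- l) U k w + b) * \prod_(k | k \notin l) H' 0 k (U k w) -
    cos (\sum_(k <- l) U k w + (b - pi / 2)) * \prod_(k | k \notin l) H' (- (pi / 2)) k (U k w))).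
  apply: eq_Rintegral => w _; rewrite !(E _ (fun f k => f (U k w))) big_cons.
  rewrite addr0 -sin_cos addrA -sin_cos -addrA cosD; ring.
(* The expectation of sin (U m) is 0; it appears here as the cosine of pi / 2, so only the product
   of cosines survives. *)
rewrite RintegralB// !IH// !(E _ (fun f k => \int[P]_w f (U k w))).
rewrite !(normal_law_cos (v0 _) (lU _)) cos0 cosN cos_pihalf !mul0r mulr0 subr0 mul1r.
rewrite big_cons mulrDl opprD expRD; ring.
Qed.

Lemma independent_normal_cos :
  (\int[P]_w (cos (\sum_k U k w))%:E = (expR (- ((\sum_k v k) / 2)))%:E)%E.
Proof.
have n1 (k : I) (y : R) : `|cst 1 y| <= (1 : R) by rewrite normr1.
have := @cos_sum (index_enum I) (index_enum_uniq I) 0 (fun _ => cst 1)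
  (fun _ => measurable_cst _) n1.
have P0 (F : I -> R) : \prod_(k | k \notin index_enum I) F k = 1.
  by rewrite big_pred0// => k; rewrite mem_index_enum.
under eq_Rintegral do rewrite addr0 P0 mulr1.
rewrite P0 cos0 mul1r mulr1 => <-.
rewrite /Rintegral fineK//; apply: integrable_fin_num => //.
apply: (@bounded_integrable _ _ _ _ _ 1) => //.
apply: (measurableT_comp (f := cos)); last exact: measurable_sum.
by apply: continuous_measurable_fun => x; exact: continuous_cos.
Qed.

End independent_normal.

(** * Quadratic forms in Gaussian variables *)

Section gaussian_quadratic.
Context (d : measure_display) (T : measurableType d) (R : realType).
Variables (P : probability T R) (I : finType) (Z : I -> T -> R) (s : I -> R).
Hypothesis mZ : forall i, measurable_fun setT (Z i).
Hypothesis expZ : forall a : I -> R,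
  (\int[P]_w (expR (\sum_i a i * Z i w))%:E =
   (expR ((\sum_i a i ^+ 2 * s i) / 2))%:E)%E.
Hypothesis cosZ : forall a : I -> R,
  (\int[P]_w (cos (\sum_i a i * Z i w))%:E =
   (expR (- ((\sum_i a i ^+ 2 * s i) / 2)))%:E)%E.

Let gamma : probability _ R := normal_prob (0 : R) 1.

Let n1 : (1 : R) != 0. Proof. exact: oner_neq0. Qed.

Let gammaE (t b : R) : (\int[gamma]_x (cos (t * x + b))%:E =
  (cos b * expR (- (t ^+ 2 / 2)))%:E)%E.
Proof. by rewrite /gamma normal_charfun// expr1n mul1r. Qed.

Let split_sum (l : seq I) (m : I) (a : I -> R) (t : R) (F : R -> I -> R) : m \notin l ->
  \sum_(i | i \notin l) F (if i == m then t else a i) i =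
  F t m + \sum_(i | i \notin m :: l) F (a i) i.
Proof.
move=> ml; rewrite (bigD1 m)//= eqxx; congr (_ + _).
apply: eq_big => [i|i /andP[_ /negbTE ->]//]; by rewrite inE negb_or andbC.
Qed.

Variable k : I -> R.

(** The induction runs over [l]: coordinates in [l] enter through their squares, the others linearly
    with arbitrary coefficients. The freedom in [a] lets the auxiliary normal variable become a
    coefficient. *)
Let Q (l : seq I) w := \sum_(i <- l) k i * Z i w ^+ 2.
Let L (l : seq I) (a : I -> R) w := \sum_(i | i \notin l) a i * Z i w.

Let measurable_sum_cond (J : finType) (C : pred J) (h : J -> T -> R) :
  (forall j, measurable_fun setT (h j)) ->
  measurable_fun setT (fun w => \sum_(j | C j) h j w).
Proof. by move=> mh; under eq_fun do rewrite -big_filter; exact: measurable_sum. Qed.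

Let mQ l : measurable_fun setT (Q l).
Proof.
by apply: measurable_sum => i; apply: measurable_funM => //; exact: measurable_funX.
Qed.

Let mL l a : measurable_fun setT (L l a).
Proof. by apply: measurable_sum_cond => i; exact: measurable_funM. Qed.

Let mexpR : measurable_fun setT (expR : R -> R). Proof. exact: measurable_expR. Qed.

Let mcos : measurable_fun setT (cos : R -> R).
Proof. by apply: continuous_measurable_fun => x; exact: continuous_cos. Qed.

Let m1 (f : T -> R) : measurable_fun setT f ->
  measurable_fun setT (fun z : T * R => f z.1).
Proof. by move=> mf; apply: (measurableT_comp mf); exact: measurable_fst. Qed.

Let m2 : measurable_fun setT (fun z : T * R => z.2).
Proof. exact: measurable_snd. Qed.

(* Integrating against a standard normal [x] replaces [expR (k i * Z i ^+ 2)] by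
   [expR (Num.sqrt (2 * k i) * x * Z i)], which is linear in [Z i]. *)
Let expQL (l : seq I) : uniq l ->
  (forall i, i \in l -> 0 <= k i /\ 2 * (k i * s i) < 1) -> forall a : I -> R,
  (\int[P]_w (expR (Q l w + L l a w))%:E =
   (\prod_(i <- l) (Num.sqrt (1 - 2 * (k i * s i)))^-1 *
     expR ((\sum_(i | i \notin l) a i ^+ 2 * s i) / 2))%:E)%E.
Proof.
elim: l => [_ _ a|m l IH /= /andP[ml ul] hk a].
  by rewrite big_nil mul1r -expZ; apply: eq_integral => w _; rewrite /Q big_nil add0r.
have [km ksm] := hk _ (mem_head _ _).
have hl i : i \in l -> 0 <= k i /\ 2 * (k i * s i) < 1.
  by move=> il; apply: hk; rewrite inE il orbT.
pose r := Num.sqrt (2 * k m).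
have r2 : r ^+ 2 = 2 * k m by rewrite sqr_sqrtr// mulr_ge0.
pose A x i := if i == m then r * x else a i.
have LA x w : L l (A x) w = r * Z m w * x + L (m :: l) a w.
  rewrite /L (split_sum a (r * x) (fun t i => t * Z i w) ml); congr (_ + _); ring.
pose f (z : T * R) := (expR (Q l z.1 + (r * Z m z.1 * z.2 + L (m :: l) a z.1)))%:E.
have mf : measurable_fun setT f.
  apply/measurable_EFinP; apply: (measurableT_comp mexpR).
  apply: measurable_funD; first exact: m1.
  apply: measurable_funD; last exact: m1.
  by apply: measurable_funM => //; apply: measurable_funM => //; exact: m1.
have f0 z : (0 <= f z)%E by rewrite lee_fin expR_ge0.
transitivity (\int[P]_w \int[gamma]_x f (w, x))%E.
  apply: eq_integral => w _; rewrite /f/=.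
  under eq_integral => x _.
    rewrite addrCA addrC (expRD (Q l w + _)) EFinM; over.
  have mE : measurable_fun setT (fun x : R => (expR (r * Z m w * x))%:E).
    by apply/measurable_EFinP; apply: (measurableT_comp mexpR); exact: measurable_funM.
  rewrite ge0_integralZl//.
  rewrite /gamma normal_mgf// expr1n mul1r -EFinM -expRD; congr (expR _)%:E.
  by rewrite /Q big_cons exprMn r2; field.
rewrite (@fubini_tonelli _ _ _ _ _ P gamma f mf f0) /f/=.
under eq_integral => x _.
  under eq_integral => w _ do rewrite -LA.
  rewrite IH// (split_sum a (r * x) (fun t i => t ^+ 2 * s i) ml).
  (* As r^2 = 2 k m, the coefficient [r * x] contributes [k m * s m * x ^+ 2], and integrating over
     x gives the new factor; [2 * (k i * s i) < 1] keeps that integral finite. *)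
  have -> : ((r * x) ^+ 2 * s m + \sum_(i | i \notin m :: l) a i ^+ 2 * s i) / 2 =
     - (- (k m * s m)) * x ^+ 2 + (\sum_(i | i \notin m :: l) a i ^+ 2 * s i) / 2.
    by rewrite exprMn r2; field.
  rewrite expRD mulrCA mulrC EFinM; over.
have mE (c : R) : measurable_fun setT (fun x : R => (expR (c * x ^+ 2))%:E).
  apply/measurable_EFinP; apply: (measurableT_comp mexpR).
  by apply: measurable_funM => //; exact: measurable_funX.
rewrite ge0_integralZl//; last 2 first.
- exact: mE.
- by rewrite lee_fin mulr_ge0 ?expR_ge0// prodr_ge0.
rewrite /gamma normal_expR_sqr; last by lra.
rewrite -EFinM mulrN big_cons; congr EFin; ring.
Qed.

Let integral1 (d' : measure_display) (T' : measurableType d') (mu : probability T' R) :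
  (\int[mu]_x 1 = 1)%E.
Proof. by rewrite integral_cst// mul1e; exact: probability_setT. Qed.

Let integrable_bounded (d' : measure_display) (T' : measurableType d') (mu : probability T' R)
   (f : T' -> R) : measurable_fun setT f ->
  (forall z, `|f z| <= 1) -> mu.-integrable setT (EFin \o f).
Proof. exact: bounded_integrable. Qed.

(** The analogue of [expQL] with exp (-k z^2) written as the average of cos (sqrt (2k) x z). The
    integrand changes sign, so Fubini's theorem requires integrability, which holds because [Q l] is
    nonnegative and the integrand is bounded by 1. *)
Let cosQL (l : seq I) : uniq l ->
  (forall i, i \in l -> 0 <= k i /\ 0 <= s i) -> forall a : I -> R,
  (\int[P]_w (expR (- Q l w) * cos (L l a w))%:E =
   (\prod_(i <- l) (Num.sqrt (1 + 2 * (k i * s i)))^-1 *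
     expR (- ((\sum_(i | i \notin l) a i ^+ 2 * s i) / 2)))%:E)%E.
Proof.
elim: l => [_ _ a|m l IH /= /andP[ml ul] hk a].
  rewrite big_nil mul1r -cosZ; apply: eq_integral => w _.
  by rewrite /Q big_nil oppr0 expR0 mul1r.
have [km sm] := hk _ (mem_head _ _).
have hl i : i \in l -> 0 <= k i /\ 0 <= s i.
  by move=> il; apply: hk; rewrite inE il orbT.
have Q0 w : 0 <= Q l w.
  rewrite /Q big_seq sumr_ge0// => i /hl[ki _]; by rewrite mulr_ge0// sqr_ge0.
pose r := Num.sqrt (2 * k m).
have r2 : r ^+ 2 = 2 * k m by rewrite sqr_sqrtr// mulr_ge0.
pose A x i := if i == m then r * x else a i.
have LA x w : L l (A x) w = r * Z m w * x + L (m :: l) a w.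
  rewrite /L (split_sum a (r * x) (fun t i => t * Z i w) ml); congr (_ + _); ring.
pose f (z : T * R) := expR (- Q l z.1) * cos (r * Z m z.1 * z.2 + L (m :: l) a z.1).
have mf : measurable_fun setT f.
  apply: measurable_funM.
    by apply: (measurableT_comp mexpR); apply: measurable_funN; exact: m1.
  apply: (measurableT_comp mcos); apply: measurable_funD; last exact: m1.
  by apply: measurable_funM => //; apply: measurable_funM => //; exact: m1.
have f1 z : `|f z| <= 1.
  rewrite /f normrM ger0_norm ?expR_ge0// mulr_ile1 ?expR_ge0//.
    by rewrite -[leRHS]expR0 ler_expR oppr_le0.
  by rewrite ler_norml cos_geN1 cos_le1.
have fi : (P \x gamma)%E.-integrable setT (EFin \o f).
  apply/integrable12ltyP; first exact/measurable_EFinP.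
  apply: (@le_lt_trans _ _ (\int[P]_w \int[gamma]_x 1)%E); last first.
    rewrite (eq_integral (fun=> 1%E)) => [|w _]; last exact: integral1.
    by rewrite integral1 ltry.
  apply: ge0_le_integral => //.
  - by move=> w _; exact: integral_ge0.
  - apply: (@measurable_fun_fubini_tonelli_F _ _ _ _ _ gamma (fun z => `|(f z)%:E|%E)).
      by apply: measurableT_comp => //; exact/measurable_EFinP.
    by [].
  - move=> w _; apply: ge0_le_integral => //.
    + apply/measurable_EFinP; apply: measurableT_comp => //.
      exact: (measurableT_comp mf (pair1_measurable w)).
    + by move=> x _; rewrite lee_fin.
transitivity (\int[P]_w \int[gamma]_x (EFin \o f) (w, x))%E.
  apply: eq_integral => w _; rewrite /f/=.
  under eq_integral do rewrite EFinM.
  rewrite integralZl//; last first.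
    apply: integrable_bounded.
      apply: (measurableT_comp mcos); apply: measurable_funD => //; exact: measurable_funM.
    by move=> x; rewrite ler_norml cos_geN1 cos_le1.
  rewrite gammaE -EFinM; congr EFin.
  rewrite [RHS]mulrCA -expRD [LHS]mulrC; congr (_ * expR _).
  by rewrite /Q big_cons exprMn r2; field.
rewrite (Fubini fi) /f/=.
under eq_integral => x _.
  under eq_integral => w _ do rewrite -LA.
  rewrite IH// (split_sum a (r * x) (fun t i => t ^+ 2 * s i) ml).
  have -> : - (((r * x) ^+ 2 * s m + \sum_(i | i \notin m :: l) a i ^+ 2 * s i) / 2) =
     - (k m * s m) * x ^+ 2 - (\sum_(i | i \notin m :: l) a i ^+ 2 * s i) / 2.
    by rewrite exprMn r2; field.
  rewrite expRD mulrCA mulrC EFinM; over.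
have mE (c : R) : measurable_fun setT (fun x : R => (expR (c * x ^+ 2))%:E).
  apply/measurable_EFinP; apply: (measurableT_comp mexpR).
  by apply: measurable_funM => //; exact: measurable_funX.
rewrite ge0_integralZl//; last 2 first.
- exact: mE.
- by rewrite lee_fin mulr_ge0 ?expR_ge0// prodr_ge0.
rewrite /gamma normal_expR_sqr; last by have := mulr_ge0 km sm; lra.
rewrite -EFinM big_cons; congr EFin; ring.
Qed.

Lemma gaussian_quadratic_mgf : (forall i, 0 <= k i /\ 2 * (k i * s i) < 1) ->
  (\int[P]_w (expR (\sum_i k i * Z i w ^+ 2))%:E =
   (\prod_i (Num.sqrt (1 - 2 * (k i * s i)))^-1)%:E)%E.
Proof.
move=> hk; have := @expQL (index_enum I) (index_enum_uniq I) (fun i _ => hk i) (fun=> 0).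
rewrite [in X in _ -> X]/= => H.
transitivity (\int[P]_w (expR (Q (index_enum I) w + L (index_enum I) (fun=> 0) w))%:E)%E.
  apply: eq_integral => w _; congr (expR _)%:E; rewrite /Q /L.
  by rewrite [X in _ + X]big1 ?addr0// => i _; rewrite mul0r.
rewrite H [X in X / 2]big1 ?mul0r ?expR0 ?mulr1// => i _; by rewrite expr0n mul0r.
Qed.

Lemma gaussian_quadratic_laplace : (forall i, 0 <= k i /\ 0 <= s i) ->
  (\int[P]_w (expR (- \sum_i k i * Z i w ^+ 2))%:E =
   (\prod_i (Num.sqrt (1 + 2 * (k i * s i)))^-1)%:E)%E.
Proof.
move=> hk; have := @cosQL (index_enum I) (index_enum_uniq I) (fun i _ => hk i) (fun=> 0) => H.
transitivity (\int[P]_w (expR (- Q (index_enum I) w) * cos (L (index_enum I) (fun=> 0) w))%:E)%E.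
  apply: eq_integral => w _; congr (_)%:E; rewrite /Q /L.
  by rewrite [X in cos X]big1 ?cos0 ?mulr1// => i _; rewrite mul0r.
rewrite H [X in X / 2]big1 ?mul0r ?oppr0 ?expR0 ?mulr1// => i _; by rewrite expr0n mul0r.
Qed.

End gaussian_quadratic.

(** Squared and combined with exp (2y) >= 1 + 2y, the claim reduces to (1 + 2y) (1 - x) = 1 + x^2 (1
    - 2x) >= 1, whence the bound 1/2 on x. The linear term x/2 is exact and will cancel against the
    centering of the quadratic form. *)
Lemma invsqrt_le_expR (R : realType) (x : R) : x <= 1 / 2 ->
  (Num.sqrt (1 - x))^-1 <= expR (x / 2 + x ^+ 2).
Proof.
move=> x2; have p0 : 0 < 1 - x by lra.
pose y := x / 2 + x ^+ 2.
have H : 1 <= expR (2 * y) * (1 - x).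
  apply: le_trans (ler_wpM2r (ltW p0) (expR_ge1Dx (2 * y))).
  have -> : (1 + 2 * y) * (1 - x) = 1 + x ^+ 2 * (1 - 2 * x) by rewrite /y; field.
  by rewrite lerDl mulr_ge0 ?sqr_ge0//; lra.
rewrite -/y -[leLHS]mul1r ler_pdivrMr ?sqrtr_gt0//.
rewrite -ler_sqr ?nnegrE ?mulr_ge0 ?expR_ge0 ?sqrtr_ge0//.
rewrite expr1n exprMn sqr_sqrtr ?(ltW p0)//; apply: le_trans H _.
by rewrite mulr_natl mulr2n expRD expr2.
Qed.

(** * Chernoff bounds *)

Section tails.
Context (d : measure_display) (T : measurableType d) (R : realType).
Variable P : probability T R.

Lemma exp_markov (X : T -> R) (C a : R) : measurable_fun setT X ->
  (\int[P]_w (expR (X w))%:E = C%:E)%E ->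
  (P [set w | (a <= X w)%R] <= (expR (- a) * C)%:E)%E.
Proof.
move=> mX XC.
have mA : measurable [set w | a <= X w].
  have -> : [set w | a <= X w] = X @^-1` `[a, +oo[.
    by apply/seteqP; split => w; rewrite /= in_itv/= andbT.
  by rewrite -[_ @^-1` _]setTI; exact: mX.
have mE : measurable_fun setT (fun w => (expR (X w))%:E).
  by apply/measurable_EFinP; apply: measurableT_comp.
have <- : (\int[P]_w (\1_[set w | a <= X w] w)%:E = P [set w | (a <= X w)%R])%E.
  by rewrite integral_indic// setIT.
have a0 : (0 <= (expR (- a))%:E)%E by rewrite lee_fin expR_ge0.
rewrite EFinM -XC -ge0_integralZl//.
apply: ge0_le_integral => //.
- by apply/measurable_EFinP; exact: measurable_indic.
- by apply/measurable_EFinP; apply: measurable_funM => //; exact/measurable_EFinP.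
- move=> w _; rewrite -EFinM lee_fin -expRD indicE.
  have [/set_mem/= aX|_] := boolP (w \in _); last exact: expR_ge0.
  by rewrite -[leLHS]expR0 ler_expR; lra.
Qed.

Variables (I : finType) (Z : I -> T -> R) (s : I -> R).
Hypothesis mZ : forall i, measurable_fun setT (Z i).
Hypothesis s0 : forall i, 0 <= s i.
Hypothesis expZ : forall a : I -> R,
  (\int[P]_w (expR (\sum_i a i * Z i w))%:E =
   (expR ((\sum_i a i ^+ 2 * s i) / 2))%:E)%E.
Hypothesis cosZ : forall a : I -> R,
  (\int[P]_w (cos (\sum_i a i * Z i w))%:E =
   (expR (- ((\sum_i a i ^+ 2 * s i) / 2)))%:E)%E.
Variable k : I -> R.
Hypothesis k0 : forall i, 0 <= k i.

Let Q w := \sum_i k i * Z i w ^+ 2.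
Let S := \sum_i k i * s i.

Lemma measurable_gaussian_quadratic : measurable_fun setT Q.
Proof.
by apply: measurable_sum => i; apply: measurable_funM => //; exact: measurable_funX.
Qed.

(** [m] bounds the individual weights and [B] acts as a number of degrees of freedom. For [e] at
    most 1 the tail stays in the Gaussian regime, hence the exponent quadratic in [e]. *)
Lemma gaussian_quadratic_tail (m B e : R) : 0 < m -> 0 <= e <= 1 ->
  (forall i, k i * s i <= m) -> S <= B * m ->
  (P [set w | (e * B * m < `|Q w - S|)%R] <= (2 * expR (- (e ^+ 2 * B / 16)))%:E)%E.
Proof.
move=> m0 /andP[e0 e1] ksm SB; have mQ := measurable_gaussian_quadratic.
have ks0 i : 0 <= k i * s i by rewrite mulr_ge0.
(* This minimizes - t e B m + 4 t^2 B m^2, the Chernoff exponent left once the terms linear in S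
   cancel; the minimum is - e^2 B / 16. As [e] is at most 1, the argument of [invsqrt_le_expR] stays
   below 1/2. *)
pose t := e / (8 * m).
have t0 : 0 <= t by rewrite divr_ge0// mulr_ge0// ltW.
have tks i : t * (k i * s i) <= 1 / 8.
  apply: le_trans (ler_wpM2l t0 (ksm i)) _; rewrite /t.
  have -> : e / (8 * m) * m = e / 8 by field; rewrite gt_eqF.
  by lra.
have tE : t = e / (8 * m) by [].
clearbody t.
have S2 : \sum_i (k i * s i) ^+ 2 <= B * m ^+ 2.
  apply: (@le_trans _ _ (\sum_i m * (k i * s i))).
    by apply: ler_sum => i _; rewrite expr2 ler_wpM2r.
  by rewrite -mulr_sumr expr2 mulrA mulrC; apply: ler_wpM2r => //; exact: ltW.
(* [c] is the sign of the tail, 1 for the upper and -1 for the lower one. *)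
have prodle (c : R) : `|c| = 1 ->
    \prod_i (Num.sqrt (1 - c * (2 * (t * k i * s i))))^-1 <=
    expR (c * t * S + 4 * t ^+ 2 * (B * m ^+ 2)).
  move=> c1; have c2 : c ^+ 2 = 1 by rewrite -[LHS]ger0_norm ?sqr_ge0// normrX c1 expr1n.
  apply: (@le_trans _ _ (\prod_i expR (c * t * (k i * s i) + 4 * t ^+ 2 * (k i * s i) ^+ 2))).
    apply: ler_prod => i _; rewrite invr_ge0 sqrtr_ge0/=.
    apply: le_trans (invsqrt_le_expR _) _.
      have := ler_norm (c * (2 * (t * (k i * s i)))).
      rewrite normrM c1 mul1r ger0_norm ?mulr_ge0// => H.
      by have := tks i; rewrite -mulrA; lra.
    rewrite ler_expR.
    have -> : c * (2 * (t * k i * s i)) / 2 + (c * (2 * (t * k i * s i))) ^+ 2 =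
        c * t * (k i * s i) + c ^+ 2 * (4 * t ^+ 2 * (k i * s i) ^+ 2) by field.
    by rewrite c2 mul1r.
  rewrite -expR_sum ler_expR big_split/= -!mulr_sumr lerD2l.
  by apply: ler_wpM2l => //; rewrite mulr_ge0 ?sqr_ge0.
have tail (c : R) : `|c| = 1 ->
    (\int[P]_w (expR (c * t * Q w))%:E =
      (\prod_i (Num.sqrt (1 - c * (2 * (t * k i * s i))))^-1)%:E)%E ->
    (P [set w | (c * t * S + t * (e * B * m) <= c * t * Q w)%R] <=
      (expR (- (e ^+ 2 * B / 16)))%:E)%E.
  move=> c1 H; apply: le_trans (exp_markov _ _ H) _.
    by apply: measurable_funM.
  rewrite lee_fin; apply: le_trans (ler_wpM2l (expR_ge0 _) (prodle _ c1)) _.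
  rewrite -expRD ler_expR tE le_eqVlt; apply/orP; left; apply/eqP.
  by field; rewrite gt_eqF.
have mA : measurable [set w | (e * B * m < `|Q w - S|)%R].
  have mN : measurable_fun setT (fun w => `|Q w - S|).
    by apply: measurableT_comp => //; exact: measurable_funB.
  have -> : [set w | (e * B * m < `|Q w - S|)%R] = (fun w => `|Q w - S|) @^-1` `]e * B * m, +oo[.
    by apply/seteqP; split => w; rewrite /= in_itv/= andbT.
  by rewrite -[_ @^-1` _]setTI; exact: mN.
have mle (c : R) : measurable [set w | c * t * S + t * (e * B * m) <= c * t * Q w].
  have mN : measurable_fun setT (fun w => c * t * Q w) by exact: measurable_funM.
  have -> : [set w | c * t * S + t * (e * B * m) <= c * t * Q w] =
      (fun w => c * t * Q w) @^-1` `[c * t * S + t * (e * B * m), +oo[.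
    by apply/seteqP; split => w; rewrite /= in_itv/= andbT.
  by rewrite -[_ @^-1` _]setTI; exact: mN.
have c1 : `|1 : R| = 1 by rewrite normr1.
have cN1 : `|-1 : R| = 1 by rewrite normrN normr1.
apply: (@le_trans _ _ (P ([set w | 1 * t * S + t * (e * B * m) <= 1 * t * Q w] `|`
                        [set w | -1 * t * S + t * (e * B * m) <= -1 * t * Q w]))).
  apply: le_measure; rewrite ?inE//; first exact: measurableU.
  move=> w /= h.
  have [QS|QS] := leP 0 (Q w - S).
    left; rewrite ger0_norm// in h; rewrite !mul1r -mulrDr ler_wpM2l//; lra.
  right; rewrite ltr0_norm// in h.
  have -> : -1 * t * S + t * (e * B * m) = t * (e * B * m - S) by ring.
  have -> : -1 * t * Q w = t * - Q w by ring.
  by rewrite ler_wpM2l//; lra.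
apply: le_trans (measureU2 _ (mle _) (mle _)) _.
rewrite mulr_natl mulr2n EFinD; apply: leeD; apply: tail => //.
- have -> : \prod_i (Num.sqrt (1 - 1 * (2 * (t * k i * s i))))^-1 =
     \prod_i (Num.sqrt (1 - 2 * (t * k i * s i)))^-1.
    by apply: eq_bigr => i _; rewrite mul1r.
  rewrite -(@gaussian_quadratic_mgf _ _ _ P I Z s mZ expZ (fun i => t * k i)).
    apply: eq_integral => w _; congr (expR _)%:E; rewrite mul1r mulr_sumr.
    by apply: eq_bigr => i _; rewrite mulrA.
  move=> i; split; first exact: mulr_ge0.
  by have := tks i; rewrite -mulrA; lra.
- have -> : \prod_i (Num.sqrt (1 - -1 * (2 * (t * k i * s i))))^-1 =
     \prod_i (Num.sqrt (1 + 2 * (t * k i * s i)))^-1.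
    by apply: eq_bigr => i _; rewrite mulN1r opprK.
  rewrite -(@gaussian_quadratic_laplace _ _ _ P I Z s mZ cosZ (fun i => t * k i)).
    apply: eq_integral => w _; congr (expR _)%:E; rewrite mulN1r mulNr mulr_sumr; congr (- _).
    by apply: eq_bigr => i _; rewrite mulrA.
  by move=> i; split => //; exact: mulr_ge0.
Qed.

(* The probability is at most the Laplace transform of [Q] at any [t > 0], hence
   at most [(1 + 2 * t * k i0 * s i0) ^ (- 1 / 2)]. *)
Lemma gaussian_quadratic_neq0 (i0 : I) : 0 < k i0 * s i0 ->
  P [set w | Q w = 0] = 0%E.
Proof.
move=> ks0; have mQ := measurable_gaussian_quadratic.
have mA : measurable [set w | Q w = 0].
  have -> : [set w | Q w = 0] = Q @^-1` [set 0] by [].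
  by rewrite -[_ @^-1` _]setTI; exact: mQ.
have bound (t : R) : 0 <= t ->
    (P [set w | Q w = 0%R] <= ((Num.sqrt (1 + 2 * (t * (k i0 * s i0))))^-1)%:E)%E.
  move=> t0.
  apply: (@le_trans _ _ (P [set w | (0 <= - \sum_i (t * k i) * Z i w ^+ 2)%R])).
    have mX : measurable_fun setT (fun w => - \sum_i (t * k i) * Z i w ^+ 2).
      apply: measurable_funN; apply: measurable_sum => i.
      by apply: measurable_funM => //; exact: measurable_funX.
    apply: le_measure; rewrite ?inE//.
      have -> : [set w | 0 <= - \sum_i (t * k i) * Z i w ^+ 2] =
          (fun w => - \sum_i (t * k i) * Z i w ^+ 2) @^-1` `[0, +oo[.
        by apply/seteqP; split => w; rewrite /= in_itv/= andbT.
      by rewrite -[_ @^-1` _]setTI; exact: mX.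
    move=> w /= Q0; have -> : \sum_i t * k i * Z i w ^+ 2 = t * Q w.
      by rewrite mulr_sumr; apply: eq_bigr => i _; rewrite mulrA.
    by rewrite Q0 mulr0 oppr0.
  apply: le_trans (exp_markov _ _ (@gaussian_quadratic_laplace _ _ _ P I Z s mZ cosZ _ _)) _.
  - apply: measurable_funN; apply: measurable_sum => i.
    by apply: measurable_funM => //; exact: measurable_funX.
  - by move=> i; split => //; exact: mulr_ge0.
  rewrite oppr0 expR0 mul1r lee_fin (bigD1 i0)//= -mulrA ler_piMr ?invr_ge0//.
  apply: prodr_ile1 => i; rewrite invr_ge0 sqrtr_ge0/= => _.
  have h : 1 <= 1 + 2 * (t * k i * s i) by rewrite lerDl !mulr_ge0.
  rewrite invf_le1; last by rewrite sqrtr_gt0; apply: lt_le_trans h.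
  by rewrite -[leLHS]sqrtr1 ler_wsqrtr.
have pE : (P [set w | Q w = 0%R] = (fine (P [set w | Q w = 0%R]))%:E)%E.
  by rewrite fineK//; exact: fin_num_measure.
rewrite pE; congr EFin; set p := fine _; rewrite -/p in pE.
have p0 : 0 <= p by rewrite -lee_fin -pE.
apply/eqP; rewrite eq_le p0 andbT leNgt; apply/negP => pgt.
(* With this [t] the bound is (1 + p^-2)^(-1/2), which is smaller than p. *)
pose t := p ^- 2 / (2 * (k i0 * s i0)).
have t0 : 0 <= t by rewrite divr_ge0 ?invr_ge0 ?exprn_ge0// mulr_ge0// ltW.
have := bound t t0; rewrite pE lee_fin leNgt => /negP; apply.
have -> : 1 + 2 * (t * (k i0 * s i0)) = 1 + p ^- 2.
  have q0 : k i0 * s i0 != 0 by rewrite gt_eqF.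
  rewrite /t; move: (k i0 * s i0) q0 => q q0; field.
  by rewrite q0 gt_eqF.
have pV0 : 0 < p^-1 by rewrite invr_gt0.
have h0 : 0 < 1 + p ^- 2 by rewrite ltr_wpDr// invr_ge0 exprn_ge0.
have h : p^-1 < Num.sqrt (1 + p ^- 2).
  by rewrite -[ltLHS](ger0_norm (ltW pV0)) -sqrtr_sqr exprVn (ltr_sqrt _ h0) ltrDr.
by rewrite -[ltRHS]invrK (@ltf_pV2 _ (Num.sqrt _) p^-1) ?posrE ?sqrtr_gt0.
Qed.

End tails.

(** * The sample covariance matrix *)

(** The orthogonal projection along the constant vectors: it subtracts the sample mean from the
    observations. *)
Definition centering (R : realType) (n : nat) : 'M[R]_n :=
  1%:M - n%:R^-1 *: const_mx 1.

Section centering.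
Variables (R : realType) (n : nat).
Hypothesis n0 : (0 < n)%N.
Let nR : (n%:R : R) != 0. Proof. by rewrite pnatr_eq0 -lt0n. Qed.

Lemma tr_centering : (centering R n)^T = centering R n.
Proof. by apply/matrixP => i j; rewrite !mxE eq_sym. Qed.

Lemma centering_idem : centering R n *m centering R n = centering R n.
Proof.
have JJ : (const_mx 1 : 'M[R]_n) *m (const_mx 1 : 'M[R]_n) = n%:R *: const_mx 1.
  apply/matrixP => i j; rewrite !mxE mulr1.
  under eq_bigr do rewrite !mxE mulr1.
  by rewrite sumr_const card_ord.
rewrite /centering mulmxBl mul1mx mulmxBr mulmx1 -scalemxAl -scalemxAr JJ.
by rewrite (scalerA n%:R^-1 n%:R) mulVf// scale1r subrr subr0.
Qed.

Lemma trace_centering : \tr (centering R n) = n.-1%:R.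
Proof.
rewrite /centering linearB/= mxtrace1 linearZ/= /mxtrace.
under [X in _ * X]eq_bigr do rewrite mxE.
by rewrite sumr_const card_ord mulVf// -{1}(prednK n0) -natr1 addrK.
Qed.

Lemma centering_row (p : nat) (M : 'M[R]_(n, p)) k :
  row k (centering R n *m M) = row k M - n%:R^-1 *: \sum_j row j M.
Proof.
rewrite row_mul /centering linearB/= mulmxBl row1 -rowE; congr (_ - _).
rewrite linearZ/= -scalemxAl; congr (_ *: _).
apply/rowP => l; rewrite !mxE summxE; apply: eq_bigr => j _.
by rewrite !mxE mul1r.
Qed.

(* Any translation of the rows disappears: this is what lets us assume that
   the observations have mean zero. *)
Lemma centered_sum_sqr (p : nat) (Y : 'I_n -> 'cV[R]_p) (m : 'cV[R]_p) :
  \sum_k \sum_l ((Y k - n%:R^-1 *: \sum_j Y j) l 0) ^+ 2 =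
  \tr ((\matrix_(k, l) (Y k l 0 - m l 0))^T *m centering R n *m
       \matrix_(k, l) (Y k l 0 - m l 0)).
Proof.
set M := \matrix_(k, l) _.
have -> : M^T *m centering R n *m M = (centering R n *m M)^T *m (centering R n *m M).
  by rewrite trmx_mul tr_centering -!mulmxA (mulmxA (centering _ _)) centering_idem.
rewrite mxtrace_mulC /mxtrace.
apply: eq_bigr => k _; rewrite mxE; apply: eq_bigr => l _.
rewrite [X in _ * X]mxE -expr2; congr (_ ^+ 2).
have /rowP/(_ l) := centering_row M k; rewrite [LHS]mxE => ->.
rewrite !mxE !summxE.
under [in RHS]eq_bigr do rewrite !mxE.
rewrite sumrB sumr_const card_ord -(mulr_natl (m l 0) n) mulrBr mulrA mulVf// mul1r.
by ring.
Qed.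

End centering.

(* Diagonalizing both the centering matrix [C] and [Sigma] turns the quadratic
   form into a weighted sum of squares of uncorrelated coordinates. *)
Section quad_diag.
Variables (R : realType) (n p : nat) (C U : 'M[R]_n) (kap : 'rV[R]_n)
  (S V : 'M[R]_p) (lam : 'rV[R]_p).
Hypotheses (UU : U *m U^T = 1%:M) (CE : C = U^T *m diag_mx kap *m U).
Hypotheses (VV : V *m V^T = 1%:M) (SE : S = V^T *m diag_mx lam *m V).

Lemma trace_quad_diag (M : 'M[R]_(n, p)) :
  \tr (M^T *m C *m M) = \sum_i kap 0 i.1 * ((U *m M *m V^T) i.1 i.2) ^+ 2.
Proof.
set Z := U *m M *m V^T.
have -> : \tr (M^T *m C *m M) = \tr (Z^T *m diag_mx kap *m Z).
  rewrite /Z !trmx_mul trmxK CE !mulmxA [RHS]mxtrace_mulC !mulmxA.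
  by rewrite (mulmx1C VV) mul1mx.
rewrite -mulmxA mxtrace_mulC /mxtrace -(pair_bigA _ (fun a l => kap 0 a * Z a l ^+ 2))/=.
apply: eq_bigr => a _; rewrite mxE; apply: eq_bigr => l _.
by rewrite mul_diag_mx !mxE; ring.
Qed.

(** A linear form in the rotated coordinates is regrouped by observation, row k of [B] being the
    coefficients applied to observation k. Independence of the observations can then be used, and
    [sum_var_diag] adds up their variances without cross terms. *)
Lemma sum_coord_diag (a : 'I_n * 'I_p -> R) (M : 'M[R]_(n, p)) :
  let B := U^T *m (\matrix_(i, l) a (i, l)) *m V in
  \sum_i a i * (U *m M *m V^T) i.1 i.2 =
  \sum_k (row k B *m (row k M)^T) 0 0.
Proof.
move=> B; set A := \matrix_(i, l) _ in B *; set Z := U *m M *m V^T.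
have -> : \sum_i a i * Z i.1 i.2 = \tr (A *m Z^T).
  rewrite /mxtrace (eq_bigr (fun i => a (i.1, i.2) * Z i.1 i.2)); last by case.
  rewrite -(pair_bigA _ (fun i l => a (i, l) * Z i l))/=.
  by apply: eq_bigr => k _; rewrite mxE; apply: eq_bigr => l _; rewrite !mxE.
have -> : \tr (A *m Z^T) = \tr (B *m M^T).
  by rewrite /Z /B !trmx_mul trmxK !mulmxA mxtrace_mulC !mulmxA.
rewrite /mxtrace; apply: eq_bigr => k _; rewrite !mxE.
by apply: eq_bigr => l _; rewrite !mxE.
Qed.

Lemma sum_var_diag (a : 'I_n * 'I_p -> R) :
  let B := U^T *m (\matrix_(i, l) a (i, l)) *m V in
  \sum_k (row k B *m S *m (row k B)^T) 0 0 = \sum_i a i ^+ 2 * lam 0 i.2.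
Proof.
move=> B; set A := \matrix_(i, l) _ in B *.
have -> : \sum_k (row k B *m S *m (row k B)^T) 0 0 = \tr (B *m S *m B^T).
  rewrite /mxtrace; apply: eq_bigr => k _; rewrite -row_mul !mxE.
  by apply: eq_bigr => l _; rewrite !mxE.
have -> : \tr (B *m S *m B^T) = \tr (A *m diag_mx lam *m A^T).
  rewrite /B SE !trmx_mul trmxK.
  transitivity (\tr (U^T *m (A *m diag_mx lam *m A^T *m U))).
    congr (\tr _); rewrite !mulmxA -(mulmxA _ V) VV mulmx1.
    by rewrite -(mulmxA _ V) VV mulmx1.
  by rewrite mxtrace_mulC -(mulmxA _ U) UU mulmx1.
rewrite [RHS](eq_bigr (fun i => a (i.1, i.2) ^+ 2 * lam 0 i.2)); last by case.
rewrite -(pair_bigA _ (fun i l => a (i, l) ^+ 2 * lam 0 l))/=.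
apply: eq_bigr => k _; rewrite mxE; apply: eq_bigr => l _.
by rewrite mul_mx_diag !mxE; ring.
Qed.

End quad_diag.

(** The centering matrix is idempotent, so each of these entries equals its own square. *)
Lemma centering_spectrum (R : realType) (n : nat) (U : 'M[R]_n) (kap : 'rV[R]_n) i :
  (0 < n)%N -> U *m U^T = 1%:M -> centering R n = U^T *m diag_mx kap *m U ->
  0 <= kap 0 i <= 1.
Proof.
move=> n0 UU CE.
have DE : diag_mx kap = U *m centering R n *m U^T.
  by rewrite CE !mulmxA UU mul1mx -mulmxA UU mulmx1.
have DD : diag_mx kap *m diag_mx kap = diag_mx kap.
  rewrite DE !mulmxA -(mulmxA _ U^T U) (mulmx1C UU) mulmx1.
  by rewrite -(mulmxA U) centering_idem.
have /eqP : kap 0 i ^+ 2 = kap 0 i.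
  move/matrixP : DD => /(_ i i); rewrite mul_diag_mx !mxE eqxx !mulr1n => H.
  by rewrite expr2; exact: H.
rewrite expr2 -subr_eq0 -[X in _ - X]mulr1 -mulrBr mulf_eq0 subr_eq0.
by case/orP => /eqP ->; rewrite ?lexx ?ler01.
Qed.

Lemma lebesgue_measure_translate (R : realType) (m : R) (A : set R) : measurable A ->
  pushforward lebesgue_measure ((fun x => x - m) : R -> measurableTypeR R) A =
  lebesgue_measure A.
Proof.
move=> mA; apply/esym/lebesgue_measure_unique => //=.
  exact: measurable_funB.
move=> _ _ [[a b]] _ <-.
rewrite /pushforward.
have -> : (fun x => x - m) @^-1` `]a, b]%classic = `](a + m), (b + m)]%classic.
  by apply/seteqP; split => x; rewrite /= !in_itv/= ltrBrDr lerBlDr.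
rewrite !lebesgue_measure_itv/= !lte_fin ltrD2r; case: ifP => // _.
by rewrite -!EFinB; congr EFin; ring.
Qed.

Lemma normal_law_center (R : realType) (d : measure_display) (T : measurableType d)
    (P : probability T R) (Y : T -> R) (m v : R) :
  0 <= v -> normal_law P Y m v -> normal_law P (fun w => Y w - m) 0 v.
Proof.
move=> v_ge0 [mY PY]; split; first exact: measurable_funB.
move=> B mB; pose B' := (fun y : R => y - m) @^-1` B.
have mB' : measurable B' by rewrite -[B']setTI; exact: measurable_funB.
rewrite -[_ @^-1` B]/(Y @^-1` B') PY//; case: ifP => [_|/negbT v0].
  rewrite !diracE; congr ((nat_of_bool _)%:R)%:E.
  by apply/idP/idP; rewrite !inE /B' /= subrr.
have s0 : Num.sqrt v != 0 by rewrite gt_eqF// sqrtr_gt0 lt_neqAle eq_sym v0.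
pose f x := (normal_pdf 0 (Num.sqrt v) x)%:E.
have mshift : measurable_fun setT (fun x : R => x - m) by exact: measurable_funB.
rewrite /normal_prob.
transitivity (\int[lebesgue_measure]_(x in B') f (x - m)%R)%E.
  apply: eq_integral => x _; rewrite /f !normal_pdfE//.
  by rewrite (normal_fun_center m).
pose sh : R -> measurableTypeR R := fun x => x - m.
transitivity (\int[pushforward lebesgue_measure sh]_(x in B) f x)%E.
  rewrite ge0_integral_pushforward//.
  - apply: measurable_funTS; apply/measurable_EFinP; exact: measurable_normal_pdf.
  - by move=> x _; rewrite lee_fin normal_pdf_ge0.
by apply: eq_measure_integral => A mA _; exact: lebesgue_measure_translate.
Qed.

(** * Linear functionals of a matrix-variate normal *)

Section measurable_bilinear.
Variables (R : realType) (p q : nat) (mu : 'M[R]_(p, q)) (b : 'rV[R]_p) (v : 'rV[R]_q).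

Lemma measurable_bilinear (d : measure_display) (T : measurableType d)
    (X : T -> 'M[R]_(p, q)) :
  (forall l j, measurable_fun setT (fun w => X w l j)) ->
  measurable_fun setT (fun w => (b *m (X w - mu) *m v^T) 0 0).
Proof.
move=> mX.
have -> : (fun w => (b *m (X w - mu) *m v^T) 0 0) =
    (fun w => \sum_j (\sum_l b 0 l * (X w l j - mu l j)) * v 0 j).
  apply/funext => w; rewrite mxE; apply: eq_bigr => j _; rewrite !mxE.
  by congr (_ * _); apply: eq_bigr => l _; rewrite !mxE.
apply: measurable_sum => j; apply: measurable_funM => //.
apply: measurable_sum => l; apply: measurable_funM => //.
exact: measurable_funB.
Qed.

Lemma sigma_matrix_bilinear (d : measure_display) (T : measurableType d)
    (X : T -> 'M[R]_(p, q)) (B : set R) : measurable B ->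
  sigma_matrix X ((fun w => (b *m (X w - mu) *m v^T) 0 0) @^-1` B).
Proof.
move=> mB; set G := [set A | exists (l : 'I_p) (j : 'I_q) (B : set R),
        measurable B /\ A = (fun w => X w l j) @^-1` B].
(* Once T carries the sigma-algebra generated by the entries, [measurable_bilinear] yields
   membership in [sigma_matrix X]. *)
have mX l j : measurable_fun setT (fun w : g_sigma_algebraType G => X w l j).
  move=> _ C mC; rewrite setTI; apply: sub_gen_smallest.
  by exists l, j, C.
have := @measurable_bilinear _ (g_sigma_algebraType G) X mX measurableT B mB.
by rewrite setTI.
Qed.

(** b X v' is the Kronecker product of b and v applied to vec (X'), and the mixed-product rule
    factors its variance. *)
Lemma matrix_normal_bilinear (d : measure_display) (T : measurableType d)
    (P : probability T R) (X : T -> 'M[R]_(p, q)) (Sigma : 'M[R]_p) (Psi : 'M[R]_q) :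
  0 <= (b *m Sigma *m b^T) 0 0 * (v *m Psi *m v^T) 0 0 ->
  matrix_normal_law P X mu Sigma Psi ->
  normal_law P (fun w => (b *m (X w - mu) *m v^T) 0 0) 0
    ((b *m Sigma *m b^T) 0 0 * (v *m Psi *m v^T) 0 0).
Proof.
move=> var0 /(_ (tensmx b v)).
have E (M : 'M[R]_(p, q)) : (tensmx b v *m vec M^T) 0 0 = (b *m M *m v^T) 0 0.
  rewrite !mxE (reindex (@mxtens_index p q)); last first.
    by exists (@mxtens_unindex p q) => i _; rewrite ?mxtens_indexK ?mxtens_unindexK.
  rewrite [LHS](eq_bigr (fun k => (tensmx b v) 0 (mxtens_index (k.1, k.2)) *
    vec M^T (mxtens_index (k.1, k.2)) 0)); last by case.
  rewrite -(pair_bigA _ (fun i j => (tensmx b v) 0 (mxtens_index (i, j)) * vec M^T (mxtens_index (i, j)) 0))/=.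
  rewrite exchange_big; apply: eq_bigr => j _; rewrite !mxE mulr_suml.
  apply: eq_bigr => i _; rewrite !mxE mxtens_indexK/= !ord1; ring.
have -> : (tensmx b v *m tensmx Sigma Psi *m (tensmx b v)^T) 0 0 =
    (b *m Sigma *m b^T) 0 0 * (v *m Psi *m v^T) 0 0.
  by rewrite trmx_tens !tensmx_mul !mxE !ord1.
move/(normal_law_center var0); congr (normal_law P _ 0 _); apply/funext => w.
by rewrite !E mulmxBr mulmxBl !mxE.
Qed.

End measurable_bilinear.

(** * Concentration of the quadratic forms of [Psi_hat] *)

Section quad_Psi_hat.
Variables (R : realType) (n p q : nat).
Hypotheses (n2 : (2 <= n)%N) (p1 : (1 <= p)%N).

Lemma quad_Psi_hat_sum (X : 'I_n -> 'M[R]_(p, q)) (v : 'rV[R]_q) :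
  (v *m Psi_hat X *m v^T) 0 0 = ((n.-1 * p)%:R)^-1 *
    \sum_k \sum_l (((X k - sample_mean X) *m v^T) l 0) ^+ 2.
Proof.
rewrite /Psi_hat -scalemxAr -scalemxAl mxE; congr (_ * _).
rewrite mulmx_sumr mulmx_suml summxE; apply: eq_bigr => k _.
have -> : v *m ((X k - sample_mean X)^T *m (X k - sample_mean X)) *m v^T =
    ((X k - sample_mean X) *m v^T)^T *m ((X k - sample_mean X) *m v^T).
  by rewrite trmx_mul trmxK !mulmxA.
by rewrite mxE; apply: eq_bigr => l _; rewrite [X in X * _]mxE expr2.
Qed.

Context (d : measure_display) (T : measurableType d).
Variables (P : probability T R) (X : 'I_n -> T -> 'M[R]_(p, q)).
Variables (mu : 'M[R]_(p, q)) (Sigma : 'M[R]_p) (Psi : 'M[R]_q) (c : R).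
Hypotheses (c0 : 0 < c) (sSigma : Sigma^T = Sigma).
Hypothesis hSigma : eigenvalues_in Sigma c^-1 c.
Hypothesis indepX : mutually_independent P X.
Hypothesis lawX : forall k, matrix_normal_law P (X k) mu Sigma Psi.

Variable v : 'rV[R]_q.
Let tau := (v *m Psi *m v^T) 0 0.
Hypothesis tau0 : 0 < tau.

(** The three claims share one diagonalization, of the centering matrix across observations and of
    [Sigma] across rows. The degrees of freedom are (n - 1) p, so p can make up for a bounded n. *)
Lemma quad_Psi_hat_tail_neq0 :
  [/\ measurable_fun setT (fun w => (v *m Psi_hat (fun k => X k w) *m v^T) 0 0),
    forall e, 0 <= e <= 1 ->
    (P [set w | (e * (c * tau) < `|(v *m Psi_hat (fun k => X k w) *m v^T) 0 0 -
                                 \tr Sigma / p%:R * tau|)%R] <=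
      (2 * expR (- (e ^+ 2 * (n.-1 * p)%:R / 16)))%:E)%E &
    P [set w | (v *m Psi_hat (fun k => X k w) *m v^T) 0 0 = 0] = 0%E].
Proof.
have n0 : (0 < n)%N by rewrite (leq_trans _ n2).
have [U [kap [UU CE]]] := symmetric_spectral (tr_centering R n).
have [V [lam [VV SE]]] := symmetric_spectral sSigma.
have kap01 a : 0 <= kap 0 a <= 1 := centering_spectrum a n0 UU CE.
have lamb l : c^-1 <= lam 0 l <= c := hSigma (spectral_eigenvalue VV SE l).
have lam0 l : 0 < lam 0 l.
  by have /andP[+ _] := lamb l; apply: lt_le_trans; rewrite invr_gt0.
pose M w : 'M[R]_(n, p) := \matrix_(k, l) ((X k w - mu) *m v^T) l 0.
pose Z (i : 'I_n * 'I_p) w := (U *m M w *m V^T) i.1 i.2.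
pose s (i : 'I_n * 'I_p) := lam 0 i.2 * tau.
pose k (i : 'I_n * 'I_p) := kap 0 i.1.
have s0 i : 0 <= s i by rewrite mulr_ge0 ?ltW.
have k0 i : 0 <= k i by have /andP[] := kap01 i.1.
pose N1 : R := (n.-1 * p)%:R.
have N10 : 0 < N1 by rewrite ltr0n muln_gt0 p1 andbT -subn1 subn_gt0.
have QE w : (v *m Psi_hat (fun k => X k w) *m v^T) 0 0 =
    N1^-1 * \sum_i k i * Z i w ^+ 2.
  rewrite quad_Psi_hat_sum; congr (_ * _).
  rewrite -(trace_quad_diag CE VV (M w)).
  have -> : M w = \matrix_(k, l) ((X k w *m v^T) l 0 - (mu *m v^T) l 0).
    by apply/matrixP => a l; rewrite mxE mulmxBl [in LHS]mxE [X in _ + X]mxE [in RHS]mxE.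
  rewrite -(centered_sum_sqr n0 (fun k => X k w *m v^T) (mu *m v^T)).
  apply: eq_bigr => a _; apply: eq_bigr => l _; congr (fun_of_matrix _ _ _ ^+ 2).
  by rewrite /sample_mean mulmxBl -scalemxAl mulmx_suml.
pose var (b : 'rV[R]_p) := (b *m Sigma *m b^T) 0 0 * tau.
have var0 b : 0 <= var b.
  rewrite mulr_ge0 ?(ltW tau0)//; have /andP[+ _] := quad_bounds sSigma hSigma b.
  apply: le_trans; rewrite mulr_ge0 ?invr_ge0 ?(ltW c0)// mxE sumr_ge0// => l _.
  by rewrite mxE -expr2 sqr_ge0.
have lawb (b : 'I_n -> 'rV[R]_p) a :
    normal_law P (fun w => (b a *m (X a w - mu) *m v^T) 0 0) 0 (var (b a)).
  exact: matrix_normal_bilinear (var0 _) (lawX a).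
pose L (b : 'I_n -> 'rV[R]_p) a w := (b a *m (X a w - mu) *m v^T) 0 0.
have indb (b : 'I_n -> 'rV[R]_p) (B : 'I_n -> set R) : (forall a, measurable (B a)) ->
    (P [set w | forall a, B a (L b a w)] = \prod_a P (L b a @^-1` B a))%E.
  move=> mB; have := @indepX [set: 'I_n]%SET (fun a => L b a @^-1` B a).
  have -> : \bigcap_(a in [set` [set: 'I_n]%SET]) L b a @^-1` B a =
      [set w | forall a, B a (L b a w)].
    by apply/seteqP; split => w H a; [apply: H; rewrite /= inE|move=> _; exact: H].
  move=> ->; first by apply: eq_bigl => a; rewrite inE.
  by move=> a _; exact: sigma_matrix_bilinear.
have linE (a : 'I_n * 'I_p -> R) w : let B := U^T *m (\matrix_(i, l) a (i, l)) *m V in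
    \sum_i a i * Z i w = \sum_k (row k B *m (X k w - mu) *m v^T) 0 0.
  move=> B; rewrite /Z (sum_coord_diag U V a (M w)); apply: eq_bigr => i _.
  rewrite -/B -(mulmxA (row i B)) [LHS]mxE [RHS]mxE.
  apply: eq_bigr => l _; congr (_ * _).
  by rewrite !mxE.
have varE (a : 'I_n * 'I_p -> R) : let B := U^T *m (\matrix_(i, l) a (i, l)) *m V in
    \sum_k var (row k B) = \sum_i a i ^+ 2 * s i.
  move=> B; rewrite /var -mulr_suml (sum_var_diag UU VV SE) mulr_suml.
  by apply: eq_bigr => i _; rewrite /s mulrA.
have expZ (a : 'I_n * 'I_p -> R) : (\int[P]_w (expR (\sum_i a i * Z i w))%:E =
   (expR ((\sum_i a i ^+ 2 * s i) / 2))%:E)%E.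
  under eq_integral do rewrite linE.
  rewrite -varE; set B := _ *m V.
  exact: (independent_normal_exp (fun a => var0 (row a B)) (lawb (fun a => row a B))
     (@indb (fun a => row a B))).
have cosZ (a : 'I_n * 'I_p -> R) : (\int[P]_w (cos (\sum_i a i * Z i w))%:E =
   (expR (- ((\sum_i a i ^+ 2 * s i) / 2)))%:E)%E.
  under eq_integral do rewrite linE.
  rewrite -varE; set B := _ *m V.
  exact: (independent_normal_cos (fun a => var0 (row a B)) (lawb (fun a => row a B))
     (@indb (fun a => row a B))).
have mZ i : measurable_fun setT (Z i).
  have -> : Z i = fun w => \sum_k (row k (U^T *m (\matrix_(i', l) ((i', l) == i)%:R) *m V) *m (X k w - mu) *m v^T) 0 0.
    apply/funext => w; rewrite -(linE (fun j => (j == i)%:R)).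
    rewrite (bigD1 i)//= eqxx mul1r big1 ?addr0// => j /negbTE ->; by rewrite mul0r.
  by apply: measurable_sum => a; have [] := lawb (fun a => row a (U^T *m (\matrix_(i', l) ((i', l) == i)%:R) *m V)) a.
(* The sum is tr C times tr Sigma times tau with tr C = n - 1; division by (n - 1) p explains the
   scalar tr Sigma / p. *)
have SE' : \sum_i k i * s i = N1 * (\tr Sigma / p%:R * tau).
  rewrite /k /s.
  rewrite -(pair_bigA _ (fun a l => kap 0 a * (lam 0 l * tau)))/=.
  have -> : \sum_i \sum_j kap 0 i * (lam 0 j * tau) =
      (\sum_i kap 0 i) * ((\sum_j lam 0 j) * tau).
    by rewrite mulr_suml; apply: eq_bigr => a _; rewrite mulr_suml mulr_sumr.
  rewrite -(spectral_trace UU CE) (trace_centering R n0) -(spectral_trace VV SE).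
  rewrite /N1 natrM; field; by rewrite pnatr_eq0 -lt0n.
have ct0 : 0 < c * tau by rewrite mulr_gt0.
have ksm i : k i * s i <= c * tau.
  have /andP[_ k1] := kap01 i.1; have /andP[_ lc] := lamb i.2.
  have h : s i <= c * tau by rewrite ler_wpM2r// ltW.
  by apply: le_trans h; rewrite ler_piMl.
have trc : \tr Sigma <= c * p%:R by have /andP[] := trace_bounds sSigma hSigma.
have SB : \sum_i k i * s i <= N1 * (c * tau).
  rewrite SE' ler_wpM2l ?(ltW N10)// ler_wpM2r ?(ltW tau0)// ler_pdivrMr ?ltr0n//.
split.
- under eq_fun do rewrite QE.
  by apply: measurable_funM => //; exact: measurable_gaussian_quadratic.
- move=> e e01.
  have := gaussian_quadratic_tail mZ s0 expZ cosZ k0 ct0 e01 ksm SB.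
  apply: le_trans; rewrite le_eqVlt; apply/orP; left; apply/eqP.
  congr (P _); apply/seteqP; split => w /=; rewrite QE SE'.
  + set Q := \sum_i _; set y := \tr _ / _ * _ => H.
    have -> : Q - N1 * y = N1 * (N1^-1 * Q - y) by rewrite mulrBr mulVKf ?gt_eqF.
    by rewrite normrM (gtr0_norm N10) (mulrC e) -mulrA ltr_pM2l.
  + set Q := \sum_i _; set y := \tr _ / _ * _.
    have -> : Q - N1 * y = N1 * (N1^-1 * Q - y) by rewrite mulrBr mulVKf ?gt_eqF.
    by rewrite normrM (gtr0_norm N10) (mulrC e) -mulrA ltr_pM2l.
(* The trace n - 1 of the centering matrix is positive, so one eigenvalue is. *)
- have [a ka] : exists a, 0 < kap 0 a.
    apply: contrapT => /forallNP kn.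
    have := spectral_trace UU CE; rewrite (trace_centering R n0) big1 => [/eqP|a _].
      by rewrite pnatr_eq0 -subn1 subn_eq0 leqNgt n2.
    by have /andP[] := kap01 a; have /negP := kn a; rewrite -leNgt; lra.
  have ks : 0 < k (a, Ordinal p1) * s (a, Ordinal p1) by rewrite !mulr_gt0.
  have := gaussian_quadratic_neq0 mZ s0 cosZ k0 ks.
  congr (P _ = _); apply/seteqP; split => w /=; rewrite QE.
    by move=> ->; rewrite mulr0.
  by move/eqP; rewrite mulf_eq0 invr_eq0 gt_eqF//= => /eqP.
Qed.

End quad_Psi_hat.

(** * The Lasso *)

Definition bilin (R : realType) (q : nat) (G : 'M[R]_q) (u v : 'rV[R]_q) : R :=
  (u *m G *m v^T) 0 0.

(** Filling coordinate j with 0 lets every form in the reduced matrices be written with the full q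
    by q matrix. *)
Definition embed (R : realType) (q : nat) (j : 'I_q) (u : 'cV[R]_q.-1) : 'rV[R]_q :=
  \row_i (if unlift j i is Some k then u k 0 else 0).

Lemma sum_lift (R : realType) (q : nat) (j : 'I_q) (F : 'I_q -> R) :
  \sum_i F i = F j + \sum_i F (lift j i).
Proof. by case: q j F => [[]|q] j F //; rewrite (bigD1_ord j). Qed.

(** Cauchy-Schwarz, from expanding the sum of the squares (k x_i - S1)^2 with k = #|Q|. *)
Lemma sqr_sum_le (R : realDomainType) (I : finType) (Q : pred I) (x : I -> R) :
  (\sum_(i | Q i) x i) ^+ 2 <= #|Q|%:R * \sum_(i | Q i) x i ^+ 2.
Proof.
set S1 := \sum_(i | Q i) x i; set S2 := \sum_(i | Q i) x i ^+ 2; set k := #|Q|%:R.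
have H : 0 <= k * (k * S2 - S1 ^+ 2).
  have -> : k * (k * S2 - S1 ^+ 2) = \sum_(i | Q i) (k * x i - S1) ^+ 2.
    under eq_bigr => i _.
      have -> : (k * x i - S1) ^+ 2 = k ^+ 2 * x i ^+ 2 + (- 2 * k * S1) * x i + S1 ^+ 2 by ring.
      over.
    rewrite !big_split/= -!mulr_sumr -/S1 -/S2 sumr_const -mulr_natl -/k; ring.
  by apply: sumr_ge0 => i _; exact: sqr_ge0.
have [k0|k0] := posnP #|Q|.
  have Q0 : Q =1 pred0 by move=> i; apply: card0_eq k0 i.
  by rewrite /S1 big_pred0// /k k0 mul0r expr0n.
by rewrite -subr_ge0 -(@pmulr_rge0 _ k)// ltr0n.
Qed.

Section bilin.
Variables (R : realType) (q : nat) (G : 'M[R]_q).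
Implicit Types u v w : 'rV[R]_q.

Lemma bilinBr u v w : bilin G u (v - w) = bilin G u v - bilin G u w.
Proof. by rewrite /bilin linearB/= mulmxBr !mxE. Qed.

Lemma bilinBl u v w : bilin G (u - v) w = bilin G u w - bilin G v w.
Proof. by rewrite /bilin !mulmxBl !mxE. Qed.

Lemma bilinDr u v w : bilin G u (v + w) = bilin G u v + bilin G u w.
Proof. by rewrite /bilin linearD/= mulmxDr !mxE. Qed.

Lemma bilinDl u v w : bilin G (u + v) w = bilin G u w + bilin G v w.
Proof. by rewrite /bilin !mulmxDl !mxE. Qed.

Lemma bilinC u v : G^T = G -> bilin G u v = bilin G v u.
Proof.
move=> sG; rewrite /bilin.
have -> : v *m G *m u^T = (u *m G *m v^T)^T by rewrite !trmx_mul trmxK sG mulmxA.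
by rewrite [RHS]mxE.
Qed.

Lemma bilin_deltal i v : bilin G (delta_mx 0 i) v = (row i G *m v^T) 0 0.
Proof. by rewrite /bilin -rowE. Qed.

Lemma bilin_delta i k : bilin G (delta_mx 0 i) (delta_mx 0 k) = G i k.
Proof. by rewrite bilin_deltal trmx_delta -colE !mxE. Qed.

Lemma bilin_embedl j (u : 'cV[R]_q.-1) v :
  bilin G (embed j u) v = \sum_i u i 0 * bilin G (delta_mx 0 (lift j i)) v.
Proof.
have -> : embed j u = \sum_i u i 0 *: delta_mx 0 (lift j i).
  apply/rowP => k; rewrite mxE summxE; case: unliftP => [i|] ->.
    rewrite (bigD1 i)//= !mxE !eqxx mulr1 big1 ?addr0// => i' i'i.
    by rewrite !mxE (inj_eq lift_inj) eq_sym (negbTE i'i) andbF mulr0.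
  by rewrite big1// => i _; rewrite !mxE (negbTE (neq_lift _ _)) andbF mulr0.
rewrite /bilin !mulmx_suml summxE; apply: eq_bigr => i _.
by rewrite -!scalemxAl mxE.
Qed.

Lemma polarization u v : G^T = G ->
  bilin G u v = (bilin G (u + v) (u + v) - bilin G (u - v) (u - v)) / 4.
Proof.
by move=> sG; rewrite !(bilinBl, bilinBr, bilinDl, bilinDr) (bilinC v u sG); field.
Qed.

End bilin.

Lemma Psi_hat_sym (R : realType) (n p q : nat) (X : 'I_n -> 'M[R]_(p, q)) :
  (Psi_hat X)^T = Psi_hat X.
Proof.
rewrite /Psi_hat linearZ/= linear_sum/=; congr (_ *: _).
by apply: eq_bigr => k _; rewrite trmx_mul trmxK.
Qed.

Lemma Psi_hat_ge0 (R : realType) (n p q : nat) (X : 'I_n -> 'M[R]_(p, q)) v :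
  0 <= bilin (Psi_hat X) v v.
Proof.
rewrite /bilin quad_Psi_hat_sum mulr_ge0 ?invr_ge0//.
by apply: sumr_ge0 => k _; apply: sumr_ge0 => l _; exact: sqr_ge0.
Qed.

Lemma Psi_hat_cauchy (R : realType) (n p q : nat) (X : 'I_n -> 'M[R]_(p, q)) i k :
  Psi_hat X i k ^+ 2 <= Psi_hat X i i * Psi_hat X k k.
Proof.
set G := Psi_hat X.
have sG : G^T = G := Psi_hat_sym X.
have Gki : G k i = G i k by rewrite -{1}sG mxE.
have G0 a : 0 <= G a a by rewrite -bilin_delta; exact: Psi_hat_ge0.
have H (s : R) : 0 <= G i i + 2 * s * G i k + s ^+ 2 * G k k.
  have := Psi_hat_ge0 X (delta_mx 0 i + s *: delta_mx 0 k); rewrite -/G.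
  rewrite bilinDl !bilinDr.
  have bZr u v : bilin G u (s *: v) = s * bilin G u v.
    have -> : (bilin G u (s *: v)) = (u *m G *m (s *: v^T)) 0 0.
      by rewrite /bilin; congr ((_ *m _) 0 0); apply/matrixP => ? ?; rewrite !mxE.
    by rewrite -scalemxAr mxE.
  have bZl u v : bilin G (s *: u) v = s * bilin G u v.
    by rewrite /bilin -!scalemxAl mxE.
  by rewrite !(bZl, bZr) !bilin_delta Gki; lra.
have [Gk0|Gk] := eqVneq (G k k) 0; last first.
  have Gkp : 0 < G k k by rewrite lt_neqAle eq_sym Gk G0.
  have := H (- G i k / G k k).
  have -> : G i i + 2 * (- G i k / G k k) * G i k + (- G i k / G k k) ^+ 2 * G k k =
     (G i i * G k k - G i k ^+ 2) / G k k by field.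
  by rewrite pmulr_lge0 ?invr_gt0// subr_ge0.
have [->|Gik] := eqVneq (G i k) 0; first by rewrite expr0n/= mulr_ge0.
(* If [G k k] vanishes, the form is affine in the parameter; this value would make it equal to
   -1. *)
have := H (- (G i i + 1) / (2 * G i k)); rewrite Gk0.
have -> : G i i + 2 * (- (G i i + 1) / (2 * G i k)) * G i k +
   (- (G i i + 1) / (2 * G i k)) ^+ 2 * 0 = -1 by field.
by move=> H01; lra.
Qed.

(** * Deterministic analysis of the Lasso *)

Section lasso.
Variables (R : realType) (n p q : nat) (X : 'I_n -> 'M[R]_(p, q)) (delta : R) (j : 'I_q).
Hypotheses (n2 : (2 <= n)%N) (p1 : (1 <= p)%N).
Let G := Psi_hat X.
Let N : R := (n * p)%:R.
Let N1 : R := (n.-1 * p)%:R.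
Let D := D_invsqrt X j.
Let dd i := (Num.sqrt (G (lift j i) (lift j i)))^-1.
Let pen := lasso_penalty X delta j.

Let N0 : 0 < N. Proof. by rewrite ltr0n muln_gt0 p1 (leq_trans _ n2). Qed.
Let N10 : 0 < N1. Proof. by rewrite ltr0n muln_gt0 p1 andbT -subn1 subn_gt0. Qed.

Lemma D_invsqrtE (a : 'cV[R]_q.-1) i : (D *m a) i 0 = dd i * a i 0.
Proof.
rewrite /D /D_invsqrt mul_diag_mx mxE mxE; congr ((Num.sqrt _)^-1 * _).
by rewrite [LHS]mxE [LHS]mxE.
Qed.

(** [N1 / N] converts the divisor (n - 1) p of [Psi_hat] into the divisor np of the least squares
    term. *)
Lemma lasso_objectiveE (a : 'cV[R]_q.-1) :
  let w := delta_mx 0 j - embed j (D *m a) in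
  lasso_objective X delta j a = N1 / N / 2 * bilin G w w + pen * norm1 a.
Proof.
move=> w; rewrite /lasso_objective; congr (_ + _).
rewrite /bilin /G quad_Psi_hat_sum -/N -/N1.
have -> (x : R) : N1 / N / 2 * (N1^-1 * x) = (2 * N)^-1 * x.
  have gen (y z : R) : 0 < z -> 0 < y -> y / z / 2 * (y^-1 * x) = (2 * z)^-1 * x.
    by move=> z0 y0; field; rewrite !gt_eqF.
  exact: gen.
congr (_ * _); apply: eq_bigr => k _; apply: eq_bigr => l _; congr (_ ^+ 2).
rewrite /w linearB/= mulmxBr trmx_delta -colE.
have YE a1 a2 : (X k - sample_mean X) a1 a2 = X k a1 a2 - sample_mean X a1 a2.
  by rewrite [LHS]mxE [X in _ + X]mxE.
rewrite [RHS]mxE [col _ _ _ _]mxE YE; congr (_ + _); rewrite [RHS]mxE; congr (- _).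
rewrite -mulmxA -/D; move: (D *m a) => u.
rewrite [LHS]mxE [RHS]mxE (sum_lift j).
have -> : (embed j u)^T j 0 = 0 by rewrite !mxE unlift_none.
rewrite mulr0 add0r; apply: eq_bigr => i _.
have -> : (embed j u)^T (lift j i) 0 = u i 0 by rewrite !mxE liftK.
congr (_ * _); rewrite YE [LHS]mxE [X in _ + X]mxE; congr (_ - _).
  by rewrite [LHS]mxE [LHS]mxE.
by rewrite [LHS]mxE [LHS]mxE.
Qed.

Variables (beta : 'cV[R]_q.-1) (ahat : 'cV[R]_q.-1).
Hypothesis G0 : forall i, 0 < G i i.
Hypothesis pen0 : 0 <= pen.
Hypothesis argmin : lasso_argmin X delta j ahat.
Let v := delta_mx 0 j - embed j beta.
Hypothesis noise : forall i,
  N1 / N * (dd i * `|bilin G (delta_mx 0 (lift j i)) v|) <= pen / 2.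
(** The true coefficients in the standardized coordinates in which the penalty acts. *)
Let astar : 'cV[R]_q.-1 := \col_i (beta i 0 / dd i).
Let h := ahat - astar.
Let supp i := beta i 0 != 0.

Let dd0 i : 0 < dd i. Proof. by rewrite invr_gt0 sqrtr_gt0. Qed.

Let Dastar : D *m astar = beta.
Proof. by apply/colP => i; rewrite D_invsqrtE mxE; field; rewrite gt_eqF. Qed.

Lemma lasso_beta_diff : lasso_beta X j ahat - beta = D *m h.
Proof. by rewrite /lasso_beta -/D /h mulmxBr Dastar. Qed.

Let embedB u u' : embed j (u - u' : 'cV[R]_q.-1) = embed j u - embed j u'.
Proof.
apply/rowP => i; rewrite !mxE; case: unliftP => [k|] _; last by rewrite subr0.
by rewrite !mxE.
Qed.

Let hE i : h i 0 = ahat i 0 - astar i 0.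
Proof. by rewrite /h [LHS]mxE [X in _ + X]mxE. Qed.

(** The objective at [ahat] is compared with that at [astar]. By [noise] the cross term costs at
    most pen / 2 times the l1 norm of [h], and off the support [h] coincides with [ahat], so the
    penalty there absorbs it. *)
Lemma lasso_basic :
  N1 / N / 2 * bilin G (embed j (D *m h)) (embed j (D *m h)) +
    pen / 2 * \sum_(i | ~~ supp i) `|h i 0| <= 3 / 2 * pen * \sum_(i | supp i) `|h i 0|.
Proof.
have := argmin astar; rewrite !lasso_objectiveE Dastar -/v.
have -> : delta_mx 0 j - embed j (D *m ahat) = v - embed j (D *m h).
  by rewrite /v /h mulmxBr Dastar embedB opprB addrA subrK.
have sG : G^T = G := Psi_hat_sym X.
set e := embed j (D *m h).
rewrite (bilinBl G v e) !(bilinBr G _ v e) (bilinC v e sG) => H.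
have Hn : N1 / N * bilin G e v <= pen / 2 * \sum_i `|h i 0|.
  rewrite bilin_embedl !mulr_sumr; apply: ler_sum => i _.
  apply: le_trans (ler_norm _) _; rewrite D_invsqrtE !normrM.
  rewrite (gtr0_norm N10) normfV (gtr0_norm N0) (gtr0_norm (dd0 i)).
  have := ler_wpM2r (normr_ge0 (h i 0)) (noise i); lra.
have Hn1 : norm1 astar + \sum_(i | ~~ supp i) `|h i 0| <=
    norm1 ahat + \sum_(i | supp i) `|h i 0|.
  rewrite /norm1 (bigID supp)/= [X in _ <= X + _](bigID supp)/=.
  have H1 : \sum_(i | supp i) `|astar i 0| <=
      \sum_(i | supp i) `|ahat i 0| + \sum_(i | supp i) `|h i 0|.
    rewrite -big_split; apply: ler_sum => i _.
    have -> : astar i 0 = ahat i 0 - h i 0.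
      by rewrite hE; ring.
    exact: ler_normB.
  have H2 : \sum_(i | ~~ supp i) `|astar i 0| = 0.
    by rewrite big1// => i /negPn/eqP b0; rewrite mxE b0 mul0r normr0.
  have H3 : \sum_(i | ~~ supp i) `|h i 0| = \sum_(i | ~~ supp i) `|ahat i 0|.
    apply: eq_bigr => i /negPn/eqP b0; congr `|_|.
    by rewrite hE [astar i 0]mxE b0 mul0r subr0.
  by rewrite H2 H3; lra.
rewrite (bigID supp)/= in Hn.
have Hp := ler_wpM2l pen0 Hn1.
lra.
Qed.

(** The basic inequality puts [h] in the cone where the l1 norm off the support is at most 3 times
    that on it; there |h|_1^2 <= 16 s |h|_2^2 by Cauchy-Schwarz, and the lower eigenvalue bound is
    asked only under this inequality. For s = 0 the cone is {0}, which is the reason for the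
    disjunction. *)
Lemma lasso_rate (s : nat) (kap : R) : 0 < pen -> 0 < kap -> nnz beta = s ->
  (s = 0%N \/ forall a : 'cV[R]_q.-1, (\sum_i `|a i 0|) ^+ 2 <= 16 * s%:R * \sum_i a i 0 ^+ 2 ->
    kap * \sum_i a i 0 ^+ 2 <= N1 / N * bilin G (embed j (D *m a)) (embed j (D *m a))) ->
  \sum_i `|h i 0| <= 12 * pen / kap * s%:R /\
  Num.sqrt (\sum_i h i 0 ^+ 2) <= 3 * pen / kap * Num.sqrt s%:R.
Proof.
move=> pen1 kap0 sE RE; have basic := lasso_basic.
pose S1 := \sum_(i | supp i) `|h i 0|; pose S2 := \sum_(i | ~~ supp i) `|h i 0|.
pose n2h := \sum_i h i 0 ^+ 2.
have n2h0 : 0 <= n2h by apply: sumr_ge0 => i _; exact: sqr_ge0.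
rewrite -/S1 -/S2 in basic.
have S12 : \sum_i `|h i 0| = S1 + S2 by rewrite (bigID supp).
have S10 : 0 <= S1 by exact: sumr_ge0.
have S20 : 0 <= S2 by exact: sumr_ge0.
have q0 : 0 <= N1 / N / 2 * bilin G (embed j (D *m h)) (embed j (D *m h)).
  by rewrite mulr_ge0 ?Psi_hat_ge0// !divr_ge0// ltW.
have cone : S2 <= 3 * S1.
  have : pen / 2 * S2 <= pen / 2 * (3 * S1) by lra.
  by rewrite ler_pM2l// divr_gt0.
have S1sq : S1 ^+ 2 <= s%:R * n2h.
  have scard : s = #|supp|.
    by rewrite -sE /nnz; apply: eq_card => i; rewrite inE.
  rewrite scard; apply: le_trans (sqr_sum_le _ _) _; rewrite ler_wpM2l//.
  under eq_bigr do rewrite real_normK ?num_real//.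
  rewrite /n2h [leRHS](bigID supp)/= lerDl.
  by apply: sumr_ge0 => i _; exact: sqr_ge0.
have n1h : \sum_i `|h i 0| <= 4 * S1 by rewrite S12; lra.
case: RE => [s0|RE].
  have S1E : S1 = 0.
    by apply/eqP; rewrite -sqrf_eq0 eq_le sqr_ge0 andbT (le_trans S1sq)// s0 mul0r.
  have hn0 : \sum_i `|h i 0| = 0.
    by apply/eqP; rewrite eq_le sumr_ge0 ?andbT//; lra.
  have h0 i : h i 0 = 0.
    move/eqP: hn0; rewrite psumr_eq0// => /allP/(_ i (mem_index_enum _)).
    by rewrite implyTb normr_eq0 => /eqP.
  rewrite s0 sqrtr0 !mulr0 hn0 lexx; split=> //.
  by rewrite big1 ?sqrtr0// => i _; rewrite h0 expr0n.
have nn0 : 0 <= \sum_i `|h i 0| by exact: sumr_ge0.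
have kn : kap * n2h <= N1 / N * bilin G (embed j (D *m h)) (embed j (D *m h)).
  apply: RE; rewrite -/n2h.
  have : (\sum_i `|h i 0|) ^+ 2 <= (4 * S1) ^+ 2 by rewrite ler_sqr ?nnegrE// mulr_ge0.
  by move/le_trans; apply; rewrite exprMn -mulrA -[X in X * _]/(4 * 4); lra.
pose r := Num.sqrt n2h; pose t := Num.sqrt (s%:R : R).
have r0 : 0 <= r by exact: sqrtr_ge0.
have t0 : 0 <= t by exact: sqrtr_ge0.
have rr : r ^+ 2 = n2h by exact: sqr_sqrtr.
have tt : t ^+ 2 = s%:R by exact: sqr_sqrtr.
have S1rt : S1 <= t * r.
  by rewrite -ler_sqr ?nnegrE ?mulr_ge0// exprMn rr tt.
have krr : kap * r ^+ 2 <= 3 * pen * (t * r).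
  rewrite rr; apply: le_trans kn _.
  have : 3 * pen * S1 <= 3 * pen * (t * r) by rewrite ler_pM2l// mulr_gt0.
  have : 0 <= pen * S2 by rewrite mulr_ge0.
  by lra.
have rle : r <= 3 * pen / kap * t.
  have [r00|rn0] := eqVneq r 0; first by
    rewrite r00 mulr_ge0//; apply: divr_ge0; [exact: mulr_ge0|exact: ltW].
  have rp : 0 < r by rewrite lt_neqAle eq_sym rn0.
  rewrite -(ler_pM2r rp) -(ler_pM2l kap0).
  have -> : kap * (3 * pen / kap * t * r) = 3 * pen * (t * r) by field; rewrite gt_eqF.
  by rewrite -expr2.
split=> //; apply: le_trans n1h _.
apply: (@le_trans _ _ (4 * (t * (3 * pen / kap * t)))).
  by rewrite ler_pM2l// (le_trans S1rt)// ler_wpM2l.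
by rewrite -tt le_eqVlt; apply/orP; left; apply/eqP; field; rewrite gt_eqF.
Qed.

End lasso.

Definition residual_vector (R : realType) (q : nat) (Psi : 'M[R]_q) (j : 'I_q) : 'rV[R]_q :=
  delta_mx 0 j - embed j (regression_coef Psi j).

(** * The population regression *)

Section population.
Variables (R : realType) (q : nat) (Psi : 'M[R]_q) (c : R).
Hypotheses (c0 : 0 < c) (sPsi : Psi^T = Psi) (hPsi : eigenvalues_in Psi c^-1 c).
Let Gamma := invmx Psi.

Let cV0 : 0 < c^-1. Proof. by rewrite invr_gt0. Qed.
Let uPsi : Psi \in unitmx := unitmx_eigenvalues hPsi cV0.

Lemma bilin_Psi_bounds (x : 'rV[R]_q) :
  c^-1 * (x *m x^T) 0 0 <= bilin Psi x x <= c * (x *m x^T) 0 0.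
Proof. exact: quad_bounds. Qed.

Let delta_sqr i : ((delta_mx 0 i : 'rV[R]_q) *m (delta_mx 0 i : 'rV[R]_q)^T) 0 0 = 1.
Proof. by rewrite trmx_delta mul_delta_mx mxE !eqxx. Qed.

Lemma diag_bounds i : c^-1 <= Psi i i <= c.
Proof.
by have := bilin_Psi_bounds (delta_mx 0 i); rewrite delta_sqr !mulr1 bilin_delta.
Qed.

(** A diagonal entry of [Psi] lies between [c^-1] and [c]. *)
Lemma eigenvalue_bound_ge1 : (0 < q)%N -> 1 <= c.
Proof.
move=> q0; have /andP[H1 H2] := diag_bounds (Ordinal q0).
have H := le_trans H1 H2; have : c^-1 * c <= c * c by rewrite ler_pM2r.
rewrite mulVf ?gt_eqF// -expr2 => H3.
by rewrite -[1](expr1n _ 2) ler_sqr ?nnegrE ?(ltW c0) in H3.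
Qed.

Let Gjj j : c^-1 <= Gamma j j <= c.
Proof.
have := quad_inv_bounds sPsi hPsi (delta_mx 0 j) cV0.
by rewrite delta_sqr !mulr1 invrK -[(_ *m _ *m _) 0 0]/(bilin Gamma _ _) bilin_delta.
Qed.

Let Gj0 j : 0 < Gamma j j.
Proof. by have /andP[+ _] := Gjj j; apply: lt_le_trans. Qed.

Let sGamma : Gamma^T = Gamma. Proof. by rewrite /Gamma trmx_inv sPsi. Qed.

Lemma residual_vectorE j : residual_vector Psi j = (Gamma j j)^-1 *: row j Gamma.
Proof.
apply/rowP => i; rewrite !mxE /=; case: unliftP => [k|] ->.
  rewrite eq_sym (negbTE (neq_lift _ _)) sub0r !mxE mulNr opprK.
  by rewrite -/Gamma -{2}sGamma mxE.
by rewrite eqxx subr0 mulVf// gt_eqF.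
Qed.

Lemma residual_Psi j : residual_vector Psi j *m Psi = (Gamma j j)^-1 *: delta_mx 0 j.
Proof. by rewrite residual_vectorE -scalemxAl -row_mul mulVmx// row1. Qed.

Lemma bilin_residual_orth i j : i != j ->
  bilin Psi (delta_mx 0 i) (residual_vector Psi j) = 0.
Proof.
move=> ij; rewrite bilinC// /bilin residual_Psi -scalemxAl trmx_delta.
by rewrite mul_delta_mx_0 ?scaler0 ?mxE// eq_sym.
Qed.

Lemma bilin_residual j : 0 <= bilin Psi (residual_vector Psi j) (residual_vector Psi j) <= c.
Proof.
have -> : bilin Psi (residual_vector Psi j) (residual_vector Psi j) = (Gamma j j)^-1.
  rewrite /bilin residual_Psi -scalemxAl -rowE residual_vectorE !mxE.
  by rewrite (mulVf (lt0r_neq0 (Gj0 j))) mulr1.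
have /andP[G1 _] := Gjj j; rewrite invr_ge0 (ltW (Gj0 j))/=.
by rewrite -[leRHS]invrK lef_pV2 ?posrE.
Qed.

End population.

(** The errors allowed at u + v and u - v add up, by the parallelogram law, to a bound in terms of u
    and v separately. *)
Lemma bilin_dev (R : realType) (q : nat) (G Psi : 'M[R]_q) (t m : R) (u v : 'rV[R]_q) :
  G^T = G -> Psi^T = Psi ->
  `|bilin G (u + v) (u + v) - t * bilin Psi (u + v) (u + v)| <= m * bilin Psi (u + v) (u + v) ->
  `|bilin G (u - v) (u - v) - t * bilin Psi (u - v) (u - v)| <= m * bilin Psi (u - v) (u - v) ->
  `|bilin G u v - t * bilin Psi u v| <= m * ((bilin Psi u u + bilin Psi v v) / 2).
Proof.
move=> sG sPsi.
rewrite (polarization u v sG) (polarization u v sPsi) !ler_norml.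
have -> : bilin Psi u u + bilin Psi v v =
    (bilin Psi (u + v) (u + v) + bilin Psi (u - v) (u - v)) / 2.
  by rewrite !(bilinBl, bilinBr, bilinDl, bilinDr); field.
move: (bilin G (u + v) (u + v)) (bilin G (u - v) (u - v)) => g1 g2.
move: (bilin Psi (u + v) (u + v)) (bilin Psi (u - v) (u - v)) => p1 p2.
by move=> /andP[H1 H2] /andP[H3 H4]; apply/andP; split; lra.
Qed.

(** Entrywise deviations control the quadratic form on vectors of small l1 norm; with the cone
    condition this yields the restricted eigenvalue bound without a uniform estimate over sparse
    vectors. *)
Lemma bilin_max (R : realType) (q : nat) (H : 'M[R]_q) (m : R) (x : 'rV[R]_q) :
  (forall i k, `|H i k| <= m) -> `|bilin H x x| <= m * (\sum_i `|x 0 i|) ^+ 2.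
Proof.
move=> Hm; rewrite /bilin mxE; apply: le_trans (ler_norm_sum _ _ _) _.
rewrite expr2 mulrA mulr_sumr; apply: ler_sum => k _.
rewrite normrM [x^T _ _]mxE ler_wpM2r// mxE.
apply: le_trans (ler_norm_sum _ _ _) _; rewrite mulr_sumr; apply: ler_sum => i _.
by rewrite normrM mulrC ler_wpM2r.
Qed.

Lemma bilin_subZ (R : realType) (q : nat) (A B : 'M[R]_q) (t : R) (u v : 'rV[R]_q) :
  bilin (A - t *: B) u v = bilin A u v - t * bilin B u v.
Proof. by rewrite /bilin mulmxBr mulmxBl -scalemxAr -scalemxAl !mxE. Qed.

Section embed_norms.
Variables (R : realType) (q : nat) (j : 'I_q) (u : 'cV[R]_q.-1).

Lemma embed_norm1 : \sum_i `|embed j u 0 i| = \sum_i `|u i 0|.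
Proof.
rewrite (sum_lift j) !mxE unlift_none normr0 add0r.
by apply: eq_bigr => i _; rewrite !mxE liftK.
Qed.

Lemma embed_sqr : (embed j u *m (embed j u)^T) 0 0 = \sum_i u i 0 ^+ 2.
Proof.
rewrite mxE (sum_lift j) !mxE unlift_none mul0r add0r.
by apply: eq_bigr => i _; rewrite !mxE liftK expr2.
Qed.

End embed_norms.

(** * The Lasso for a sample with controlled deviations *)

Section lasso_event.
Variables (R : realType) (n p q : nat) (X : 'I_n -> 'M[R]_(p, q)) (delta c : R) (j : 'I_q).
Hypotheses (n2 : (2 <= n)%N) (p1 : (1 <= p)%N) (c1 : 1 <= c).
Let G := Psi_hat X.
Let N : R := (n * p)%:R.
Let N1 : R := (n.-1 * p)%:R.
Let L := log_dim R n p q.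
Let rho := Num.sqrt (L / N).
Hypothesis rho0 : 0 < rho.
Hypothesis delta_ge : 48 * c ^+ 4 <= delta.
Hypothesis G0 : forall i, 0 < G i i.
Variables (Psi : 'M[R]_q) (alpha : 'cV[R]_q.-1).
Hypothesis argmin : lasso_argmin X delta j alpha.
Let beta := regression_coef Psi j.
Let err := lasso_beta X j alpha - beta.
Let D := D_invsqrt X j.
Let dd i := (Num.sqrt (G (lift j i) (lift j i)))^-1.
Let pen := lasso_penalty X delta j.

Let N0 : 0 < N. Proof. by rewrite ltr0n muln_gt0 p1 (leq_trans _ n2). Qed.
Let N10 : 0 < N1. Proof. by rewrite ltr0n muln_gt0 p1 andbT -subn1 subn_gt0. Qed.
Let c0 : 0 < c. Proof. exact: lt_le_trans c1. Qed.
Let c4 : 0 < c ^+ 4. Proof. exact: exprn_gt0. Qed.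
Let delta0 : 0 < delta.
Proof. by apply: lt_le_trans delta_ge; rewrite mulr_gt0. Qed.
Let dd0 i : 0 < dd i. Proof. by rewrite invr_gt0 sqrtr_gt0. Qed.
Let sqrtG0 : 0 < Num.sqrt (G j j). Proof. by rewrite sqrtr_gt0. Qed.

Let penE : pen = delta * Num.sqrt (G j j) * rho.
Proof.
by rewrite /pen /lasso_penalty -/G -/N -/L -(mulrA (G j j)) sqrtrM ?(ltW (G0 j))// mulrA.
Qed.

Let pen0 : 0 < pen. Proof. by rewrite penE !mulr_gt0. Qed.

(** Since n may stay bounded, 1/2 is the lower bound for (n - 1) / n, attained at n = 2. *)
Let NN : 1 / 2 <= N1 / N <= 1.
Proof.
have pR : (0 : R) < p%:R by rewrite ltr0n.
have nR : (2 : R) <= n%:R by rewrite (ler_nat R 2 n).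
have n1R : (n.-1%:R : R) = n%:R - 1 by rewrite -subn1 natrB// (leq_trans _ n2).
rewrite ler_pdivlMr// ler_pdivrMr// /N1 /N !natrM n1R !mul1r.
apply/andP; split; last by rewrite ler_pM2r//; lra.
by rewrite mulrA ler_pM2r//; lra.
Qed.

Lemma lasso_event_null : nnz beta = 0%N -> 1 / (2 * c ^+ 4) < 12 * rho ->
  norm1 err <= 0 /\ norm2 err <= 0.
Proof.
move=> b0 rhoc.
have beta0 : beta = 0.
  apply/colP => i; rewrite [RHS]mxE; apply/eqP/negPn/negP => bi.
  by have := card0_eq b0 i; rewrite !inE bi.
have noise i : N1 / N * (dd i * `|bilin G (delta_mx 0 (lift j i)) (delta_mx 0 j - embed j beta)|)
    <= pen / 2.
  have -> : embed j beta = 0.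
    by apply/rowP => k; rewrite beta0 !mxE; case: unliftP => // k' _; rewrite mxE.
  rewrite subr0 bilin_delta.
  apply: (@le_trans _ _ (1 * Num.sqrt (G j j))).
    apply: ler_pM => //; [by rewrite divr_ge0// ltW|by rewrite mulr_ge0// ltW| |].
      by have /andP[] := NN.
    rewrite mulrC /dd ler_pdivrMr ?sqrtr_gt0// -sqrtrM ?(ltW (G0 _))//.
    by rewrite -sqrtr_sqr mulrC ler_wsqrtr// Psi_hat_cauchy.
  (* Here 12 rho > 1 / (2 c^4) means 24 c^4 rho > 1, and delta >= 48 c^4 doubles this. *)
  rewrite penE; have : 2 <= delta * rho.
    have h : 1 <= 24 * c ^+ 4 * rho.
      move: rhoc; rewrite ltr_pdivrMr ?mulr_gt0// => H; lra.
    apply: (@le_trans _ _ (48 * c ^+ 4 * rho)); last by rewrite ler_pM2r.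
    by lra.
  move=> H; have := ler_wpM2r (ltW sqrtG0) H; lra.
(* For s = 0 both bounds vanish whatever [kap] is; 1 is a placeholder. *)
have [H1 H2] := @lasso_rate _ _ _ _ X delta j n2 p1 beta alpha G0 (ltW pen0) argmin noise 0%N 1 pen0 ltr01 b0 (or_introl erefl).
move: H1 H2; rewrite sqrtr0 !mulr0 => H1 H2.
set h := alpha - _ in H1 H2.
have h0 i : h i 0 = 0.
  apply/eqP; rewrite -normr_eq0 eq_le normr_ge0 andbT; apply: le_trans H1.
  by rewrite (bigD1 i)//= lerDl; exact: sumr_ge0.
have errE : err = 0.
  rewrite /err (@lasso_beta_diff _ _ _ _ X j beta alpha G0).
  apply/colP => i; rewrite D_invsqrtE [RHS]mxE.
  by have := h0 i; rewrite /h => ->; rewrite mulr0.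
rewrite errE /norm1 /norm2 !big1 ?sqrtr0//.
  by move=> i _; rewrite mxE expr0n.
by move=> i _; rewrite mxE normr0.
Qed.

Variables (t e : R).
Hypothesis sPsi : Psi^T = Psi.
Hypothesis hPsi : eigenvalues_in Psi c^-1 c.
Hypothesis tc : c^-1 <= t <= c.
Hypothesis eE : e = 12 * rho.
Hypothesis e_le : e <= 1 / (2 * c ^+ 4).
Let dev (u : 'rV[R]_q) :=
  `|bilin G u u - t * bilin Psi u u| <= e * (c * bilin Psi u u).
Hypothesis dev_delta : forall i k,
  dev (delta_mx 0 i + delta_mx 0 k) /\ dev (delta_mx 0 i - delta_mx 0 k).
Hypothesis dev_resid : forall i,
  dev (delta_mx 0 i + residual_vector Psi j) /\ dev (delta_mx 0 i - residual_vector Psi j).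

Let sG : G^T = G := Psi_hat_sym X.
Let e0 : 0 < e. Proof. by rewrite eE mulr_gt0. Qed.

Let devG i k : `|G i k - t * Psi i k| <= e * c ^+ 2.
Proof.
have [H1 H2] := dev_delta i k; rewrite /dev !mulrA in H1 H2.
have := bilin_dev sG sPsi H1 H2; rewrite !bilin_delta => /le_trans; apply.
have /andP[_ Hi] := diag_bounds sPsi hPsi i; have /andP[_ Hk] := diag_bounds sPsi hPsi k.
have -> : e * c ^+ 2 = e * c * c by ring.
by rewrite ler_pM2l ?mulr_gt0//; lra.
Qed.

Let dev_noise i : `|bilin G (delta_mx 0 (lift j i)) (residual_vector Psi j)| <= e * c ^+ 2.
Proof.
have [H1 H2] := dev_resid (lift j i); rewrite /dev !mulrA in H1 H2.
have := bilin_dev sG sPsi H1 H2; rewrite bilin_delta.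
rewrite (bilin_residual_orth c0 sPsi hPsi) ?mulr0 ?subr0; last by rewrite eq_sym neq_lift.
move=> /le_trans; apply.
have /andP[_ Hi] := diag_bounds sPsi hPsi (lift j i).
have /andP[_ Hk] := bilin_residual c0 sPsi hPsi j.
have -> : e * c ^+ 2 = e * c * c by ring.
by rewrite ler_pM2l ?mulr_gt0//; lra.
Qed.

Let ec : e * c ^+ 4 <= 1 / 2.
Proof.
have := ler_wpM2r (ltW c4) e_le.
have -> // : 1 / (2 * c ^+ 4) * c ^+ 4 = 1 / 2 by field; rewrite gt_eqF.
Qed.

(** [t * Psi i i] lies between c^-2 and c^2, and the threshold 1 / (2 c^4) for [e] makes the
    deviation e c^2 at most half of c^-2. *)
Let G_bounds i : (2 * c ^+ 2)^-1 <= G i i <= 2 * c ^+ 2.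
Proof.
have := devG i i; rewrite ler_norml => /andP[H1 H2].
have /andP[P1 P2] := diag_bounds sPsi hPsi i; have /andP[t1 t2] := tc.
have c2 : 0 < c ^+ 2 by exact: exprn_gt0.
have cc : 1 <= c ^+ 2 by rewrite expr_ge1// ltW.
have ec2 : e * c ^+ 2 <= (2 * c ^+ 2)^-1.
  rewrite -[leRHS]mul1r ler_pdivlMr ?mulr_gt0//.
  have -> : e * c ^+ 2 * (2 * c ^+ 2) = e * c ^+ 4 * 2 by ring.
  by rewrite -ler_pdivlMr.
have tP1 : (c ^+ 2)^-1 <= t * Psi i i.
  by rewrite expr2 invfM; apply: ler_pM => //; rewrite invr_ge0 ltW.
have tP2 : t * Psi i i <= c ^+ 2.
  rewrite expr2; apply: ler_pM => //.
    by apply: le_trans t1; rewrite invr_ge0 ltW.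
  by apply: le_trans P1; rewrite invr_ge0 ltW.
have ce : e * c ^+ 2 <= c ^+ 2.
  apply: le_trans ec2 _; rewrite -[leLHS]mul1r ler_pdivrMr ?mulr_gt0//.
  by have := ler_pM ler01 ler01 cc cc; rewrite mulr1; lra.
have E : (c ^+ 2)^-1 = (2 * c ^+ 2)^-1 + (2 * c ^+ 2)^-1 by field; rewrite gt_eqF.
by apply/andP; split; lra.
Qed.

Let m : R := Num.sqrt (2 * c ^+ 2).
Let m2 : m ^+ 2 = 2 * c ^+ 2.
Proof. by rewrite sqr_sqrtr// mulr_ge0// sqr_ge0. Qed.
Let m0 : 0 < m.
Proof. by rewrite sqrtr_gt0 mulr_gt0// exprn_gt0. Qed.

Let sqrtG_le i : Num.sqrt (G i i) <= m.
Proof. by rewrite ler_wsqrtr//; have /andP[] := G_bounds i. Qed.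

Let sqrtG_ge i : m^-1 <= Num.sqrt (G i i).
Proof.
rewrite /m -sqrtrV ?ler_wsqrtr//; first by have /andP[] := G_bounds i.
by rewrite mulr_ge0// sqr_ge0.
Qed.

Let dd_bounds i : m^-1 <= dd i <= m.
Proof.
have g0 : 0 < Num.sqrt (G (lift j i) (lift j i)) by rewrite sqrtr_gt0.
have mV0 : 0 < m^-1 by rewrite invr_gt0.
apply/andP; split.
  by have := sqrtG_le (lift j i); rewrite -lef_pV2 ?posrE.
by have := sqrtG_ge (lift j i); rewrite -lef_pV2 ?posrE// invrK.
Qed.

(** The source of 48 c^4: the noise is at most m e c^2 = 12 m c^2 rho and pen / 2 at least delta rho
    / (2 m), so delta must be at least 24 m^2 c^2, where m^2 = 2 c^2. *)
Let noise i : N1 / N * (dd i * `|bilin G (delta_mx 0 (lift j i)) (residual_vector Psi j)|)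
  <= pen / 2.
Proof.
apply: (@le_trans _ _ (1 * (m * (e * c ^+ 2)))).
  apply: ler_pM; [by rewrite divr_ge0// ltW|by rewrite mulr_ge0// ltW| |].
    by have /andP[] := NN.
  by apply: ler_pM => //; [exact: ltW|have /andP[] := dd_bounds i].
rewrite penE mul1r.
apply: (@le_trans _ _ (48 * c ^+ 4 * m^-1 * rho / 2)); last first.
  rewrite ler_pM2r ?invr_gt0// ler_pM2r//; apply: ler_pM => //.
  - by rewrite mulr_ge0// ltW.
  - by rewrite invr_ge0 ltW.
rewrite eE -(ler_pM2r m0).
have -> : 48 * c ^+ 4 * m^-1 * rho / 2 * m = 24 * c ^+ 4 * rho by field; rewrite gt_eqF.
have -> : m * (12 * rho * c ^+ 2) * m = 12 * rho * c ^+ 2 * m ^+ 2 by ring.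
by rewrite m2 le_eqVlt; apply/orP; left; apply/eqP; ring.
Qed.

Lemma lasso_event_rate (s : nat) : nnz beta = s -> s%:R * e <= 1 / (128 * c ^+ 8) ->
  norm1 err <= 192 * c ^+ 6 * delta * (s%:R * rho) /\
  norm2 err <= 48 * c ^+ 6 * delta * (Num.sqrt s%:R * rho).
Proof.
move=> sE se.
have c8 : 0 < c ^+ 8 by exact: exprn_gt0.
have c2 : 0 < c ^+ 2 by exact: exprn_gt0.
(* Rescaling by [D] costs 2 c^2, the bounds on [Psi] and [t] cost c each, the deviation takes half
   of what is left, and [N1 / N] another half. *)
pose kap := 1 / (8 * c ^+ 4).
have kap0 : 0 < kap by rewrite divr_gt0// mulr_gt0.
have RE (a : 'cV[R]_q.-1) : (\sum_i `|a i 0|) ^+ 2 <= 16 * s%:R * \sum_i a i 0 ^+ 2 ->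
    kap * \sum_i a i 0 ^+ 2 <= N1 / N * bilin G (embed j (D *m a)) (embed j (D *m a)).
  set n2a := \sum_i a i 0 ^+ 2 => cone.
  have n2a0 : 0 <= n2a by apply: sumr_ge0 => i _; exact: sqr_ge0.
  set x := embed j (D *m a).
  have x1 : \sum_i `|x 0 i| <= m * \sum_i `|a i 0|.
    rewrite embed_norm1 mulr_sumr; apply: ler_sum => i _.
    rewrite D_invsqrtE normrM (gtr0_norm (dd0 i)) ler_wpM2r//.
    by have /andP[] := dd_bounds i.
  have x1sq : (\sum_i `|x 0 i|) ^+ 2 <= 32 * c ^+ 2 * s%:R * n2a.
    apply: (@le_trans _ _ ((m * \sum_i `|a i 0|) ^+ 2)).
      by rewrite ler_sqr ?nnegrE ?sumr_ge0 ?mulr_ge0 ?sumr_ge0// ltW.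
    rewrite exprMn m2.
    have -> : 32 * c ^+ 2 * s%:R * n2a = 2 * c ^+ 2 * (16 * s%:R * n2a) by ring.
    by rewrite ler_pM2l// mulr_gt0.
  have x2 : n2a / (2 * c ^+ 2) <= (x *m x^T) 0 0.
    rewrite embed_sqr mulr_suml; apply: ler_sum => i _.
    rewrite D_invsqrtE exprMn mulrC ler_wpM2r ?sqr_ge0//.
    rewrite -m2 -exprVn ler_sqr ?nnegrE ?invr_ge0 ?(ltW m0) ?(ltW (dd0 i))//.
    by have /andP[] := dd_bounds i.
  have Hx : `|bilin G x x - t * bilin Psi x x| <= e * c ^+ 2 * (\sum_i `|x 0 i|) ^+ 2.
    have -> : bilin G x x - t * bilin Psi x x = bilin (G - t *: Psi) x x.
      by rewrite bilin_subZ.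
    apply: bilin_max => i k.
    have -> : (G - t *: Psi) i k = G i k - t * Psi i k.
      by rewrite -!bilin_delta bilin_subZ.
    exact: devG.
  have /andP[Px _] := bilin_Psi_bounds sPsi hPsi x.
  have tPx : n2a / (2 * c ^+ 4) <= t * bilin Psi x x.
    have cV : 0 <= c^-1 by rewrite invr_ge0 ltW.
    have -> : n2a / (2 * c ^+ 4) = c^-1 * (c^-1 * (n2a / (2 * c ^+ 2))).
      by field; rewrite gt_eqF.
    apply: ler_pM => //; first by rewrite !mulr_ge0// invr_ge0 mulr_ge0// ltW.
      by have /andP[] := tc.
    by apply: le_trans Px; rewrite ler_wpM2l.
  (* The deviation is at most 32 c^4 s e times [n2a]; the bound 1 / (128 c^8) on s e brings it down
     to half of the lower bound in [tPx]. *)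
  have small : e * c ^+ 2 * (\sum_i `|x 0 i|) ^+ 2 <= n2a / (4 * c ^+ 4).
    apply: le_trans (ler_wpM2l (mulr_ge0 (ltW e0) (ltW c2)) x1sq) _.
    have -> : e * c ^+ 2 * (32 * c ^+ 2 * s%:R * n2a) = (32 * c ^+ 4 * n2a) * (s%:R * e) by ring.
    have h : 0 <= 32 * c ^+ 4 * n2a by rewrite !mulr_ge0// ltW.
    apply: le_trans (ler_wpM2l h se) _; rewrite le_eqVlt; apply/orP; left; apply/eqP.
    by field; rewrite gt_eqF.
  have Gx : n2a / (4 * c ^+ 4) <= bilin G x x.
    move: Hx; rewrite ler_norml => /andP[Hx _].
    have E : n2a / (2 * c ^+ 4) = n2a / (4 * c ^+ 4) + n2a / (4 * c ^+ 4).
      by field; rewrite gt_eqF.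
    by lra.
  have -> : kap * n2a = 1 / 2 * (n2a / (4 * c ^+ 4)) by rewrite /kap; field; rewrite gt_eqF.
  apply: ler_pM => //; first by rewrite divr_ge0// mulr_ge0// ltW.
  by have /andP[] := NN.
have [] := @lasso_rate _ _ _ _ X delta j n2 p1 beta alpha G0 (ltW pen0) argmin noise s kap pen0 kap0 sE (or_intror RE).
set h := alpha - _ => H1 H2.
have errE i : err i 0 = dd i * h i 0.
  by rewrite /err (@lasso_beta_diff _ _ _ _ X j beta alpha G0) D_invsqrtE.
have pen_le : pen <= delta * m * rho by rewrite penE ler_pM2r// ler_pM2l.
have kV : 0 <= kap^-1 by rewrite invr_ge0 ltW.
have kE : kap^-1 = 8 * c ^+ 4 by rewrite /kap mul1r invrK.
split.
  apply: (@le_trans _ _ (m * (12 * (delta * m * rho) / kap * s%:R))).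
    apply: (@le_trans _ _ (m * \sum_i `|h i 0|)).
      rewrite /norm1 mulr_sumr; apply: ler_sum => i _.
      rewrite errE normrM (gtr0_norm (dd0 i)) ler_wpM2r//.
      by have /andP[] := dd_bounds i.
    rewrite ler_pM2l//; apply: le_trans H1 _; rewrite ler_wpM2r// ler_wpM2r//.
    by rewrite ler_pM2l.
  rewrite kE.
  have -> : m * (12 * (delta * m * rho) * (8 * c ^+ 4) * s%:R) =
     m ^+ 2 * (96 * delta * rho * c ^+ 4 * s%:R) by ring.
  by rewrite m2 le_eqVlt; apply/orP; left; apply/eqP; ring.
apply: (@le_trans _ _ (m * (3 * (delta * m * rho) / kap * Num.sqrt s%:R))).
  apply: (@le_trans _ _ (m * Num.sqrt (\sum_i h i 0 ^+ 2))).
    rewrite /norm2 -[X in X * _](gtr0_norm m0) -sqrtr_sqr -sqrtrM ?sqr_ge0//.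
    rewrite ler_wsqrtr// mulr_sumr; apply: ler_sum => i _.
    rewrite errE exprMn ler_wpM2r ?sqr_ge0// ler_sqr ?nnegrE ?(ltW m0) ?(ltW (dd0 i))//.
    by have /andP[] := dd_bounds i.
  rewrite ler_pM2l//; apply: le_trans H2 _; rewrite ler_wpM2r ?sqrtr_ge0// ler_wpM2r//.
  by rewrite ler_pM2l.
rewrite kE.
have -> : m * (3 * (delta * m * rho) * (8 * c ^+ 4) * Num.sqrt s%:R) =
   m ^+ 2 * (24 * delta * rho * c ^+ 4 * Num.sqrt s%:R) by ring.
by rewrite m2 le_eqVlt; apply/orP; left; apply/eqP; ring.
Qed.

End lasso_event.

(** * Rates *)

Section union_bound.
Context (d : measure_display) (T : measurableType d) (R : realType).
Variables (P : probability T R) (I : finType) (E : I -> set T).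
Hypothesis mE : forall i, measurable (E i).

Lemma bigcup_enum : \bigcup_(i in [set: I]) E i = \big[setU/set0]_(i <- enum I) E i.
Proof.
rewrite -bigcup_seq; apply/seteqP; split => w [i _ Ei]; exists i => //=.
by rewrite mem_enum.
Qed.

Lemma measurable_bigcup_finType : measurable (\bigcup_(i in [set: I]) E i).
Proof. by rewrite bigcup_enum; exact: bigsetU_measurable. Qed.

Lemma probability_union_le (x : R) : (forall i, P (E i) <= x%:E)%E ->
  (P (\bigcup_(i in [set: I]) E i) <= (#|I|%:R * x)%:E)%E.
Proof.
move=> Ex; rewrite bigcup_enum.
apply: (@le_trans _ _ (\sum_(i <- enum I) P (E i))%E).
  elim: (enum I) => [|i l IH]; first by rewrite !big_nil measure0.
  rewrite !big_cons; apply: le_trans (measureU2 _ _ _) _ => //.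
    exact: bigsetU_measurable.
  exact: leeD2l.
apply: (@le_trans _ _ (\sum_(i <- enum I) x%:E)%E); first exact: lee_sum.
by rewrite sumEFin lee_fin big_const_seq count_predT -cardE iter_addr addr0 mulr_natl.
Qed.

End union_bound.

(** The choice of 12: since 144 / 32 > 4, each deviation event has probability at most 2 M^-4, M =
    max (q, np), small enough for a union over about q^2 vectors. *)
Lemma deviation_exponent_ge (R : realType) (l k m : R) : 0 < l -> 0 < k -> k / 2 <= m ->
  4 * l <= 12 ^+ 2 * (l / k) * m / 16.
Proof.
move=> l0 k0 km; have h : 0 <= l / k by rewrite divr_ge0// ltW.
have := ler_wpM2l h km; have := divfK (lt0r_neq0 k0) l.
move: (l / k) => x xk xm; have := ltW l0; rewrite -xk; lra.
Qed.

(** * The estimate for a single problem *)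

Section fixed_size.
Variables (R : realType) (n p q : nat) (c delta : R).
Hypotheses (n2 : (2 <= n)%N) (p1 : (1 <= p)%N) (q2 : (2 <= q)%N).
Hypotheses (c0 : 0 < c) (delta_ge : 48 * c ^+ 4 <= delta).
Context (d : measure_display) (T : measurableType d).
Variables (P : probability T R) (X : 'I_n -> T -> 'M[R]_(p, q)).
Variables (mu : 'M[R]_(p, q)) (Sigma : 'M[R]_p) (Psi : 'M[R]_q).
Hypotheses (sSigma : Sigma^T = Sigma) (hSigma : eigenvalues_in Sigma c^-1 c).
Hypotheses (sPsi : Psi^T = Psi) (hPsi : eigenvalues_in Psi c^-1 c).
Hypothesis indepX : mutually_independent P X.
Hypothesis lawX : forall k, matrix_normal_law P (X k) mu Sigma Psi.
Variable alpha : 'I_q -> T -> 'cV[R]_q.-1.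
Hypothesis lasso : {ae P, forall w, forall j,
  lasso_argmin (fun k => X k w) delta j (alpha j w)}.

Let N : R := (n * p)%:R.
Let L := log_dim R n p q.
Let rho := Num.sqrt (L / N).
Let G w := Psi_hat (fun k => X k w).
Let t := \tr Sigma / p%:R.
Let e := 12 * rho.
Let err j w := lasso_beta (fun k => X k w) j (alpha j w) - regression_coef Psi j.

Let c1 : 1 <= c. Proof. by apply: (eigenvalue_bound_ge1 c0 sPsi hPsi); apply: leq_trans q2. Qed.
Let np2 : (2 <= n * p)%N.
Proof. by rewrite (leq_trans n2)// leq_pmulr. Qed.
Let M0 : 2 <= (maxn q (n * p))%:R :> R.
Proof. by rewrite (ler_nat R 2) leq_max q2. Qed.
Let N0 : 0 < N. Proof. by rewrite ltr0n (leq_trans _ np2). Qed.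
Let L0 : 0 < L.
Proof. by rewrite /L /log_dim ln_gt0//; apply: lt_le_trans M0; rewrite ltr1n. Qed.
Let rho0 : 0 < rho. Proof. by rewrite sqrtr_gt0 divr_gt0. Qed.

Let tc : c^-1 <= t <= c.
Proof.
have /andP[H1 H2] := trace_bounds sSigma hSigma.
have pR : (0 : R) < p%:R by rewrite ltr0n.
by rewrite /t ler_pdivlMr// ler_pdivrMr// H1 H2.
Qed.

Let bilin_gt0 (v : 'rV[R]_q) : v != 0 -> 0 < bilin Psi v v.
Proof.
move=> v0; have /andP[H _] := bilin_Psi_bounds sPsi hPsi v; apply: lt_le_trans H.
by rewrite mulr_gt0 ?invr_gt0// mulmx_tr_gt0.
Qed.

Let bilin0 (H : 'M[R]_q) : bilin H 0 0 = 0.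
Proof. by rewrite /bilin !mul0mx mxE. Qed.

Let tail v := quad_Psi_hat_tail_neq0 n2 p1 c0 sSigma hSigma indepX lawX (v := v) (Psi := Psi).

Let bad v := [set w | e * (c * bilin Psi v v) < `|bilin (G w) v v - t * bilin Psi v v|].

Let mbilin v : measurable_fun setT (fun w => bilin (G w) v v).
Proof.
(* The zero vector does occur in [family] below, as e_i - e_i, while [tail] requires a positive
   variance. *)
have [->|v0] := eqVneq v 0; last by have [] := tail (bilin_gt0 v0).
have -> : (fun w => bilin (G w) 0 0) = cst 0 by apply/funext => w; rewrite bilin0.
exact: measurable_cst.
Qed.

Let mbad v : measurable (bad v).
Proof.
have mf : measurable_fun setT (fun w => `|bilin (G w) v v - t * bilin Psi v v|).
  by apply: measurableT_comp => //; apply: measurable_funB => //; exact: mbilin.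
have -> : bad v = (fun w => `|bilin (G w) v v - t * bilin Psi v v|) @^-1`
    `]e * (c * bilin Psi v v), +oo[.
  by apply/seteqP; split => w; rewrite /= in_itv/= andbT.
by rewrite -[_ @^-1` _]setTI; exact: mf.
Qed.

Let Pbad v : e <= 1 -> (P (bad v) <= (2 * ((maxn q (n * p))%:R ^- 4))%:E)%E.
Proof.
move=> e1; have [->|v0] := eqVneq v 0.
  have -> : bad 0 = set0.
    by apply/seteqP; split => w //=; rewrite /bad /= !bilin0 !mulr0 subrr normr0 ltxx.
  by rewrite measure0 lee_fin mulr_ge0// invr_ge0 exprn_ge0// (le_trans _ M0).
have [_ H _] := tail (bilin_gt0 v0).
apply: le_trans (H e _) _; first by rewrite e1 mulr_ge0// ltW.
rewrite lee_fin ler_pM2l//.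
have -> : (maxn q (n * p))%:R ^- 4 = expR (- (4 * L)) :> R.
  rewrite expRN; congr (_^-1).
  have -> : expR (4 * L) = expR L ^+ 4 by rewrite -expRM_natl.
  by rewrite /L /log_dim lnK// posrE; apply: lt_le_trans M0.
rewrite ler_expR lerN2 /e exprMn sqr_sqrtr; last by rewrite divr_ge0// ltW.
have n1p : N / 2 <= (n.-1 * p)%:R.
  have pR : (0 : R) < p%:R by rewrite ltr0n.
  have nR : (2 : R) <= n%:R by rewrite (ler_nat R 2 n).
  rewrite /N !natrM -subn1 natrB ?(leq_trans _ n2)// mulrAC ler_pM2r//; lra.
exact: deviation_exponent_ge.
Qed.

(* The two booleans choose the second summand and the sign. *)
Let family (i : 'I_q * 'I_q * (bool * bool)) : 'rV[R]_q :=
  let u := if i.2.1 then delta_mx 0 i.1.2 else residual_vector Psi i.1.2 in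
  if i.2.2 then delta_mx 0 i.1.1 + u else delta_mx 0 i.1.1 - u.

Let A1 := ~` \bigcup_(i in [set: 'I_q * 'I_q * (bool * bool)]) bad (family i).
Let A2 := ~` \bigcup_(i in [set: 'I_q]) [set w | G w i i = 0].

Let mA1 : measurable A1.
Proof. by apply: measurableC; exact: measurable_bigcup_finType. Qed.

Let mdiag i : measurable [set w | G w i i = 0].
Proof.
have -> : [set w | G w i i = 0] = (fun w => bilin (G w) (delta_mx 0 i) (delta_mx 0 i)) @^-1` [set 0].
  by apply/seteqP; split => w /=; rewrite bilin_delta.
by rewrite -[_ @^-1` _]setTI; exact: mbilin.
Qed.

Let mA2 : measurable A2.
Proof. by apply: measurableC; exact: measurable_bigcup_finType. Qed.

Let PA2 : P (~` A2) = 0%E.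
Proof.
apply/eqP; rewrite eq_le measure_ge0 andbT /A2 setCK.
apply: le_trans (probability_union_le (x := 0) mdiag _) _; last by rewrite mulr0.
move=> i; have di0 : (delta_mx 0 i : 'rV[R]_q) != 0.
  apply/eqP => /rowP/(_ i); rewrite !mxE !eqxx => /eqP; by rewrite oner_eq0.
have [_ _ H] := tail (bilin_gt0 di0).
have -> : [set w | G w i i = 0] =
    [set w | ((delta_mx 0 i : 'rV[R]_q) *m Psi_hat (fun k => X k w) *m (delta_mx 0 i : 'rV[R]_q)^T) 0 0 = 0].
  by apply/seteqP; split => w /=; rewrite -[(_ *m _ *m _) 0 0]/(bilin _ _ _) bilin_delta.
by rewrite H.
Qed.

(** There are 4 q^2 vectors in [family], and q^2 N <= M^3 <= M^4 for M = max (q, np). *)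
Let PA1 : e <= 1 -> (P (~` A1) <= (8 / N)%:E)%E.
Proof.
move=> e1; rewrite /A1 setCK.
apply: le_trans (probability_union_le (fun i => mbad (family i)) (fun i => Pbad (family i) e1)) _.
rewrite !card_prod !card_ord card_bool lee_fin !natrM.
set M := (maxn q (n * p))%:R : R.
have qM : q%:R <= M by rewrite ler_nat leq_maxl.
have NM : N <= M by rewrite ler_nat leq_maxr.
have Mp : 0 < M by apply: lt_le_trans M0.
have qq : q%:R * q%:R <= M ^+ 2 by rewrite expr2 ler_pM.
rewrite ler_pdivlMr//.
have -> : q%:R * q%:R * (2 * 2) * (2 * M ^- 4) * N = 8 * (q%:R * q%:R) * N / M ^+ 4.
  by field; rewrite gt_eqF.
rewrite ler_pdivrMr ?exprn_gt0//.
have M1 : 1 <= M by apply: le_trans M0; rewrite ler1n.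
have h : q%:R * q%:R * N <= M ^+ 2 * M by apply: ler_pM => //; rewrite ?mulr_ge0// ltW.
have : M ^+ 2 * M <= M ^+ 4.
  have -> : M ^+ 4 = M ^+ 2 * M * M by ring.
  by rewrite ler_peMr// mulr_ge0 ?sqr_ge0// ltW.
lra.
Qed.

Lemma fixed_size_rate (s : nat) : (forall j, (nnz (regression_coef Psi j) <= s)%N) ->
  s%:R * e <= 1 / (128 * c ^+ 8) ->
  exists A : set T, [/\ measurable A, ((1 - 8 / N)%:E <= P A)%E &
    forall w, A w -> forall j,
      norm1 (err j w) <= 192 * c ^+ 6 * delta * (s%:R * rho) /\
      norm2 (err j w) <= 48 * c ^+ 6 * delta * (Num.sqrt s%:R * rho)].
Proof.
move=> ns se.
(* The selection [alpha] is arbitrary, so the exceptional set of [lasso] is replaced by a measurable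
   null set containing it. *)
have [B [mB PB sB]] := lasso.
pose small := e <= 1 / (2 * c ^+ 4).
(* If [e] is not small, no deviation bound is imposed and the case s = 0 is settled by
   [lasso_event_null]. Almost surely nonzero diagonal entries are required in both cases, for
   D_j^(-1/2) to be meaningful. *)
pose A := (if small then A1 else setT) `&` A2 `&` ~` B.
have c40 : 0 < c ^+ 4 by exact: exprn_gt0.
have delta0 : 0 <= delta by apply: le_trans delta_ge; rewrite mulr_ge0// ltW.
have mS : measurable (if small then A1 else setT) by [case: ifP => _; [exact: mA1|exact: measurableT]].
exists A; split.
- by apply: measurableI; [exact: measurableI|exact: measurableC].
- have PC : (P (~` A) <= (8 / N)%:E)%E.
    rewrite /A !setCI (setCK B); apply: le_trans (measureU2 _ _ _) _ => //.
      by apply: measurableU; exact: measurableC.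
    rewrite [X in (_ + X)%E](_ : _ = 0%E) ?adde0; last exact: PB.
    apply: le_trans (measureU2 _ _ _) _; [exact: measurableC|exact: measurableC|].
    rewrite [X in (_ + X)%E](_ : _ = 0%E) ?adde0; last exact: PA2.
    case: ifP => [sm|_]; last by rewrite setCT measure0 lee_fin divr_ge0// ltW.
    apply: PA1; apply: le_trans sm _; rewrite ler_pdivrMr ?mulr_gt0// mul1r.
    by have : 1 <= c ^+ 4 by [rewrite expr_ge1// ltW]; lra.
  have mAA : measurable A.
    by apply: measurableI; [exact: measurableI|exact: measurableC].
  have := @probability_setC _ _ _ P _ mAA => PE.
  move: PC; rewrite PE; have := fin_num_measure P A mAA.
  by move/fineK => <-; rewrite -EFinB !lee_fin; lra.
move=> w [[Sw A2w] nBw] j.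
have argmin : forall j, lasso_argmin (fun k => X k w) delta j (alpha j w).
  by apply: contrapT => H; apply: nBw; apply: sB.
have G0 i : 0 < G w i i.
  rewrite lt_neqAle -[X in _ && (0 <= X)]bilin_delta Psi_hat_ge0 andbT eq_sym.
  by apply/negP => /eqP Gi; apply: A2w; exists i.
have rc : 0 <= 192 * c ^+ 6 * delta by rewrite mulr_ge0// mulr_ge0// exprn_ge0// ltW.
have rc' : 0 <= 48 * c ^+ 6 * delta by rewrite mulr_ge0// mulr_ge0// exprn_ge0// ltW.
move: Sw; case: ifP => [sm A1w|/negbT nsm _]; last first.
  (* The assumption [se] forces [s = 0], as [e] is not small. *)
  have s0 : s = 0%N.
    apply/eqP; rewrite -leqn0 leqNgt; apply/negP => s0.
    move: nsm; rewrite /small => /negP; apply.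
    have s1 : (1 : R) <= s%:R by rewrite ler1n.
    have e0 : 0 <= e by rewrite mulr_ge0// ltW.
    have ese : e <= s%:R * e by rewrite ler_peMl.
    apply: le_trans (le_trans ese se) _.
    have c81 : c ^+ 4 <= c ^+ 8.
      by have -> : c ^+ 8 = c ^+ 4 * c ^+ 4 by [ring]; rewrite ler_peMl ?(ltW c40)// expr_ge1// ltW.
    rewrite !mul1r lef_pV2 ?posrE ?mulr_gt0// ?exprn_gt0//; lra.
  have b0 : nnz (regression_coef Psi j) = 0%N.
    by apply/eqP; rewrite -leqn0 -s0.
  have big : 1 / (2 * c ^+ 4) < 12 * rho by rewrite ltNge.
  have [H1 H2] := lasso_event_null n2 p1 c1 rho0 delta_ge G0 (argmin j) b0 big.
  rewrite s0 sqrtr0 !mul0r !mulr0; split; [exact: H1|exact: H2].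
have devA i : `|bilin (G w) (family i) (family i) - t * bilin Psi (family i) (family i)| <=
    e * (c * bilin Psi (family i) (family i)).
  by rewrite leNgt; apply/negP => h; apply: A1w; exists i.
have dev1 i k : `|bilin (G w) (delta_mx 0 i + delta_mx 0 k) (delta_mx 0 i + delta_mx 0 k) -
      t * bilin Psi (delta_mx 0 i + delta_mx 0 k) (delta_mx 0 i + delta_mx 0 k)| <=
      e * (c * bilin Psi (delta_mx 0 i + delta_mx 0 k) (delta_mx 0 i + delta_mx 0 k)) /\
    `|bilin (G w) (delta_mx 0 i - delta_mx 0 k) (delta_mx 0 i - delta_mx 0 k) -
      t * bilin Psi (delta_mx 0 i - delta_mx 0 k) (delta_mx 0 i - delta_mx 0 k)| <=
      e * (c * bilin Psi (delta_mx 0 i - delta_mx 0 k) (delta_mx 0 i - delta_mx 0 k)).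
  by split; [exact: (devA (i, k, (true, true)))|exact: (devA (i, k, (true, false)))].
have dev2 i : `|bilin (G w) (delta_mx 0 i + residual_vector Psi j) (delta_mx 0 i + residual_vector Psi j) -
      t * bilin Psi (delta_mx 0 i + residual_vector Psi j) (delta_mx 0 i + residual_vector Psi j)| <=
      e * (c * bilin Psi (delta_mx 0 i + residual_vector Psi j) (delta_mx 0 i + residual_vector Psi j)) /\
    `|bilin (G w) (delta_mx 0 i - residual_vector Psi j) (delta_mx 0 i - residual_vector Psi j) -
      t * bilin Psi (delta_mx 0 i - residual_vector Psi j) (delta_mx 0 i - residual_vector Psi j)| <=
      e * (c * bilin Psi (delta_mx 0 i - residual_vector Psi j) (delta_mx 0 i - residual_vector Psi j)).
  by split; [exact: (devA (i, j, (false, true)))|exact: (devA (i, j, (false, false)))].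
have sjs : ((nnz (regression_coef Psi j))%:R : R) <= s%:R by rewrite ler_nat.
have sje : (nnz (regression_coef Psi j))%:R * e <= 1 / (128 * c ^+ 8).
  by apply: le_trans se; rewrite ler_wpM2r// mulr_ge0// ltW.
have [H1 H2] := lasso_event_rate n2 p1 c1 rho0 delta_ge G0 (argmin j) sPsi hPsi tc erefl sm dev1 dev2 erefl sje.
split.
  by apply: le_trans H1 _; rewrite ler_wpM2l// ler_wpM2r// ltW.
by apply: le_trans H2 _; rewrite ler_wpM2l// ler_wpM2r ?ler_wsqrtr// ltW.
Qed.

End fixed_size.

(** * From sparsity to the rates *)

Section rates.
Variables (R : realType) (s K L l e : R).
Hypotheses (s0 : 0 <= s) (K0 : 0 < K) (L0 : 0 < L) (l0 : 0 < l) (lL : l <= L).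
Hypothesis e0 : 0 <= e.

Lemma powR32 : L `^ (3 / 2) = L * Num.sqrt L.
Proof.
have -> : 3 / 2 = 1 + 2^-1 :> R by lra.
by rewrite powRD ?powRr1 ?powR12_sqrt ?(ltW L0)// gt_eqF ?implybT.
Qed.

(** The powers of K cancel, and of L^(3/2) one factor sqrt L is used up by the error rate sqrt (L /
    K). *)
Lemma l1_rate_le : s <= e * (Num.sqrt K / L `^ (3 / 2)) ->
  s * Num.sqrt (L / K) <= e * L^-1.
Proof.
rewrite powR32 => h; have h1 : 0 < Num.sqrt K by rewrite sqrtr_gt0.
have h2 : 0 < Num.sqrt L by rewrite sqrtr_gt0.
rewrite sqrtrM ?(ltW L0)// sqrtrV ?(ltW K0)//.
apply: le_trans (ler_wpM2r _ h) _; first by rewrite mulr_ge0 ?invr_ge0// ltW.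
rewrite le_eqVlt; apply/orP; left; apply/eqP; field; apply/and3P; split; by rewrite gt_eqF.
Qed.

Lemma powR_quarter (x : R) : 0 < x -> (x `^ (- (1 / 4))) ^+ 2 = (Num.sqrt x)^-1.
Proof.
move=> x0; rewrite expr2 -powRD; last by rewrite (gt_eqF x0) implybT.
have -> : - (1 / 4) - 1 / 4 = - 2^-1 :> R by lra.
by rewrite powRN powR12_sqrt// ltW.
Qed.

(** Squared, the left side is at most e^2 / sqrt (K L), and L may be replaced by the smaller l; the
    square root of s is why the sparsity bound is taken with e^2. *)
Lemma l2_rate_le : s <= e ^+ 2 * (Num.sqrt K / L `^ (3 / 2)) ->
  Num.sqrt s * Num.sqrt (L / K) <= e * (K * l) `^ (- (1 / 4)).
Proof.
rewrite powR32 => h; have h1 : 0 < Num.sqrt K by rewrite sqrtr_gt0.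
have h2 : 0 < Num.sqrt L by rewrite sqrtr_gt0.
have h3 : 0 < Num.sqrt l by rewrite sqrtr_gt0.
rewrite -ler_sqr ?nnegrE ?mulr_ge0 ?powR_ge0//.
rewrite !exprMn powR_quarter ?mulr_gt0// !sqr_sqrtr ?divr_ge0 ?(ltW L0) ?(ltW K0)//.
apply: le_trans (ler_wpM2r _ h) _; first by rewrite mulr_ge0 ?invr_ge0// ltW.
apply: (@le_trans _ _ (e ^+ 2 * (Num.sqrt K * Num.sqrt L)^-1)).
  have aux (k m f : R) : 0 < k -> 0 < m ->
      f * (k / (m ^+ 2 * m)) * (m ^+ 2 / k ^+ 2) = f * (k * m)^-1.
    by move=> k0 m0; field; rewrite !gt_eqF.
  have := aux _ _ (e ^+ 2) h1 h2.
  by rewrite (sqr_sqrtr (ltW L0)) (sqr_sqrtr (ltW K0)) => ->.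
rewrite ler_wpM2l ?sqr_ge0// sqrtrM ?(ltW K0)// lef_pV2 ?posrE ?mulr_gt0//.
by rewrite ler_wpM2l ?(ltW h1)// ler_wsqrtr.
Qed.

End rates.

(** One constant [M] serves every eps, because the failure probability tends to 0. *)
Lemma bigO_probability_of_events (R : realType) (d : nat -> measure_display)
    (T : forall N, measurableType (d N)) (P : forall N, probability (T N) R)
    (Y : forall N, T N -> R) (a : nat -> R) (m : nat -> nat) (b M : R) :
  0 < M -> m @ \oo --> \oo ->
  (\forall N \near \oo, exists A : set (T N),
      [/\ measurable A, ((1 - b / (m N)%:R)%:E <= P N A)%E
        & forall w, A w -> `|Y N w| <= M * `|a N| ]) ->
  bigO_probability P Y a.
Proof.
move=> M0 /cvgnyPge mo evA eps eps0; exists M => //.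
near=> N; have : exists A : set (T N),
    [/\ measurable A, ((1 - b / (m N)%:R)%:E <= P N A)%E
      & forall w, A w -> `|Y N w| <= M * `|a N| ] by near: N.
move=> [A [mA PA YA]]; exists A; split => //; apply: le_trans PA.
rewrite lee_fin lerD2l lerN2.
have mN : (Num.bound (`|b| / eps) <= m N)%N by near: N; exact: mo.
have bm : `|b| / eps < (m N)%:R.
  by apply: lt_le_trans (archi_boundP _) _; rewrite ?ler_nat// divr_ge0// ltW.
have m0 : 0 < (m N)%:R :> R by apply: le_lt_trans bm; rewrite divr_ge0// ltW.
rewrite ler_pdivrMr//; apply: le_trans (ler_norm _) _.
by move: bm; rewrite ltr_pdivrMr// mulrC => /ltW.
Unshelve. all: by end_near. Qed.

Theorem proposition4 (R : realType) (c : R) (hc : 0 < c) :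
  exists2 delta0 : R, 0 < delta0 &
  forall (n p q : nat -> nat)
    (hn : forall N, (2 <= n N)%N)
    (hp : forall N, (1 <= p N)%N)
    (hq : forall N, (2 <= q N)%N)
    (mu : forall N, 'M[R]_(p N, q N))
    (Sigma : forall N, 'M[R]_(p N))
    (Psi : forall N, 'M[R]_(q N))
    (hSigma : forall N, posdefmx (Sigma N))
    (hPsi : forall N, posdefmx (Psi N))
    (d : nat -> measure_display)
    (T : forall N, measurableType (d N))
    (P : forall N, probability (T N) R)
    (X : forall N, 'I_(n N) -> T N -> 'M[R]_(p N, q N))
    (hX_indep : forall N, mutually_independent (P N) (X N))
    (hX_law : forall N k,
      matrix_normal_law (P N) (X N k) (mu N) (Sigma N) (Psi N))
    (h_np : (fun N => (n N * p N)%N) @ \oo --> \oo)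
    (hSigma_eig : forall N, eigenvalues_in (Sigma N) c^-1 c)
    (hPsi_eig : forall N, eigenvalues_in (Psi N) c^-1 c)
    (h_sparse :
      (fun N => (\max_(j < q N) nnz (regression_coef (Psi N) j))%:R : R) =o_\oo
      (fun N => Num.sqrt (n N * p N)%:R
                / log_dim R (n N) (p N) (q N) `^ (3 / 2)))
    (delta : R) (hdelta : delta0 <= delta)
    (alpha_hat : forall N, 'I_(q N) -> T N -> 'cV[R]_(q N).-1)
    (h_lasso : forall N, {ae P N, forall w, forall j,
      lasso_argmin (fun k => X N k w) delta j (alpha_hat N j w)}),
  exists a1 a2 : nat -> R,
  [/\ a1 =o_\oo (fun N => (log_dim R (n N) (p N) (q N))^-1),
      a2 =o_\oo (fun N => ((n N * p N)%:R * ln (q N)%:R) `^ (- (1 / 4))),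
      bigO_probability P
        (fun N w => \big[Num.max/0]_(j < q N)
          norm1 (lasso_beta (fun k => X N k w) j (alpha_hat N j w)
                 - regression_coef (Psi N) j)) a1
    & bigO_probability P
        (fun N w => \big[Num.max/0]_(j < q N)
          norm2 (lasso_beta (fun k => X N k w) j (alpha_hat N j w)
                 - regression_coef (Psi N) j)) a2].
Proof.
exists (48 * c ^+ 4); first by rewrite mulr_gt0// exprn_gt0.
move=> n p q hn hp hq mu Sigma Psi hSigma hPsi d T P X hX_indep hX_law h_np
  hSigma_eig hPsi_eig h_sparse delta hdelta alpha_hat h_lasso.
pose s N := (\max_(j < q N) nnz (regression_coef (Psi N) j))%N.
pose K N : R := (n N * p N)%:R.
pose L N := log_dim R (n N) (p N) (q N).
pose rho N := Num.sqrt (L N / K N).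
have K0 N : 0 < K N by rewrite ltr0n muln_gt0 hp (leq_trans _ (hn N)).
have q1 N : (1 : R) < (q N)%:R by rewrite ltr1n.
have lq0 N : 0 < ln (q N)%:R :> R by rewrite ln_gt0.
have lqL N : ln (q N)%:R <= L N.
  rewrite /L /log_dim ler_ln ?ler_nat ?leq_maxl// posrE.
    by rewrite (lt_trans _ (q1 N)).
  by rewrite ltr0n (leq_trans _ (leq_maxl _ _))// (leq_trans _ (hq N)).
have L0 N : 0 < L N by exact: lt_le_trans (lqL N).
have ln20 : 0 < ln (2 : R) by rewrite ln_gt0// ltr1n.
have lnL N : ln (2 : R) <= L N.
  apply: le_trans (lqL N); rewrite ler_ln ?posrE// ?(lt_trans _ (q1 N))//.
  by rewrite (ler_nat R 2).
have rho0 N : 0 <= rho N by exact: sqrtr_ge0.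
have nrate N : 0 <= Num.sqrt (K N) / L N `^ (3 / 2).
  by rewrite divr_ge0 ?sqrtr_ge0 ?powR_ge0.
have sparse e : 0 < e -> \forall N \near \oo,
    (s N)%:R <= e * (Num.sqrt (K N) / L N `^ (3 / 2)).
  move=> e0; move/eqoP: h_sparse => /(_ e e0); apply: filterS => N.
  by rewrite ger0_norm// ger0_norm// nrate.
have c40 : 0 < c ^+ 4 by exact: exprn_gt0.
have c60 : 0 < c ^+ 6 by exact: exprn_gt0.
have c80 : 0 < c ^+ 8 by exact: exprn_gt0.
have delta0 : 0 < delta by apply: lt_le_trans hdelta; rewrite mulr_gt0.
(* These are the actual error rates; all factors c and delta go into the constants of O_P. *)
pose a1 N := (s N)%:R * rho N; pose a2 N := Num.sqrt (s N)%:R * rho N.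
have a1_ge0 N : 0 <= a1 N by rewrite mulr_ge0.
have a2_ge0 N : 0 <= a2 N by rewrite mulr_ge0 ?sqrtr_ge0.
have events : \forall N \near \oo, exists A : set (T N),
    [/\ measurable A, ((1 - 8 / K N)%:E <= P N A)%E &
    forall w, A w -> forall j,
      norm1 (lasso_beta (fun k => X N k w) j (alpha_hat N j w)
             - regression_coef (Psi N) j) <= 192 * c ^+ 6 * delta * a1 N /\
      norm2 (lasso_beta (fun k => X N k w) j (alpha_hat N j w)
             - regression_coef (Psi N) j) <= 48 * c ^+ 6 * delta * a2 N].
  (* Sparsity with this constant gives s rho <= e / L, and L >= ln 2 because q >= 2; hence 12 s rho
     <= 1 / (128 c^8), as [fixed_size_rate] demands. *)
  have e0 : 0 < ln (2 : R) / (12 * (128 * c ^+ 8)) by rewrite divr_gt0 ?mulr_gt0.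
  near=> N.
  apply: (fixed_size_rate (hn N) (hp N) (hq N) hc hdelta (hSigma N).1
    (hSigma_eig N) (hPsi N).1 (hPsi_eig N) (hX_indep N) (hX_law N) (h_lasso N)).
    by move=> j; exact: (leq_bigmax (F := fun j => nnz (regression_coef (Psi N) j))).
  have sN : (s N)%:R <= ln 2 / (12 * (128 * c ^+ 8)) * (Num.sqrt (K N) / L N `^ (3 / 2)).
    by near: N; exact: sparse.
  have := l1_rate_le (K0 N) (L0 N) sN.
  have : ln 2 / (12 * (128 * c ^+ 8)) * (L N)^-1 <= 1 / (12 * (128 * c ^+ 8)).
    rewrite mulrAC ler_wpM2r ?invr_ge0//; last by rewrite ler_pdivrMr// mul1r.
    by apply: mulr_ge0 => //; apply: mulr_ge0 => //; exact: ltW.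
  move=> h1 h2; have := le_trans h2 h1; rewrite -/(rho N).
  have -> : 1 / (12 * (128 * c ^+ 8)) = 1 / (128 * c ^+ 8) / 12.
    by rewrite [12 * _]mulrC invfM mulrA.
  by rewrite ler_pdivlMr// => h; rewrite mulrCA mulrC.
exists a1, a2; split.
- apply/eqoP => e e0; near=> N.
  rewrite ger0_norm// ger0_norm ?invr_ge0 ?(ltW (L0 N))//.
  by apply: (l1_rate_le (K0 N) (L0 N)); near: N; exact: sparse.
- apply/eqoP => e e0; near=> N.
  rewrite ger0_norm// ger0_norm ?powR_ge0//.
  apply: (l2_rate_le _ (K0 N) (L0 N) (lq0 N) (lqL N) (ltW e0)) => //.
  by near: N; apply: sparse; exact: exprn_gt0.
- apply: (bigO_probability_of_events (m := fun N => (n N * p N)%N) (b := 8)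
    (M := 192 * c ^+ 6 * delta)) => //; first by rewrite !mulr_gt0.
  apply: filterS events => N [A [mA PA H]]; exists A; split => // w Aw.
  rewrite (ger0_norm (a1_ge0 N)) ger0_norm; last exact: bigmax_ge_id.
  apply: bigmax_le => [|j _]; last by have [] := H w Aw j.
  by rewrite mulr_ge0// ltW// !mulr_gt0.
- apply: (bigO_probability_of_events (m := fun N => (n N * p N)%N) (b := 8)
    (M := 48 * c ^+ 6 * delta)) => //; first by rewrite !mulr_gt0.
  apply: filterS events => N [A [mA PA H]]; exists A; split => // w Aw.
  rewrite (ger0_norm (a2_ge0 N)) ger0_norm; last exact: bigmax_ge_id.
  apply: bigmax_le => [|j _]; last by have [] := H w Aw j.
  by rewrite mulr_ge0// ltW// !mulr_gt0.
Unshelve. all: by end_near. Qed.
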